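(* Let $d\ge3$, $1\le p,\theta\le\infty$ and $s>1/p$. Let $\boldsymbol\alpha=(\alpha_1,\dots,\alpha_{d-1})\in(\mathbb R\setminus\mathbb Q)^{d-1}$ be of approximation type $1$, and for $N\in\mathbb N$ let $$\mathcal P_N(\boldsymbol\alpha)=\Bigl\{\Bigl(\frac nN,\{n\alpha_1\},\dots,\{n\alpha_{d-1}\}\Bigr):n=0,1,\dots,N-1\Bigr\}.$$ Then for every $\delta>0$ there is a constant $C<\infty$, independent of $N$, such that for all $N\in\mathbb N$ $$\mathrm{wce}\bigl(\mathcal P_N(\boldsymbol\alpha),\mathring{\mathbf B}^s_{p,\theta}\bigr)\;\le\;\frac{C}{N^{s-\delta}}.$$
   Context: Conventions: $\mathbb N=\{1,2,\dots\}$; $\{x\}$ is the fractional part of $x$; $\langle x\rangle=\min_{m\in\mathbb Z}|x-m|$ for $x\in\mathbb R$; for $\boldsymbol h\in\mathbb Z^{d-1}$, $r(\boldsymbol h)=\prod_{j=1}^{d-1}\max\{1,|h_j|\}$. Approximation type: $\boldsymbol\alpha\in(\mathbb R\setminus\mathbb Q)^{d-1}$ is of approximation type $\eta\in\mathbb R$ if $\eta$ is the infimum of all numbers $\sigma$ for which there is a constant $c=c(\sigma,\boldsymbol\alpha)>0$ with $r(\boldsymbol h)^\sigma\langle\boldsymbol h\cdot\boldsymbol\alpha\rangle\ge c$ for all $\boldsymbol h\in\mathbb Z^{d-1}\setminus\{\boldsymbol 0\}$, where $\boldsymbol h\cdot\boldsymbol\alpha$ is the inner product. Function space: for $f\in L_1(\mathbb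 R^d)$ let $\mathcal F f(\boldsymbol\xi)=\int_{\mathbb R^d}f(\boldsymbol y)e^{-2\pi \mathrm i\,\boldsymbol\xi\cdot\boldsymbol y}\,d\boldsymbol y$, extended to tempered distributions as usual. Let $\Psi_0\in C_0^\infty(\mathbb R)$ be the up-function, i.e. the function with support $[-1,1]$ and $\mathcal F\Psi_0(\xi)=\prod_{k=0}^\infty \mathrm{sinc}(2^{-k}\xi)$, $\mathrm{sinc}(\xi)=\sin(\pi\xi)/(\pi\xi)$. Fix a non-negative integer $L$ with $L+1>s$, and put $\Psi_1(x)=\frac{d^L}{dx^L}\bigl(2\Psi_0(2\,\cdot)-\Psi_0\bigr)(x)$, $\Psi_j(x)=2^{j-1}\Psi_1(2^{j-1}x)$ for $j\ge1$, and $\Psi_{\boldsymbol m}(\boldsymbol x)=\prod_{i=1}^d\Psi_{m_i}(x_i)$ for $\boldsymbol m\in\mathbb N_0^d$. The Besov space of dominating mixed smoothness $\mathbf B^s_{p,\theta}(\mathbb R^d)$ is the set of tempered distributions $f$ on $\mathbb R^d$ with $$\|f\|_{\mathbf B^s_{p,\theta}}=\Bigl(\sum_{\boldsymbol m\in\mathbb N_0^d}2^{s|\boldsymbol m|_1\theta}\|\Psi_{\boldsymbol m}*f\|_{L_p(\mathbb R^d)}^\theta\Bigr)^{1/\theta}<\infty$$ (supremum over $\boldsymbol m$ if $\theta=\infty$), where $|\boldsymbol m|_1=m_1+\dots+m_d$. Put $\mathring{\mathbf B}^s_{p,\theta}=\{f\in\mathbf B^s_{p,\theta}(\mathbb R^d):\mathrm{supp}(f)\subset[0,1]^d\}$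 with the same norm. Since $s>1/p$ (with $1/\infty:=0$), these functions are continuous. Worst-case error of a point set $\mathcal P=\{\boldsymbol x_0,\dots,\boldsymbol x_{N-1}\}\subset[0,1)^d$: $\mathrm{wce}(\mathcal P,\mathring{\mathbf B}^s_{p,\theta})=\sup\bigl\{\bigl|\int_{[0,1]^d}f(\boldsymbol x)\,d\boldsymbol x-\frac1N\sum_{n=0}^{N-1}f(\boldsymbol x_n)\bigr|: f\in\mathring{\mathbf B}^s_{p,\theta},\ \|f\|_{\mathbf B^s_{p,\theta}}\le1\bigr\}$. *)

(* Defs.v *)
(* MathComp-Analysis, over an arbitrary R : realType; complex numbers are R[i],
   which carries no topology or measurable structure over R, so continuity,
   smoothness and integrals are taken on real and imaginary parts. *)
From HB Require Import structures.
From mathcomp Require Import all_boot all_order all_algebra.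
From mathcomp Require Import all_classical all_reals all_analysis.
From mathcomp Require Import complex.

Set Implicit Arguments.
Unset Strict Implicit.
Unset Printing Implicit Defensive.

Import Order.TTheory GRing.Theory Num.Theory.
Import numFieldNormedType.Exports.

Local Open Scope classical_set_scope.
Local Open Scope complex_scope.
Local Open Scope ring_scope.

Definition rV_display : measure_display -> measure_display.
Proof. exact. Qed.

Section rV_measurable.
Context {d} {T : sigmaRingType d}.
Variable n : nat.

Let coors : 'I_n -> 'rV[T]_n -> T := fun i x => x 0 i.

Let rV_set0 : g_sigma_preimage coors set0.
Proof. exact: sigma_algebra0. Qed.

Let rV_setC A : g_sigma_preimage coors A -> g_sigma_preimage coors (~` A).
Proof. exact: sigma_algebraC. Qed.

Let rV_bigcup (F : (set _)^nat) : (forall i, g_sigma_preimage coors (F i)) ->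
  g_sigma_preimage coors (\bigcup_i (F i)).
Proof. exact: sigma_algebra_bigcup. Qed.

(* The product sigma-algebra; for T = R it is the Borel sigma-algebra of R^n. *)
HB.instance Definition _ := @isMeasurable.Build (rV_display d)
  'rV[T]_n (g_sigma_preimage coors) rV_set0 rV_setC rV_bigcup.

End rV_measurable.

Lemma measurable_coord d (T : sigmaRingType d) n (i : 'I_n) :
  measurable_fun [set: 'rV[T]_n] (fun x : 'rV[T]_n => x 0 i).
Proof.
move=> _ Y mY; rewrite setTI; apply: sub_sigma_algebra => /=.
rewrite -bigcup_seq/=; exists i => /=; first by rewrite mem_index_enum.
by exists Y => //; rewrite setTI.
Qed.

Lemma measurable_fun_rV d1 d2 (T1 : measurableType d1) (T2 : measurableType d2)
    n (f : T1 -> 'rV[T2]_n) :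
  (forall i, measurable_fun [set: T1] (fun x => f x 0 i)) ->
  measurable_fun [set: T1] f.
Proof.
move=> mf.
suff H : g_sigma_preimage (fun i => (fun v : 'rV[T2]_n => v 0 i) \o f)
    `<=` measurable.
  by rewrite g_sigma_preimage_comp in H => _ A mA; apply: H; exists A.
apply: smallest_sub; first exact: sigma_algebra_measurable.
case: n => [|n] in f mf *; first by rewrite big_ord0.
rewrite -bigcup_mkord_ord; apply: bigcup_sub => i Ii.
by move=> A [B mB <-]; exact: mf.
Qed.

Section lebesgue_rV.
Variable R : realType.

Definition rV_cons n (z : R * 'rV[R]_n) : 'rV[R]_n.+1 :=
  row_mx (const_mx z.1 : 'rV_1) z.2.

Lemma rV_cons0 n (z : R * 'rV[R]_n) : rV_cons z 0 0 = z.1.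
Proof.
have -> : (0 : 'I_n.+1) = lshift n (0 : 'I_1) by exact: val_inj.
by rewrite [LHS](row_mxEl (const_mx z.1 : 'rV_1) z.2) mxE.
Qed.

Lemma rV_consS n (z : R * 'rV[R]_n) j : rV_cons z 0 (lift ord0 j) = z.2 0 j.
Proof.
have -> : lift ord0 j = rshift 1 j by exact: val_inj.
exact: (row_mxEr (const_mx z.1 : 'rV_1) z.2).
Qed.

Definition rV_uncons n (v : 'rV[R]_n.+1) : R * 'rV[R]_n :=
  (v 0 0, \row_j v 0 (lift ord0 j)).

Lemma rV_consK n : cancel (@rV_cons n) (@rV_uncons n).
Proof.
move=> [x v]; rewrite /rV_uncons rV_cons0; congr pair.
by apply/rowP => j; rewrite mxE rV_consS.
Qed.

Lemma measurable_rV_cons n :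
  measurable_fun [set: measurableTypeR R * 'rV[R]_n] (@rV_cons n).
Proof.
apply: measurable_fun_rV => i.
case: (unliftP ord0 i) => [j ->|->].
  under eq_fun do rewrite rV_consS.
  exact: (measurableT_comp (@measurable_coord _ _ n j) measurable_snd).
under eq_fun do rewrite rV_cons0.
exact: measurable_fst.
Qed.

Lemma measurable_rV_uncons n :
  measurable_fun [set: 'rV[R]_n.+1]
    (@rV_uncons n : _ -> measurableTypeR R * 'rV[R]_n).
Proof.
apply: measurable_fun_pair; first exact: measurable_coord.
apply: measurable_fun_rV => i; under eq_fun do rewrite mxE.
exact: measurable_coord.
Qed.

Section step.
Variables (n : nat) (mu : {sigma_finite_measure set 'rV[R]_n -> \bar R}).

Definition lebesgue_rV_step : set 'rV[R]_n.+1 -> \bar R :=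
  pushforward (@lebesgue_measure R \x mu)%E (@rV_cons n).

Let step_measure : {measure set 'rV[R]_n.+1 -> \bar R} :=
  measure_function_pushforward__canonical__measure_function_Measure
    (@lebesgue_measure R \x mu)%E (@measurable_rV_cons n).

Let step0 : lebesgue_rV_step set0 = 0%E.
Proof. exact: (measure0 step_measure). Qed.

Let step_ge0 A : (0 <= lebesgue_rV_step A)%E.
Proof. exact: (measure_ge0 step_measure). Qed.

Let step_sigma_additive : semi_sigma_additive lebesgue_rV_step.
Proof. exact: (@measure_semi_sigma_additive _ _ _ step_measure). Qed.

HB.instance Definition _ := isMeasure.Build _ _ _ lebesgue_rV_step
  step0 step_ge0 step_sigma_additive.

Let step_sigma_finite : sigma_finite setT lebesgue_rV_step.
Proof.
have /sigma_finiteP[F [TF ndF Foo]] := sigma_finiteT (@lebesgue_measure R).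
have /sigma_finiteP[G [TG ndG Goo]] := sigma_finiteT mu.
exists (fun k => @rV_uncons n @^-1` (F k `*` G k)).
  apply/seteqP; split=> // v _.
  have [k _ Fk] : (\bigcup_k F k) (rV_uncons v).1 by rewrite -TF.
  have [l _ Gl] : (\bigcup_k G k) (rV_uncons v).2 by rewrite -TG.
  exists (maxn k l) => //; split.
  - by move: Fk; exact/subsetPset/ndF/leq_maxl.
  - by move: Gl; exact/subsetPset/ndG/leq_maxr.
move=> k; have [mFk Fkoo] := Foo k; have [mGk Gkoo] := Goo k; split.
  rewrite -[X in measurable X]setTI; apply: measurable_rV_uncons => //.
  exact: measurableX.
rewrite /lebesgue_rV_step /pushforward -comp_preimage.
rewrite (_ : _ \o _ = id); last by apply/funext => z /=; rewrite rV_consK.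
by rewrite preimage_id product_measure1E// lte_mul_pinfty// ge0_fin_numE.
Qed.

HB.instance Definition _ :=
  Measure_isSigmaFinite.Build _ _ _ lebesgue_rV_step step_sigma_finite.

End step.

(* The library only has binary products of measures. *)
Fixpoint lebesgue_rV n : {sigma_finite_measure set 'rV[R]_n -> \bar R} :=
  match n with
  | 0 => \d_(0 : 'rV[R]_0)
  | k.+1 => lebesgue_rV_step (lebesgue_rV k)
  end.

End lebesgue_rV.

Section approximation_type.
Variable R : realType.

Definition frac (x : R) : R := x - (Num.floor x)%:~R.

(* The minimum is attained, so it is the infimum. *)
Definition dist_int (x : R) : R := inf [set `|x - m%:~R| | m in [set: int]].

Definition height n (h : 'rV[int]_n) : R :=
  \prod_(j < n) Num.max 1 (`|h 0 j|%:~R).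

Definition inner_int n (h : 'rV[int]_n) (alpha : 'rV[R]_n) : R :=
  \sum_(j < n) (h 0 j)%:~R * alpha 0 j.

(* The infimum is taken in \bar R, where it is +oo on the empty set and -oo on
   a set that is not bounded below. *)
Definition approximation_type n (alpha : 'rV[R]_n) (eta : R) : Prop :=
  ereal_inf [set sigma%:E | sigma in
    [set sigma : R | exists2 c : R, 0 < c & forall h : 'rV[int]_n, h != 0 ->
       c <= height h `^ sigma * dist_int (inner_int h alpha)]] = eta%:E.

End approximation_type.

Section complex_functions.
Variable R : realType.
Implicit Types T : Type.

Definition cRe T (f : T -> R[i]) : T -> R := fun x => complex.Re (f x).
Definition cIm T (f : T -> R[i]) : T -> R := fun x => complex.Im (f x).

Definition cabs (z : R[i]) : R := ComplexField.Normc.normc z.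

Definition expi (t : R) : R[i] := cos t +i* sin t.

Definition cintegral d (T : measurableType d) (mu : {measure set T -> \bar R})
    (D : set T) (f : T -> R[i]) : R[i] :=
  Rintegral mu D (cRe f) +i* Rintegral mu D (cIm f).

Definition Lp_norm n (p : \bar R) (f : 'rV[R]_n -> R[i]) : \bar R :=
  Lnorm (lebesgue_rV R n) p (fun x => (cabs (f x))%:E).

Definition fourier1 (f : R -> R[i]) (xi : R) : R[i] :=
  cintegral (@lebesgue_measure R) setT
    (fun y => f y * expi (- (2 * pi * xi * y))).

(* The mixed partial derivative along the coordinates listed in l. *)
Definition mpartial n (l : seq 'I_n) (f : 'rV[R]_n -> R) : 'rV[R]_n -> R :=
  foldr (fun i g x => 'D_(delta_mx 0 i) g x) f l.

Definition cmpartial n (l : seq 'I_n) (f : 'rV[R]_n -> R[i]) :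
    'rV[R]_n -> R[i] :=
  fun x => mpartial l (cRe f) x +i* mpartial l (cIm f) x.

Definition smooth n (f : 'rV[R]_n -> R) : Prop := forall l : seq 'I_n,
  continuous (mpartial l f) /\
  forall i x, derivable (mpartial l f) x (delta_mx 0 i).

Definition csmooth n (f : 'rV[R]_n -> R[i]) : Prop :=
  smooth (cRe f) /\ smooth (cIm f).

Definition ccontinuous n (f : 'rV[R]_n -> R[i]) : Prop :=
  continuous (cRe f) /\ continuous (cIm f).

Definition fsupport n (f : 'rV[R]_n -> R[i]) : set 'rV[R]_n :=
  closure [set x | f x <> 0].

Definition test_function n (f : 'rV[R]_n -> R[i]) : Prop :=
  csmooth f /\ compact (fsupport f).

End complex_functions.

Section tempered_distributions.
Variables (R : realType) (n : nat).
Implicit Types (f g : 'rV[R]_n -> R[i]) (T : ('rV[R]_n -> R[i]) -> R[i]).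

(* The value at x of a weighted partial derivative of f; f is a Schwartz
   function iff all of them are bounded in x, and the suprema over x are the
   seminorms that define the topology of the Schwartz space. *)
Definition schwartz_weight k (l : seq 'I_n) f (x : 'rV[R]_n) : R :=
  (1 + `|x|) ^+ k * cabs (cmpartial l f x).

Definition schwartz f : Prop :=
  csmooth f /\ forall k l, exists M : R, forall x, schwartz_weight k l f x <= M.

(* T is a total function on 'rV[R]_n -> R[i] of which only the values on
   Schwartz functions are constrained or used.  The second conjunct is
   continuity at 0, to which continuity of a linear map reduces. *)
Definition tempered_distribution T : Prop :=
  (forall (a : R[i]) f g, schwartz f -> schwartz g ->
     T (fun x => a * f x + g x) = a * T f + T g) /\
  (forall eps : R, 0 < eps -> exists k (delta : R), 0 < delta /\
     forall f, schwartz f ->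
       (forall j l x, (j <= k)%N -> (size l <= k)%N ->
          schwartz_weight j l f x <= delta) ->
       cabs (T f) <= eps).

Definition dsupport T : set 'rV[R]_n :=
  [set x | forall U : set 'rV[R]_n, open U -> U x ->
     exists f, [/\ test_function f, fsupport f `<=` U & T f <> 0]].

Definition dconvolution (psi : 'rV[R]_n -> R) T : 'rV[R]_n -> R[i] :=
  fun x => T (fun y => (psi (x - y))%:C).

Definition continuous_version T g : Prop :=
  ccontinuous g /\ forall f, test_function f ->
    T f = cintegral (lebesgue_rV R n) setT (fun x => g x * f x).

End tempered_distributions.

Section besov.
Variable R : realType.

Definition sinc (x : R) : R := if x == 0 then 1 else sin (pi * x) / (pi * x).

Definition up_function (Psi0 : R -> R) : Prop :=
  [/\ forall k x, derivable (derive1n k Psi0) x 1,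
      closure [set x | Psi0 x <> 0] = `[-1, 1]%classic &
      forall xi, fourier1 (fun y => (Psi0 y)%:C) xi =
        (limn (fun k : nat => \prod_(0 <= j < k) sinc (2 ^- j * xi)))%:C].

Variables (Psi0 : R -> R) (L : nat).

Definition Psi1 : R -> R := derive1n L (fun x => 2 * Psi0 (2 * x) - Psi0 x).

Definition Psi (j : nat) : R -> R :=
  match j with
  | 0 => Psi0
  | k.+1 => fun x => 2 ^+ k * Psi1 (2 ^+ k * x)
  end.

Variable d : nat.
Implicit Types (m : {ffun 'I_d -> nat}) (T : ('rV[R]_d -> R[i]) -> R[i]).

Definition mPsi m (x : 'rV[R]_d) : R := \prod_(i < d) Psi (m i) (x 0 i).

Definition norm1 m : nat := (\sum_(i < d) m i)%N.

(* For p and theta at least 1; the supremum branch is theta = +oo. *)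
Definition besov_norm (s : R) (p theta : \bar R) T : \bar R :=
  (match theta with
   | t%:E =>
       (\esum_(m in [set: {ffun 'I_d -> nat}])
          (2 `^ (s * (norm1 m)%:R * t))%:E *
          poweR (Lp_norm p (dconvolution (mPsi m) T)) t) `^ t^-1
   | _ => ereal_sup [set (2 `^ (s * (norm1 m)%:R))%:E *
                         Lp_norm p (dconvolution (mPsi m) T) | m in setT]
   end)%E.

Definition cube : set 'rV[R]_d := [set x | forall i, 0 <= x 0 i <= 1].

Definition besov_ring (s : R) (p theta : \bar R) T : Prop :=
  [/\ tempered_distribution T, (besov_norm s p theta T < +oo)%E &
      dsupport T `<=` cube].

Definition quadrature_error N (x : 'I_N -> 'rV[R]_d) (g : 'rV[R]_d -> R[i]) : R
  := cabs (cintegral (lebesgue_rV R d) cube g -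
           N%:R^-1 * \sum_(n < N) g (x n)).

(* When 1/p < s every element of the space has exactly one continuous
   version, and it is this function that the quadrature rule evaluates. *)
Definition wce N (x : 'I_N -> 'rV[R]_d) (s : R) (p theta : \bar R) : \bar R :=
  ereal_sup [set e | exists T g,
    [/\ besov_ring s p theta T, (besov_norm s p theta T <= 1)%E,
        continuous_version T g & e = (quadrature_error x g)%:E]].

End besov.

Definition kronecker_points (R : realType) (k : nat) (alpha : 'rV[R]_k)
    (N : nat) : 'I_N -> 'rV[R]_k.+1 :=
  fun n => rV_cons (n%:R / N%:R, \row_(j < k) frac (n%:R * alpha 0 j)).

(* Main.v *)
Require Import Defs.
From mathcomp Require Import all_boot all_order all_algebra.
From mathcomp Require Import all_classical all_reals all_analysis.
From mathcomp Require Import complex measurable_realfun.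
From mathcomp Require Import ring lra zify.

Set Implicit Arguments.
Unset Strict Implicit.
Unset Printing Implicit Defensive.

Import Order.TTheory GRing.Theory Num.Theory.
Import numFieldNormedType.Exports.

Local Open Scope classical_set_scope.
Local Open Scope ring_scope.

(** Let [Psi_j] be the one-dimensional level functions of the Besov norm.  One
    constructs compactly supported kernels [kappa_j], [supp kappa_j] in
    [[- c 2^-j, c 2^-j]], such that [sum_(j <= J) kappa_j * Psi_j = U_J] is an
    approximate identity; no Fourier inversion is needed.  The key point is that
    [f - a * f] is the convolution of [f'] with a bounded compactly supported
    kernel when [a] has integral 1.  Tensorizing, the quadrature error of [f]
    equals [sum_m int (Psi_m * f) e_m], where [e_m (y)] is the error of the
    Kronecker points for the translated kernel [kappa_m (. - y)].

    If [2^|m| <= N^(1 - e)], then [e_m] is smaller than any power of [N]: the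
    periodizations of [kappa_(m_j)] are approximated by trigonometric polynomials
    with iterated Fejer means, and each frequency [h <> 0] is killed by repeated
    Abel summation in [n], where the approximation type bounds
    [|1 - exp (2 i pi h . alpha)|] from below.  If [2^|m| > N^(1 - e)], then
    [kappa_m] is dominated by a smooth bump living at a coarser level to which
    the previous case applies, so that [|e_m| <= C 2^|m| N^-(1 - e)] while
    [int |e_m| <= C].  Since [||Psi_m * f||_p <= 2^(- s |m|)], Hoelder's inequality
    makes the series over [m] converge to [O (N^(- s + delta))]. *)

(** The obstacle is the boundary of the cube: a translated kernel may stick out of it, where the
    Kronecker set stops. As f vanishes outside the cube, the set may be continued, by integer
    translates in the last d - 1 coordinates and by further indices n in the first. Each kernel then
    sees a complete lattice sum, periodized in the last coordinates and cut off only by the kernel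
    itself in the first, so that Abel summation has no boundary terms. Smallness rests on one
    principle: each order of smoothness gains a factor N^-e2, while everything else loses a fixed
    power of N. Crude bounds therefore suffice, and the order M is chosen last. The threshold
    concerns the total |m| because the approximation type is stated with the product r(h):
    frequencies |h_j| < 2^(m_j + v) have r(h) <= 2^(m_1 + ... + m_(d-1) + (d-1) v), and the loss
    2^(m_0) / |1 - exp (2 i pi h . alpha)| is essentially 2^|m| up to a small power of N. The error
    kernels are controlled in L_1 and in the sup norm; a small part of the smoothness s is held back
    so that the sum over m is a convergent geometric series. *)

Lemma eq_bound (R : realType) (x y : R) : x = y -> x <= y.
Proof. by move=> ->. Qed.

(** * Bounded functions with support of finite measure: integrability and Fubini *)

Section bounded_integrals.
Context d (T : measurableType d) (R : realType).
Variable mu : {measure set T -> \bar R}.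

Lemma bounded_integrable (A : set T) (B : R) (f : T -> R) :
  measurable A -> (mu A < +oo)%E -> measurable_fun setT f ->
  (forall x, `|f x| <= B) -> (forall x, ~ A x -> f x = 0) ->
  mu.-integrable setT (EFin \o f).
Proof.
move=> mA Aoo mf fB f0.
have : mu.-integrable A (EFin \o f).
  apply: measurable_bounded_integrable => //; first exact: measurable_funTS.
  exists B; split; first exact: num_real.
  by move=> M BM x Ax; apply: le_trans (fB x) (ltW BM).
rewrite (integrable_mkcond _ mA); congr (_.-integrable _ _).
apply/funext => x; rewrite patchE; case: ifPn => //.
by rewrite notin_setE => /f0 fx; rewrite /= fx.
Qed.

Lemma le_Rintegral_bound (A : set T) (B : R) (f : T -> R) :
  measurable A -> (mu A < +oo)%E -> measurable_fun setT f ->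
  (forall x, `|f x| <= B) -> (forall x, ~ A x -> f x = 0) ->
  `|Rintegral mu setT f| <= B * fine (mu A).
Proof.
move=> mA Aoo mf fB f0.
have intf := bounded_integrable mA Aoo mf fB f0.
apply: le_trans (le_normr_Rintegral measurableT intf) _.
have B0 x : 0 <= B := le_trans (normr_ge0 _) (fB x).
have intA : mu.-integrable setT (EFin \o (fun x => B * \1_A x)).
  apply: (@bounded_integrable A `|B|) => //.
  - by apply: measurable_funM => //; exact: measurable_indic.
  - move=> x; rewrite normrM ler_piMr// indicE ger0_norm ?ler0n//.
    by case: (_ \in _).
  - by move=> x Ax; rewrite indicE memNset// mulr0.
apply: le_trans (le_Rintegral measurableT _ intA _) _.
- exact: integrable_norm.
- move=> x _; rewrite indicE; have [Ax|Ax] := pselect (A x).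
    by rewrite mem_set// mulr1.
  by rewrite memNset// mulr0 f0// normr0.
rewrite RintegralZl//; last first.
  apply: (@bounded_integrable A 1) => //.
  - by move=> x; rewrite indicE ger0_norm ?ler0n//; case: (_ \in _).
  - by move=> x Ax; rewrite indicE memNset.
by rewrite /Rintegral integral_indic// setIT.
Qed.

End bounded_integrals.

Section bounded_fubini.
Context d1 d2 (T1 : measurableType d1) (T2 : measurableType d2) (R : realType).
Variables (m1 : {sigma_finite_measure set T1 -> \bar R}).
Variables (m2 : {sigma_finite_measure set T2 -> \bar R}).
Variables (A1 : set T1) (A2 : set T2) (B : R) (F : T1 * T2 -> R).
Hypotheses (mA1 : measurable A1) (mA2 : measurable A2).
Hypotheses (A1oo : (m1 A1 < +oo)%E) (A2oo : (m2 A2 < +oo)%E).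
Hypothesis mF : measurable_fun setT F.
Hypothesis FB : forall z, `|F z| <= B.
Hypothesis F0 : forall z, ~ (A1 z.1 /\ A2 z.2) -> F z = 0.

Lemma bounded_integrable_prod : (m1 \x m2)%E.-integrable setT (EFin \o F).
Proof.
apply: (@bounded_integrable _ _ _ _ (A1 `*` A2) B) => //.
  exact: measurableX.
rewrite (_ : _ (_ `*` _) = m1 A1 * m2 A2)%E; last exact: product_measure1E.
by rewrite lte_mul_pinfty// ge0_fin_numE.
Qed.

Lemma bounded_section1 x : m2.-integrable setT (EFin \o (fun y => F (x, y))).
Proof.
apply: (@bounded_integrable _ _ _ _ A2 B) => //.
  exact: measurableT_comp.
by move=> y Ay; apply: F0 => -[].
Qed.

Lemma bounded_section2 y : m1.-integrable setT (EFin \o (fun x => F (x, y))).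
Proof.
apply: (@bounded_integrable _ _ _ _ A1 B) => //.
  exact: measurableT_comp.
by move=> x Ax; apply: F0 => -[].
Qed.

Let E1 x : (\int[m2]_y (F (x, y))%:E = (Rintegral m2 setT (fun y => F (x, y)))%:E)%E.
Proof. by rewrite fineK// integrable_fin_num//; exact: bounded_section1. Qed.

Let E2 y : (\int[m1]_x (F (x, y))%:E = (Rintegral m1 setT (fun x => F (x, y)))%:E)%E.
Proof. by rewrite fineK// integrable_fin_num//; exact: bounded_section2. Qed.

Lemma measurable_Rintegral1 :
  measurable_fun setT (fun x => Rintegral m2 setT (fun y => F (x, y))).
Proof.
apply/measurable_EFinP.
have := measurable_fubini_F bounded_integrable_prod.
by apply: eq_measurable_fun => x _; rewrite /fubini_F /= E1.
Qed.

Lemma Rintegral_fubini1 : Rintegral (m1 \x m2)%E setT F =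
  Rintegral m1 setT (fun x => Rintegral m2 setT (fun y => F (x, y))).
Proof.
rewrite /Rintegral -(integral12_prod_meas1 bounded_integrable_prod).
by congr fine; apply: eq_integral => x _; rewrite /fubini_F /= E1.
Qed.

Lemma Rintegral_fubini :
  Rintegral m1 setT (fun x => Rintegral m2 setT (fun y => F (x, y))) =
  Rintegral m2 setT (fun y => Rintegral m1 setT (fun x => F (x, y))).
Proof.
have := Fubini bounded_integrable_prod.
under eq_integral do rewrite /= E1.
under [X in _ = X]eq_integral do rewrite /= E2.
by move=> e; rewrite /Rintegral e.
Qed.

End bounded_fubini.

(** * Compactly supported kernels and convolution *)

Section kernels.
Variable R : realType.
Local Notation mu := (@lebesgue_measure R).
Implicit Types f g h : R -> R.

(** A single constant bounds the values and the support. Continuity is not asked for, because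
    indicators and truncated Fejer kernels must belong to the class. *)
Definition kern f := measurable_fun setT f /\ exists c : R,
  [/\ 0 <= c, forall x, `|f x| <= c & forall x, c < `|x| -> f x = 0].

Definition integ f : R := Rintegral mu setT f.

Lemma measurable_affine (a b : R) : measurable_fun setT (fun x : R => a * x + b).
Proof. by apply: measurable_funD => //; apply: measurable_funM. Qed.

(** By uniqueness of Lebesgue measure: the pushforward along the affine map, scaled by [|a|], gives
    half-open intervals their length. For [a < 0] the preimage is half-open on the other side, which
    does not change its measure. *)
Lemma lebesgue_affine (a b : R) (A : set R) : a != 0 -> measurable A ->
  (mu ((fun x : R => (a * x + b)%R) @^-1` A) = (`|a|^-1)%:E * mu A)%E.
Proof.
move=> a0 mA.
have na0 : 0 < `|a| by rewrite normr_gt0.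
pose phi : measurableTypeR R -> measurableTypeR R := fun x => a * x + b.
have mphi : measurable_fun setT phi by exact: measurable_affine.
pose nu := mscale (NngNum (ltW na0))
  (measure_function_pushforward__canonical__measure_function_Measure mu mphi).
have -> : (mu A = nu A)%E.
  apply: (@lebesgue_measure_unique R nu) => //= _ [[x y]] _ <- /=.
  rewrite /nu /mscale /= /pushforward.
  have [a_gt0|a_lt0|/eqP] := ltgtP a 0; last by rewrite (negbTE a0).
    have -> : phi @^-1` `]x, y] = `[(y - b) / a, (x - b) / a[%classic.
      apply/seteqP; split=> z /=; rewrite !in_itv/= /phi.
        move=> /andP[h1 h2]; apply/andP; split.
          by rewrite ler_ndivrMr//; lra.
        by rewrite ltr_ndivlMr//; lra.
      move=> /andP[]; rewrite ler_ndivrMr// ltr_ndivlMr// => h1 h2.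
      by apply/andP; split; lra.
    rewrite !lebesgue_measure_itv/= !lte_fin ltr_ndivlMr// divfK//.
    rewrite ltrD2r; case: ifP => _; last by rewrite mule0.
    rewrite !EFinN -!EFinD -EFinM ltr0_norm//; congr (_%:E).
    by field.
  have -> : phi @^-1` `]x, y] = `](x - b) / a, (y - b) / a]%classic.
    apply/seteqP; split=> z /=; rewrite !in_itv/= /phi.
      move=> /andP[h1 h2]; apply/andP; split.
        by rewrite ltr_pdivrMr//; lra.
      by rewrite ler_pdivlMr//; lra.
    move=> /andP[]; rewrite ltr_pdivrMr// ler_pdivlMr// => h1 h2.
    by apply/andP; split; lra.
  rewrite !lebesgue_measure_itv/= !lte_fin ltr_pdivrMr// divfK//.
  rewrite ltrD2r; case: ifP => _; last by rewrite mule0.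
  rewrite !EFinN -!EFinD -EFinM gtr0_norm//; congr (_%:E).
  by field.
by rewrite /nu /mscale/= muleA -EFinM mulVf ?gt_eqF// mul1e.
Qed.

(** The change of variables holds for nonnegative functions by pushforward and is transferred to [f]
    through its positive and negative parts. *)
Lemma integral_affine (a b : R) f : a != 0 ->
  mu.-integrable setT (EFin \o f) ->
  mu.-integrable setT (EFin \o (fun x => f (a * x + b))) /\
  integ (fun x => f (a * x + b)) = `|a|^-1 * integ f.
Proof.
move=> a0 intf.
have na0 : 0 < `|a|^-1 by rewrite invr_gt0 normr_gt0.
pose phi : measurableTypeR R -> measurableTypeR R := fun x => a * x + b.
have mphi : measurable_fun setT phi by exact: measurable_affine.
pose nu := mscale (NngNum (ltW na0)) mu.
have nuE A : measurable A -> (pushforward mu phi A = nu A)%E.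
  by move=> mA; rewrite /nu /mscale /= -(lebesgue_affine b a0 mA).
have ge0E (g : R -> \bar R) : measurable_fun setT g -> (forall x, 0 <= g x)%E ->
    (\int[mu]_x g (phi x) = (`|a|^-1)%:E * \int[mu]_x g x)%E.
  move=> mg g0.
  transitivity (\int[pushforward mu phi]_x g x)%E.
    by rewrite ge0_integral_pushforward.
  rewrite -[RHS](@ge0_integral_mscale _ _ R mu setT measurableT (NngNum (ltW na0)))//.
  by apply: eq_measure_integral => A mA _; exact: nuE.
have mf := measurable_int _ intf.
have intE : (\int[mu]_x (f (a * x + b))%:E = (`|a|^-1)%:E * \int[mu]_x (f x)%:E)%E.
  transitivity (\int[mu]_x ((EFin \o f) \o phi) x)%E; first by [].
  rewrite integralE funepos_comp funeneg_comp [in RHS]integralE.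
  rewrite muleBr//; last first.
    apply: fin_num_adde_defl; rewrite fin_numN.
    by apply: integrable_fin_num => //; exact: integrable_funeneg.
  rewrite -!ge0E//; last 2 first.
    by apply: measurable_funeneg.
    by apply: measurable_funepos.
split; last by rewrite /integ /Rintegral intE fineM// integrable_fin_num.
apply/integrableP; split; first exact: (measurableT_comp mf mphi).
rewrite (ge0E (fun x => `|(f x)%:E|)%E)//; last exact: measurableT_comp.
by rewrite lte_mul_pinfty//; case/integrableP: intf.
Qed.

Lemma lebesgue_itv_fin (a b : R) : (mu `[a, b]%classic < +oo)%E.
Proof.
apply: (@le_lt_trans _ _ (lebesgue_measure (`[a, b]%classic : set R))) => //.
by rewrite lebesgue_measure_itv/=; case: ifP => _; rewrite ?ltry.
Qed.

Lemma kern_integrable f : kern f -> mu.-integrable setT (EFin \o f).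
Proof.
move=> [mf [c [c0 fc f0]]].
apply: (@bounded_integrable _ _ _ mu `[- c, c]%classic c) => //.
  exact: lebesgue_itv_fin.
move=> x; rewrite /= in_itv/= -ler_norml => /negP; rewrite -ltNge.
exact: f0.
Qed.

Lemma kern_wide f (C : R) : kern f -> exists c : R,
  [/\ 0 < c, C <= c, forall x, `|f x| <= c & forall x, c < `|x| -> f x = 0].
Proof.
move=> [_ [c [c0 fc f0]]]; exists (c + `|C| + 1); split.
- by rewrite ltr_wpDl ?addr_ge0.
- by have := ler_norm C; lra.
- by move=> x; apply: le_trans (fc x) _; have := normr_ge0 C; lra.
- by move=> x xc; apply: f0; have := normr_ge0 C; lra.
Qed.

Lemma kernD f g : kern f -> kern g -> kern (f \+ g).
Proof.
move=> kf kg; split; first by apply: measurable_funD; [case: kf|case: kg].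
have [c [c0 _ fc f0]] := kern_wide 0 kf.
have [b [b0 _ gb g0]] := kern_wide 0 kg.
exists (c + b); split; first by rewrite addr_ge0// ltW.
- by move=> x /=; rewrite (le_trans (ler_normD _ _))// lerD.
- by move=> x /= h; rewrite f0 ?g0 ?addr0//; lra.
Qed.

Lemma kernZ (a : R) f : kern f -> kern (fun x => a * f x).
Proof.
move=> kf; split; first by apply: measurable_funM => //; case: kf.
have [c [c0 _ fc f0]] := kern_wide 0 kf.
exists (c * `|a| + c); split; first by rewrite addr_ge0 ?mulr_ge0// ltW.
- move=> x /=; rewrite normrM.
  have := ler_wpM2l (normr_ge0 a) (fc x); lra.
- move=> x /= h; rewrite f0 ?mulr0//; apply: le_lt_trans h.
  by rewrite lerDr mulr_ge0// ltW.
Qed.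

Lemma kernB f g : kern f -> kern g -> kern (f \- g).
Proof.
move=> kf kg; rewrite (_ : f \- g = f \+ (fun x => -1 * g x)).
  by apply: kernD => //; exact: kernZ.
by apply/funext => x /=; rewrite mulN1r.
Qed.

Lemma kern_affine (a b : R) f : a != 0 -> kern f -> kern (fun x => f (a * x + b)).
Proof.
move=> a0 kf; split.
  by apply: (measurableT_comp (f := f)); [case: kf|exact: measurable_affine].
have [c [c0 _ fc f0]] := kern_wide 0 kf.
have na0 : 0 < `|a| by rewrite normr_gt0.
exists (c + (c + `|b|) / `|a|); split.
- by rewrite addr_ge0 ?divr_ge0 ?addr_ge0// ltW.
- move=> x; apply: le_trans (fc _) _.
  by rewrite lerDl divr_ge0 ?addr_ge0// ltW.
- move=> x h; apply: f0.
  have h1 : (c + `|b|) / `|a| < `|x| by lra.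
  move: h1; rewrite ltr_pdivrMr// mulrC -normrM => h1.
  by have := ler_normB (a * x + b) b; rewrite addrK; lra.
Qed.

Lemma kernM f g : kern f -> kern g -> kern (f \* g).
Proof.
move=> kf kg; split; first by apply: measurable_funM; [case: kf|case: kg].
have [c [c0 _ fc f0]] := kern_wide 0 kf.
have [b [b0 _ gb g0]] := kern_wide 0 kg.
exists (c * b + c); split; first by rewrite addr_ge0// ?mulr_ge0// ltW.
- move=> x /=; rewrite normrM; apply: le_trans (ler_pM _ _ (fc x) (gb x)) _ => //.
  by rewrite lerDl ltW.
- move=> x /= h; rewrite f0 ?mul0r//; apply: le_lt_trans h.
  by rewrite lerDr mulr_ge0// ltW.
Qed.

Lemma integD f g : kern f -> kern g -> integ (f \+ g) = integ f + integ g.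
Proof.
by move=> /kern_integrable kf /kern_integrable kg; rewrite /integ -RintegralD.
Qed.

Lemma integB f g : kern f -> kern g -> integ (f \- g) = integ f - integ g.
Proof.
by move=> /kern_integrable kf /kern_integrable kg; rewrite /integ -RintegralB.
Qed.

Lemma integZ (a : R) f : kern f -> integ (fun x => a * f x) = a * integ f.
Proof. by move=> /kern_integrable kf; rewrite /integ -RintegralZl. Qed.

Lemma integ_affine (a b : R) f : a != 0 -> kern f ->
  integ (fun x => f (a * x + b)) = `|a|^-1 * integ f.
Proof. by move=> a0 /kern_integrable kf; case: (integral_affine b a0 kf). Qed.

Lemma integ_shift (b : R) f : kern f -> integ (fun x => f (x + b)) = integ f.
Proof.
move=> kf; rewrite -[RHS]mul1r -[X in X * _]invr1 -[X in X^-1 * _]normr1.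
rewrite -(@integ_affine 1 b)//.
by congr integ; apply/funext => x; rewrite mul1r.
Qed.

Lemma integ_refl (b : R) f : kern f -> integ (fun x => f (b - x)) = integ f.
Proof.
move=> kf; rewrite -[RHS]mul1r -[X in X * _]invr1 -[X in X^-1 * _](normrN1 R).
rewrite -(@integ_affine (-1) b)//.
by congr integ; apply/funext => x; rewrite mulN1r addrC.
Qed.

Lemma le_integ f g : kern f -> kern g -> (forall x, f x <= g x) ->
  integ f <= integ g.
Proof.
by move=> /kern_integrable kf /kern_integrable kg h; apply: le_Rintegral.
Qed.

Lemma kern_norm f : kern f -> kern (fun x => `|f x|).
Proof.
move=> kf; split; first by apply: measurableT_comp => //; case: kf.
have [c [c0 _ fc f0]] := kern_wide 0 kf.
exists c; split; first exact: ltW.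
- by move=> x; rewrite normr_id.
- by move=> x /f0 ->; rewrite normr0.
Qed.

Lemma le_norm_integ f : kern f -> `|integ f| <= integ (fun x => `|f x|).
Proof. by move=> /kern_integrable kf; apply: le_normr_Rintegral. Qed.

Section fubini_kernel.
Variables (c B : R) (F : R * R -> R).
Hypothesis mF : measurable_fun setT (F : measurableTypeR R * measurableTypeR R -> R).
Hypothesis FB : forall z, `|F z| <= B.
Hypothesis F0 : forall z, c < `|z.1| \/ c < `|z.2| -> F z = 0.

Let I : set (measurableTypeR R) := `[- c, c]%classic.
Let mI : measurable I. Proof. exact: measurable_itv. Qed.
Let Ioo : (mu I < +oo)%E.
Proof. exact: lebesgue_itv_fin. Qed.
Let F0' (z : measurableTypeR R * measurableTypeR R) : ~ (I z.1 /\ I z.2) -> F z = 0.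
Proof.
move=> h; apply: F0; rewrite !ltNge; apply/orP; rewrite -negb_and.
apply/negP => /andP[h1 h2]; apply: h.
by rewrite /I/= !in_itv/= -!ler_norml.
Qed.

Lemma integ_fubini : integ (fun x => integ (fun y => F (x, y))) =
  integ (fun y => integ (fun x => F (x, y))).
Proof. exact: (Rintegral_fubini mI mI Ioo Ioo mF FB F0'). Qed.

Lemma kern_integ : kern (fun x => integ (fun y => F (x, y))).
Proof.
split; first exact: (measurable_Rintegral1 mI mI Ioo Ioo mF FB F0').
have mFx (x : R) : measurable_fun setT (fun y : R => F (x, y)).
  by apply: (measurableT_comp mF).
exists (`|c| + `|B| * fine (mu I)); split.
- by rewrite addr_ge0// mulr_ge0// fine_ge0.
- move=> x; apply: (@le_trans _ _ (`|B| * fine (mu I))); last by rewrite lerDr.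
  apply: le_Rintegral_bound => //.
  + exact: mFx.
  + by move=> y; apply: le_trans (FB _) (ler_norm _).
  + by move=> y Iy; apply: F0' => -[].
- move=> x cx; rewrite (_ : (fun y => F (x, y)) = cst 0).
    by rewrite /integ Rintegral_cst// mul0r.
  apply/funext => y; apply: F0; left => /=; apply: le_lt_trans cx.
  by apply: le_trans (ler_norm _) _; rewrite lerDl mulr_ge0// fine_ge0.
Qed.

End fubini_kernel.

Definition convol f g x : R := integ (fun y => f (x - y) * g y).

Lemma kern_convol_section f g (x : R) : kern f -> kern g ->
  kern (fun y => f (x - y) * g y).
Proof.
move=> kf kg; apply: kernM => //.
rewrite (_ : (fun _ => _) = fun y => f (-1 * y + x)); first exact: kern_affine.
by apply/funext => y; rewrite mulN1r addrC.
Qed.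

Lemma kern_convol f g : kern f -> kern g -> kern (convol f g).
Proof.
move=> kf kg.
have [c [c0 _ fc f0]] := kern_wide 0 kf.
have [b [b0 _ gb g0]] := kern_wide 0 kg.
apply: (@kern_integ (c + b) (c * b) (fun z => f (z.1 - z.2) * g z.2)).
- apply: measurable_funM.
    apply: measurableT_comp; first by case: kf.
    by apply: measurable_funB.
  by apply: measurableT_comp => //; case: kg.
- by move=> z; rewrite normrM ler_pM.
- move=> [x y] /= h; have [hb|hb] := ltP b `|y|.
    by rewrite g0// mulr0.
  rewrite f0 ?mul0r//.
  case: h => h; last lra.
  by have := ler_normB (x - y) (- y); rewrite opprK subrK normrN; lra.
Qed.

Lemma convolC f g : kern f -> kern g -> convol f g = convol g f.
Proof.
move=> kf kg; apply/funext => x; rewrite /convol.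
rewrite -[LHS](@integ_refl x); last exact: kern_convol_section.
by congr integ; apply/funext => y; rewrite subKr mulrC.
Qed.

Lemma convolA f g h : kern f -> kern g -> kern h ->
  convol f (convol g h) = convol (convol f g) h.
Proof.
move=> kf kg kh; apply/funext => x.
have [c [c0 _ fc f0]] := kern_wide 0 kf.
have [b [b0 _ gb g0]] := kern_wide 0 kg.
have [a [a0 _ ha h0]] := kern_wide 0 kh.
transitivity (integ (fun y => integ (fun z => f (x - y) * (g (y - z) * h z)))).
  congr integ; apply/funext => y; rewrite -integZ//.
  exact: kern_convol_section.
rewrite (@integ_fubini (a + b) (c * (b * a))
  (fun z => f (x - z.1) * (g (z.1 - z.2) * h z.2))).
- congr integ; apply/funext => z.
  transitivity (integ (fun y => h z * (f (x - y) * g (y - z)))).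
    by congr integ; apply/funext => y /=; ring.
  have kfg : kern (fun y => f (x - y) * g (y - z)).
    rewrite (_ : (fun _ => _) = (fun y => (fun u => f (x - z - u) * g u) (1 * y + (- z)))).
      apply: (@kern_affine 1 (- z) (fun u => f (x - z - u) * g u)) => //.
      exact: kern_convol_section.
    by apply/funext => y /=; rewrite mul1r; congr (f _ * _); ring.
  rewrite integZ// mulrC; congr (_ * _).
  rewrite -[LHS](integ_shift z)//.
  by congr integ; apply/funext => y /=; congr (f _ * g _); ring.
- apply: measurable_funM; [|apply: measurable_funM].
  + apply: (@measurableT_comp _ _ _ _ _ _ f); first by case: kf.
    by apply: measurable_funB.
  + apply: (@measurableT_comp _ _ _ _ _ _ g); first by case: kg.
    by apply: measurable_funB.
  + by apply: measurableT_comp => //; case: kh.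
- by move=> z; rewrite !normrM ler_pM// ler_pM.
- move=> [y z] /= hh; have [hb|hb] := ltP a `|z|.
    by rewrite h0// !mulr0.
  rewrite g0 ?mul0r ?mulr0//.
  case: hh => hh; last lra.
  by have := ler_normB (y - z) (- z); rewrite opprK subrK normrN; lra.
Qed.

Lemma convolDl f g h : kern f -> kern g -> kern h ->
  convol (f \+ g) h = convol f h \+ convol g h.
Proof.
move=> kf kg kh; apply/funext => x; rewrite /convol /= -integD.
- by congr integ; apply/funext => y /=; rewrite mulrDl.
- exact: kern_convol_section.
- exact: kern_convol_section.
Qed.

Lemma convolDr f g h : kern f -> kern g -> kern h ->
  convol h (f \+ g) = convol h f \+ convol h g.
Proof.
move=> kf kg kh; rewrite convolC//; last exact: kernD.
by rewrite convolDl// (convolC kf)// (convolC kg).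
Qed.

Lemma convolBl f g h : kern f -> kern g -> kern h ->
  convol (f \- g) h = convol f h \- convol g h.
Proof.
move=> kf kg kh; apply/funext => x; rewrite /convol /= -integB.
- by congr integ; apply/funext => y /=; rewrite mulrBl.
- exact: kern_convol_section.
- exact: kern_convol_section.
Qed.

Lemma convolBr f g h : kern f -> kern g -> kern h ->
  convol h (f \- g) = convol h f \- convol h g.
Proof.
move=> kf kg kh; rewrite convolC//; last exact: kernB.
by rewrite convolBl// (convolC kf)// (convolC kg).
Qed.

Lemma integ_convol f g : kern f -> kern g -> integ (convol f g) = integ f * integ g.
Proof.
move=> kf kg.
have [c [c0 _ fc f0]] := kern_wide 0 kf.
have [b [b0 _ gb g0]] := kern_wide 0 kg.
rewrite /convol (@integ_fubini (c + b) (c * b) (fun z => f (z.1 - z.2) * g z.2)).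
- rewrite -integZ//; congr integ; apply/funext => y /=.
  transitivity (integ (fun x => g y * f (x - y))).
    by congr integ; apply/funext => x; rewrite mulrC.
  rewrite integZ; last first.
    rewrite (_ : (fun _ => _) = fun x => f (1 * x - y)); first exact: kern_affine.
    by apply/funext => x; rewrite mul1r.
  by rewrite (integ_shift (- y))// mulrC.
- apply: measurable_funM.
    apply: (@measurableT_comp _ _ _ _ _ _ f); first by case: kf.
    by apply: measurable_funB.
  by apply: measurableT_comp => //; case: kg.
- by move=> z; rewrite normrM ler_pM.
- move=> [x y] /= h; have [hb|hb] := ltP b `|y|.
    by rewrite g0// mulr0.
  rewrite f0 ?mul0r//.
  case: h => h; last lra.
  by have := ler_normB (x - y) (- y); rewrite opprK subrK normrN; lra.
Qed.

(** The dilations [a f(a x)] preserve integrals and respect convolution, so identities between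
    kernels need proof at scale one only. *)
Lemma convol_scale (a : R) f g : 0 < a -> kern f -> kern g ->
  convol (fun x => a * f (a * x)) (fun x => a * g (a * x)) =
  (fun x => a * convol f g (a * x)).
Proof.
move=> a0 kf kg; apply/funext => x; rewrite /convol.
have := @integ_affine a 0 (fun y => f (a * x - y) * g y) (lt0r_neq0 a0)
  (kern_convol_section _ kf kg).
rewrite gtr0_norm// => e.
transitivity (integ (fun y => a ^+ 2 * (f (a * x - (a * y + 0)) * g (a * y + 0)))).
  congr integ; apply/funext => y; rewrite addr0 mulrBr; ring.
rewrite integZ; last first.
  by apply: (@kern_affine a 0 (fun y => f (a * x - y) * g y)); rewrite ?gt_eqF//;
    exact: kern_convol_section.
by rewrite e; field; rewrite gt_eqF.
Qed.

End kernels.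

(** * Smooth functions with bounded support *)

Section smooth_functions.
Variable R : realType.
Implicit Types f g : R -> R.

Definition smooth1 f := forall k (x : R), derivable (derive1n k f) x 1.

Lemma derive1n_add j k f : derive1n j (derive1n k f) = derive1n (j + k) f.
Proof. by rewrite /derive1n -iterD. Qed.

Lemma smooth1_is_derive f k (x : R) : smooth1 f ->
  is_derive x 1 (derive1n k f) (derive1n k.+1 f x).
Proof. by move=> sf; rewrite derive1nS derive1E; apply: derivableP. Qed.

Lemma smooth1_derive1n f k : smooth1 f -> smooth1 (derive1n k f).
Proof. by move=> sf j x; rewrite derive1n_add. Qed.

Lemma smooth1_continuous f k : smooth1 f -> continuous (derive1n k f).
Proof.
by move=> sf x; apply: differentiable_continuous; apply/derivable1_diffP.
Qed.

Lemma is_derive_affine (a b x : R) : is_derive x 1 (fun x : R => a * x + b) a.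
Proof.
have h := @is_deriveD R R R (a \*: id) (cst b) x 1 (a *: 1) 0
  (is_deriveZ _ (is_derive_id _ _)) (is_derive_cst _ _ _).
by apply: (is_derive_eq h); rewrite addr0 /GRing.scale /= mulr1.
Qed.

Lemma derive1n_affine (c a b : R) f k : smooth1 f ->
  derive1n k (fun x => c * f (a * x + b)) =
  (fun x => c * a ^+ k * derive1n k f (a * x + b)).
Proof.
move=> sf; elim: k => [|k IH]; first by apply/funext => x; rewrite expr0 mulr1.
rewrite derive1nS IH; apply/funext => x; rewrite derive1E.
have h1 := is_derive_affine a b x.
have h2 := @is_derive1_comp R (derive1n k f) (fun x => a * x + b) x _ a
  (smooth1_is_derive k (a * x + b) sf) h1.
have h3 := @is_deriveZ _ _ _ _ (c * a ^+ k) _ _ _ h2.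
have -> : (fun x0 : R => c * a ^+ k * derive1n k f (a * x0 + b)) =
   (c * a ^+ k) \*: (derive1n k f \o (fun x => a * x + b)) by [].
by rewrite derive_val /GRing.scale /= exprS; ring.
Qed.

Lemma smooth1_affine (c a b : R) f : smooth1 f ->
  smooth1 (fun x => c * f (a * x + b)).
Proof.
move=> sf k x; rewrite derive1n_affine//.
have h1 := is_derive_affine a b x.
have h2 := @is_derive1_comp R (derive1n k f) (fun x => a * x + b) x _ a
  (smooth1_is_derive k (a * x + b) sf) h1.
have := @is_deriveZ _ _ _ _ (c * a ^+ k) _ _ _ h2.
by case.
Qed.

Lemma derive1nB f g k : smooth1 f -> smooth1 g ->
  derive1n k (f \- g) = derive1n k f \- derive1n k g.
Proof.
move=> sf sg; elim: k => // k IH; rewrite derive1nS IH; apply/funext => x.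
rewrite derive1E.
have := is_deriveB (smooth1_is_derive k x sf) (smooth1_is_derive k x sg).
by move=> h; rewrite derive_val.
Qed.

Lemma smooth1B f g : smooth1 f -> smooth1 g -> smooth1 (f \- g).
Proof.
move=> sf sg k x; rewrite derive1nB//.
by have [] := is_deriveB (smooth1_is_derive k x sf) (smooth1_is_derive k x sg).
Qed.

Definition bsupp (c : R) f := forall x, c < `|x| -> f x = 0.

Lemma bsupp_derive1 c f : bsupp c f -> bsupp c (derive1 f).
Proof.
move=> f0 x cx; rewrite derive1E -(@derive_cst R _ _ (0 : R) x 1).
apply: near_eq_derive.
have : \forall y \near x, c < `|y|.
  have h := @norm_continuous R R x.
  exact: (@cvgr_gt R R (nbhs x) _ (fun y => `|y|) `|x| h c cx).
by apply: filterS => y /f0.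
Qed.

Lemma bsupp_derive1n c f k : bsupp c f -> bsupp c (derive1n k f).
Proof. by move=> f0; elim: k => // k IH; rewrite derive1nS; apply: bsupp_derive1. Qed.

Lemma continuous_kern c f : continuous f -> bsupp c f -> kern f.
Proof.
move=> cf f0; split; first exact: continuous_measurable_fun.
have : compact (`[- `|c|, `|c|]%classic : set R) by exact: segment_compact.
have cwf : {within `[- `|c|, `|c|], continuous f} by exact: continuous_subspaceT.
move=> /(continuous_compact cwf)/compact_bounded[M [_ hM]].
have hb x : `|f x| <= `|M| + 1.
  have [cx|cx] := ltP `|c| `|x|.
    by rewrite f0 ?normr0 ?addr_ge0//; apply: le_lt_trans cx; exact: ler_norm.
  apply: (hM (`|M| + 1)); first by have := ler_norm M; lra.
  by exists x => //; rewrite /= in_itv/= -ler_norml.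
exists (`|c| + (`|M| + 1)); split.
- by rewrite !addr_ge0.
- by move=> x; apply: le_trans (hb x) _; rewrite lerDr.
- move=> x hx; apply: f0; apply: le_lt_trans hx; apply: le_trans (ler_norm c) _.
  by rewrite lerDl addr_ge0.
Qed.

Lemma smooth1_kern c f k : smooth1 f -> bsupp c f -> kern (derive1n k f).
Proof.
move=> sf f0; apply: (@continuous_kern c); first exact: smooth1_continuous.
exact: bsupp_derive1n.
Qed.

Lemma MVT_bound f (df : R -> R) (B x y : R) :
  (forall z : R, is_derive z 1 f (df z)) -> (forall z, `|df z| <= B) ->
  `|f x - f y| <= B * `|x - y|.
Proof.
move=> dfE dfB; wlog xy : x y / y <= x => [H|].
  by case/orP: (le_total y x) => h; [exact: H|rewrite distrC (distrC x); exact: H].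
have [|z _ ->] := @MVT_segment R f df y x xy (fun z _ => dfE z).
  apply: continuous_subspaceT => z; apply: differentiable_continuous.
  by apply/derivable1_diffP; case: (dfE z).
by rewrite normrM ler_wpM2r.
Qed.

(** The fundamental theorem of calculus on a half-line: after the substitution [w = x - u] the
    Heaviside factor restricts the integral of the derivative to [w <= x - v], and the lower end
    lies outside the support. *)
Lemma integ_tail c f (x v : R) : smooth1 f -> bsupp c f ->
  integ (fun u => (v <= u)%R%:R * derive1n 1 f (x - u)) = f (x - v).
Proof.
move=> sf f0.
have kf := smooth1_kern 1 sf f0.
set z := x - v; pose c' : R := `|c| + `|z| + 1.
have c'0 : 0 < c' by rewrite /c' ltr_wpDl// addr_ge0.
have hz : - c' < z.
  by have := ler_norm (- z); rewrite normrN /c'; have := normr_ge0 c; lra.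
have kz : kern (fun w => (w <= z)%R%:R * derive1n 1 f w).
  split.
    apply: measurable_funM; last by case: kf.
    rewrite (_ : (fun _ => _) = \1_(`]-oo, z]%classic : set R)); last first.
      apply/funext => w; rewrite indicE; congr (nat_of_bool _)%:R.
      by apply/idP/idP; rewrite ?inE /= in_itv.
    by apply: measurable_indic; exact: measurable_itv.
  have [M [M0 _ fM fM0]] := kern_wide 0 kf.
  exists M; split; first exact: ltW.
    by move=> w; rewrite normrM; case: (w <= z); rewrite ?normr1 ?mul1r ?normr0 ?mul0r ?(ltW M0).
  by move=> w /fM0 ->; rewrite mulr0.
transitivity (integ (fun w => (w <= z)%R%:R * derive1n 1 f w)).
  rewrite -[RHS](integ_refl x)//; congr integ; apply/funext => u.
  by rewrite /z lerD2l lerN2.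
have -> : integ (fun w => (w <= z)%R%:R * derive1n 1 f w) =
    Rintegral lebesgue_measure `[- c', z]%classic (derive1n 1 f).
  rewrite Rintegral_mkcond; congr Rintegral; apply/funext => w.
  rewrite patchE; have [wz|wz] := leP w z; rewrite ?mul1r ?mul0r.
    have [wc|wc] := leP (- c') w.
      by rewrite mem_set//= in_itv/= wc wz.
    rewrite memNset ?(bsupp_derive1n 1 f0)//=.
      have := ler_norm (- w); rewrite normrN; move: wc; rewrite /c'.
      by have := ler_norm c; have := normr_ge0 z; lra.
    by rewrite in_itv/= leNgt wc.
  by rewrite memNset//= in_itv/= [w <= z]leNgt wz andbF.
rewrite /Rintegral (@continuous_FTC2 _ _ f)//.
- rewrite (f0 (- c')) ?sube0// normrN gtr0_norm// /c'.
  by have := ler_norm c; have := normr_ge0 z; lra.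
- by apply: continuous_subspaceT; exact: smooth1_continuous.
- have cf := smooth1_continuous (k := 0) sf; split.
  + by move=> y _; exact: (sf 0%N).
  + by apply: cvg_at_right_filter; exact: cf.
  + by apply: cvg_at_left_filter; exact: cf.
Qed.

End smooth_functions.

(** * Iterated differences in place of derivatives *)

Section difference_class.
Variable R : realType.
Implicit Types (f g : R -> R) (us : seq R).

Definition diff1 (u : R) f : R -> R := fun t => f t - f (t - u).

Fixpoint diffs us f : R -> R := if us is u :: us' then diffs us' (diff1 u f) else f.

Definition absprod us : R := \prod_(u <- us) `|u|.

Lemma diffsB us f g : diffs us (f \- g) = diffs us f \- diffs us g.
Proof.
elim: us f g => // u us IH f g /=; rewrite -IH; congr diffs.
by apply/funext => t; rewrite /diff1 /=; ring.
Qed.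

Lemma diffsD us f g : diffs us (f \+ g) = diffs us f \+ diffs us g.
Proof.
elim: us f g => // u us IH f g /=; rewrite -IH; congr diffs.
by apply/funext => t; rewrite /diff1 /=; ring.
Qed.

Lemma diffsZ us (c : R) f : diffs us (fun x => c * f x) = (fun x => c * diffs us f x).
Proof.
elim: us f => // u us IH f /=; rewrite -IH; congr diffs.
by apply/funext => t; rewrite /diff1 /=; ring.
Qed.

Lemma diffs_shift us (b : R) f :
  diffs us (fun t => f (t + b)) = (fun t => diffs us f (t + b)).
Proof.
elim: us f => // u us IH f /=; rewrite -IH; congr diffs.
by apply/funext => t; rewrite /diff1 addrAC.
Qed.

Lemma diffs_scale us (a : R) f :
  diffs us (fun t => f (a * t)) = (fun t => diffs [seq a * u | u <- us] f (a * t)).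
Proof.
elim: us f => // u us IH f /=; rewrite -IH; congr diffs.
by apply/funext => t; rewrite /diff1 mulrBr.
Qed.

Lemma diffs_diff1 us u f : diffs us (diff1 u f) = diff1 u (diffs us f).
Proof.
rewrite (_ : diff1 u f = f \- (fun t => f (t + - u))) ?diffsB ?diffs_shift//.
Qed.

Lemma absprod_scale us (a : R) :
  absprod [seq a * u | u <- us] = `|a| ^+ size us * absprod us.
Proof.
rewrite /absprod big_map; elim: us => [|u us IH]; first by rewrite !big_nil mulr1.
by rewrite !big_cons IH normrM /= exprS; ring.
Qed.

Lemma absprod_ge0 us : 0 <= absprod us.
Proof. by apply: prodr_ge0. Qed.

(* A substitute for a bound on the [M]-th derivative which makes sense for kernels
   that are not differentiable. *)
Definition dbound (M : nat) (B : R) f :=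
  forall us, size us = M -> forall t, `|diffs us f t| <= B * absprod us.

Definition dclass f := forall M, exists B, dbound M B f.

Lemma dbound_ge0 M B f : dbound M B f -> 0 <= B.
Proof.
move=> /(_ (nseq M 1)); rewrite size_nseq => /(_ erefl 0).
rewrite /absprod big_nseq normr1 iter_mulr mulr1 expr1n mulr1.
exact: le_trans.
Qed.

Lemma dclassD f g : dclass f -> dclass g -> dclass (f \+ g).
Proof.
move=> df dg M; have [B hB] := df M; have [C hC] := dg M; exists (B + C).
move=> us sM t; rewrite diffsD mulrDl; apply: le_trans (ler_normD _ _) _.
by apply: lerD; [exact: hB|exact: hC].
Qed.

Lemma dclassZ (c : R) f : dclass f -> dclass (fun x => c * f x).
Proof.
move=> df M; have [B hB] := df M; exists (`|c| * B).
by move=> us sM t; rewrite diffsZ normrM -mulrA ler_wpM2l// hB.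
Qed.

Lemma dclassB f g : dclass f -> dclass g -> dclass (f \- g).
Proof.
move=> df dg; rewrite (_ : f \- g = f \+ (fun x => -1 * g x)).
  by apply: dclassD => //; exact: dclassZ.
by apply/funext => x /=; rewrite mulN1r.
Qed.

Lemma dclass0 : dclass (cst 0).
Proof.
move=> M; exists 0 => us _ t; rewrite (_ : cst 0 = (fun x => 0 * cst 0 x)).
  by rewrite diffsZ !mul0r normr0.
by apply/funext => x; rewrite mul0r.
Qed.

Lemma dbound_scale M B (a : R) f : 0 < a -> dbound M B f ->
  dbound M (a ^+ M * B) (fun t => f (a * t)).
Proof.
move=> a0 hf us sM t; rewrite diffs_scale.
apply: le_trans (hf _ _ _) _; first by rewrite size_map.
by rewrite absprod_scale sM gtr0_norm// mulrCA mulrA.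
Qed.

Lemma smooth1_diffs us f (x : R) : smooth1 f ->
  is_derive x 1 (diffs us f) (diffs us (derive1n 1 f) x) /\
  smooth1 (diffs us f).
Proof.
elim: us f => [|u us IH] f sf /=.
  by split => //; exact: (smooth1_is_derive 0).
have sd : smooth1 (diff1 u f) /\ derive1n 1 (diff1 u f) = diff1 u (derive1n 1 f).
  have E : diff1 u f = f \- (fun t => 1 * f (1 * t + - u)).
    by apply/funext => t; rewrite /diff1 /= !mul1r.
  have sa := @smooth1_affine R 1 1 (- u) f sf.
  rewrite E; split; first exact: smooth1B.
  rewrite derive1nB// derive1n_affine//; apply/funext => t /=.
  by rewrite /diff1 !mul1r.
by have [h1 h2] := IH _ sd.1; rewrite -sd.2.
Qed.

(** Induction on [M], applied to the derivative: the mean value theorem turns a bound for [M]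
    differences of the derivative into one for [M.+1] differences of [f], with the additional factor
    [|u|]. *)
Lemma smooth1_dclass c f : smooth1 f -> bsupp c f -> dclass f.
Proof.
move=> sf f0 M; elim: M f sf f0 => [|M IH] f sf f0.
  have [B [_ _ fB _]] := kern_wide 0 (smooth1_kern 0 sf f0).
  by exists B => -[|//] _ t; rewrite /absprod big_nil mulr1 /=; exact: fB.
have [B hB] := IH _ (@smooth1_derive1n R f 1 sf) (@bsupp_derive1n R c f 1 f0).
exists B => -[//|u us] [sM] t /=; rewrite diffs_diff1.
have := @MVT_bound _ (diffs us f) _ (B * absprod us) t (t - u)
  (fun z => (smooth1_diffs us z sf).1) (hB us sM).
by rewrite /diff1 subKr /absprod big_cons -mulrA [X in B * X]mulrC.
Qed.

Lemma diffs_convol us f h : kern f -> kern h ->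
  kern (diffs us f) /\ diffs us (convol f h) = convol (diffs us f) h.
Proof.
elim: us f => // u us IH f kf kh /=.
have E : diff1 u f = f \- (fun t => f (1 * t + - u)).
  by apply/funext => x; rewrite /diff1 /= mul1r.
have ku : kern (fun t => f (1 * t + - u)) by exact: kern_affine.
have [|k1 k2] := IH (diff1 u f) _ kh; first by rewrite E; exact: kernB.
split=> //; rewrite -k2; congr diffs; rewrite E convolBl//.
apply/funext => x; rewrite /diff1 /=; congr (_ - _).
by congr integ; apply/funext => y; rewrite mul1r addrAC.
Qed.

(** All differences fall on [f]; the other factor enters only through its L_1 norm and may be
    rough. *)
Lemma dbound_convol M B f h : kern f -> kern h -> dbound M B f ->
  dbound M (B * integ (fun x => `|h x|)) (convol f h).
Proof.
move=> kf kh hf us sM t.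
have [kd ->] := diffs_convol us kf kh.
apply: le_trans (le_norm_integ (kern_convol_section _ kd kh)) _.
rewrite mulrAC -integZ; last exact: kern_norm.
apply: le_integ.
- by apply: kern_norm; exact: kern_convol_section.
- by apply: kernZ; exact: kern_norm.
- by move=> y; rewrite normrM ler_wpM2r// hf.
Qed.

Lemma dclass_convol f h : kern f -> kern h -> dclass f -> dclass (convol f h).
Proof.
move=> kf kh df M; have [B hB] := df M; exists (B * integ (fun x => `|h x|)).
exact: dbound_convol.
Qed.

End difference_class.

Lemma norm_bool_sub (R : realType) (a b : bool) : `|a%:R - b%:R| <= 1 :> R.
Proof. by case: a; case: b; rewrite /= ?subrr ?subr0 ?sub0r ?normrN ?normr0 ?normr1. Qed.

Section step_kernel.
Variable R : realType.
Implicit Types f g h : R -> R.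

(* If [integ f = 1], then [g - f * g = step_kern f * g^`()]. *)
Definition step_kern f (u : R) : R :=
  integ (fun v => f v * ((0 <= u)%R%:R - (v <= u)%R%:R)).

Let measurable_ler2 (s t : R * R -> R) :
  measurable_fun setT (s : measurableTypeR R * measurableTypeR R -> R) ->
  measurable_fun setT (t : measurableTypeR R * measurableTypeR R -> R) ->
  measurable_fun setT ((fun z => (s z <= t z)%R%:R) : measurableTypeR R * measurableTypeR R -> R).
Proof.
move=> ms mt.
have h := measurable_fun_ler ms mt.
rewrite (_ : (fun _ => _) = (fun b : bool => b%:R) \o (fun z => (s z <= t z)%R))//.
exact: measurableT_comp.
Qed.

Let step_meas f : kern f -> measurable_fun setT
  ((fun z => f z.2 * ((0 <= z.1)%R%:R - (z.2 <= z.1)%R%:R)) :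
     measurableTypeR R * measurableTypeR R -> R).
Proof.
move=> kf; apply: measurable_funM.
  by apply: (@measurableT_comp _ _ _ _ _ _ f); [case: kf|].
by apply: measurable_funB; exact: measurable_ler2.
Qed.

Lemma step_kern_supp c f : bsupp c f -> bsupp c (step_kern f).
Proof.
move=> f0 u cu; rewrite /step_kern (_ : (fun _ => _) = cst 0).
  by rewrite /integ Rintegral_cst// mul0r.
apply/funext => v /=; have [cv|cv] := ltP c `|v|; first by rewrite f0// mul0r.
suff -> : (0 <= u) = (v <= u) by rewrite subrr mulr0.
have c0 : 0 <= c by apply: le_trans cv.
have [u0|u0] := leP 0 u.
  by rewrite ger0_norm// in cu; apply/esym/ltW/(le_lt_trans (ler_norm v))/(le_lt_trans cv).
rewrite ltr0_norm// in cu; apply/esym/negbTE; rewrite -ltNge.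
by have := ler_norm (- v); rewrite normrN; lra.
Qed.

Lemma kern_step f : kern f -> kern (step_kern f).
Proof.
move=> kf; have [c [c0 _ fc f0]] := kern_wide 0 kf.
(* The cut-off in [z.1] changes nothing, by [step_kern_supp], but makes the integrand visibly
   bounded and compactly supported in both variables, as [kern_integ] requires. *)
have h u : step_kern f u = integ (fun v => (fun z => (if c < `|z.1| then 0 else 1) *
   (f z.2 * ((0 <= z.1)%R%:R - (z.2 <= z.1)%R%:R))) (u, v)).
  rewrite /=; case: ifPn => [cu|_]; last by congr integ; apply/funext => v; rewrite mul1r.
  rewrite (step_kern_supp f0)// (_ : (fun _ => _) = cst 0) ?/integ ?Rintegral_cst ?mul0r//.
  by apply/funext => v; rewrite mul0r.
rewrite (_ : step_kern f = fun u => integ (fun v => (fun z => (if c < `|z.1| then 0 else 1) *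
   (f z.2 * ((0 <= z.1)%R%:R - (z.2 <= z.1)%R%:R))) (u, v))); last exact/funext.
apply: (@kern_integ R c c (fun z => (if c < `|z.1| then 0 else 1) *
   (f z.2 * ((0 <= z.1)%R%:R - (z.2 <= z.1)%R%:R)))).
- apply: measurable_funM; last exact: step_meas.
  rewrite (_ : (fun _ => _) = fun z : R * R => (`|z.1| <= c)%R%:R); last first.
    by apply/funext => z; rewrite leNgt; case: ifP.
  by apply: measurable_ler2 => //; apply: measurableT_comp => //; exact: measurableT_comp.
- move=> z; rewrite normrM; apply: (@le_trans _ _ (1 * (c * 1))); last by rewrite mulr1 mul1r.
  apply: ler_pM => //; first by case: ifP; rewrite ?normr0 ?normr1.
  by rewrite normrM ler_pM// norm_bool_sub.
- by move=> z [->|/f0 ->]; rewrite ?mul0r ?mulr0.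
Qed.

(** As [integ f = 1], the right-hand side is the integral of [f v * (g x - g (x - v))]. Each
    increment of [g] is the integral of its derivative against a difference of two Heaviside
    functions ([integ_tail]), and exchanging the integrals produces [step_kern f]. *)
Lemma convol_step c f g : kern f -> integ f = 1 -> smooth1 g -> bsupp c g ->
  convol (step_kern f) (derive1n 1 g) = g \- convol f g.
Proof.
move=> kf f1 sg g0.
have kg := smooth1_kern 0 sg g0.
have kg1 := smooth1_kern 1 sg g0.
have ks := kern_step kf.
have [a [a0 _ fa fsupp]] := kern_wide 0 kf.
have [b [b0 _ gb gsupp]] := kern_wide 0 kg1.
rewrite convolC//; apply/funext => x; rewrite /convol.
pose F (z : R * R) := (if a < `|z.1| then 0 else 1) * (derive1n 1 g (x - z.1) *
  (f z.2 * ((0 <= z.1)%R%:R - (z.2 <= z.1)%R%:R))).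
transitivity (integ (fun u => integ (fun v => F (u, v)))).
  congr integ; apply/funext => u; rewrite /F /=; case: ifPn => [au|_].
    rewrite (step_kern_supp fsupp)// mulr0 (_ : (fun _ => _) = cst 0) ?/integ ?Rintegral_cst ?mul0r//.
    by apply/funext => v; rewrite mul0r.
  rewrite /step_kern -integZ.
    by congr integ; apply/funext => v; rewrite mul1r.
  have kfu : kern (fun v => f v * (v <= u)%R%:R).
    split.
      apply: measurable_funM; first by case: kf.
      rewrite (_ : (fun _ => _) = \1_(`]-oo, u]%classic : set R)); last first.
        apply/funext => w; rewrite indicE; congr (nat_of_bool _)%:R.
        by apply/idP/idP; rewrite ?inE /= in_itv.
      by apply: measurable_indic; exact: measurable_itv.
    exists a; split => //; first exact: ltW.
      by move=> v; rewrite normrM; case: (v <= u); rewrite ?normr1 ?mulr1 ?normr0 ?mulr0 ?(ltW a0).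
    by move=> v /fsupp ->; rewrite mul0r.
  rewrite (_ : (fun _ => _) = (fun v => (0 <= u)%R%:R * f v) \- (fun v => f v * (v <= u)%R%:R)).
    by apply: kernB => //; exact: kernZ.
  by apply/funext => v /=; rewrite mulrBr mulrC.
rewrite (@integ_fubini R a (b * a)).
- transitivity (integ (fun v => f v * (g x - g (x - v)))).
    congr integ; apply/funext => v.
    have [av|av] := ltP a `|v|.
      rewrite fsupp// mul0r (_ : (fun _ => _) = cst 0) ?/integ ?Rintegral_cst ?mul0r//.
      by apply/funext => u; rewrite /F /= fsupp// mul0r !mulr0.
    have kt w : kern (fun u => (w <= u)%R%:R * derive1n 1 g (x - u)).
      split.
        apply: measurable_funM.
          rewrite (_ : (fun _ => _) = \1_(`[w, +oo[%classic : set R)); last first.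
            apply/funext => z; rewrite indicE; congr (nat_of_bool _)%:R.
            by apply/idP/idP; rewrite ?inE /= in_itv/= andbT.
          by apply: measurable_indic; exact: measurable_itv.
        apply: (@measurableT_comp _ _ _ _ _ _ (derive1n 1 g)); first by case: kg1.
        by apply: measurable_funB.
      exists (b + `|x|); split; first by rewrite addr_ge0// ltW.
        move=> u; rewrite normrM; apply: le_trans (_ : b <= _); last by rewrite lerDl.
        by case: (w <= u); rewrite ?normr1 ?mul1r ?normr0 ?mul0r ?(ltW b0).
      move=> u hu; rewrite gsupp ?mulr0//.
      by have := ler_normB x (x - u); rewrite subKr; lra.
    transitivity (f v * (integ (fun u => (0 <= u)%R%:R * derive1n 1 g (x - u)) -
        integ (fun u => (v <= u)%R%:R * derive1n 1 g (x - u)))).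
      rewrite -integB// -integZ; last exact: kernB.
      congr integ; apply/funext => u; rewrite /F /=; case: ifPn => [au|_]; last ring.
      suff -> : (0 <= u) = (v <= u) by rewrite !subrr !mulr0.
      have [u0|u0] := leP 0 u.
        by rewrite ger0_norm// in au; apply/esym/ltW/(le_lt_trans (ler_norm v))/(le_lt_trans av).
      rewrite ltr0_norm// in au; apply/esym/negbTE; rewrite -ltNge.
      by have := ler_norm (- v); rewrite normrN; lra.
    by rewrite !(integ_tail _ _ sg g0) subr0.
  rewrite (_ : (fun _ => _) = (fun v => g x * f v) \- (fun v => g (x - v) * f v)).
    rewrite integB; [|exact: kernZ|exact: kern_convol_section].
    by rewrite integZ// f1 mulr1 /= -[X in g x - X]/(convol g f x) (convolC (kg : kern g) kf).
  by apply/funext => v /=; ring.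
- rewrite /F; apply: measurable_funM.
    rewrite (_ : (fun _ => _) = fun z : R * R => (`|z.1| <= a)%R%:R); last first.
      by apply/funext => z; rewrite leNgt; case: ifP.
    by apply: measurable_ler2 => //; apply: measurableT_comp => //; exact: measurableT_comp.
  apply: measurable_funM; last exact: step_meas.
  apply: (@measurableT_comp _ _ _ _ _ _ (derive1n 1 g)); first by case: kg1.
  by apply: measurable_funB.
- move=> z; rewrite /F normrM -[b * a]mul1r; apply: ler_pM => //.
    by case: ifP; rewrite ?normr0 ?normr1.
  by rewrite normrM ler_pM// normrM -[X in _ <= X]mulr1 ler_pM// norm_bool_sub.
- by move=> z [h|/fsupp h]; rewrite /F ?h ?mul0r ?mulr0.
Qed.

End step_kernel.

(** * The reproducing formula *)

Section reproducing.
Variable R : realType.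
Implicit Types f g h : R -> R.

Lemma convol0 f : kern f -> convol f (cst 0) = cst 0.
Proof.
move=> kf; apply/funext => x; rewrite /convol (_ : (fun _ => _) = cst 0).
  by rewrite /integ Rintegral_cst// mul0r.
by apply/funext => y; rewrite mulr0.
Qed.

Lemma kern0 : kern (cst 0 : R -> R).
Proof.
split; first exact: measurable_cst.
by exists 0; split => // x; rewrite normr0.
Qed.

(* [pow_kern f r] represents delta - (delta - f)^r. *)
Fixpoint pow_kern f r : R -> R :=
  if r is r'.+1 then f \+ (pow_kern f r' \- convol f (pow_kern f r')) else cst 0.

Lemma kern_pow f r : kern f -> kern (pow_kern f r).
Proof.
move=> kf; elim: r => [|r IH]; first exact: kern0.
by apply: kernD => //; apply: kernB => //; exact: kern_convol.
Qed.

Lemma dclass_pow f r : kern f -> dclass f -> dclass (pow_kern f r).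
Proof.
move=> kf df; elim: r => [|r IH]; first exact: dclass0.
apply: dclassD => //; apply: dclassB => //; apply: dclass_convol => //.
exact: kern_pow.
Qed.

(** [delta - f] has integral zero, hence so has every positive power of it. *)
Lemma integ_pow f r : kern f -> integ f = 1 -> integ (pow_kern f r.+1) = 1.
Proof.
move=> kf f1; have kp := kern_pow r kf.
rewrite /= integD//; last by apply: kernB => //; exact: kern_convol.
by rewrite integB ?integ_convol ?f1 ?mul1r ?subrr ?addr0//; exact: kern_convol.
Qed.

Lemma pow_kern_scale (c : R) f r : 0 < c -> kern f ->
  pow_kern (fun x => c * f (c * x)) r = (fun x => c * pow_kern f r (c * x)).
Proof.
move=> c0 kf; elim: r => [|r IH] /=; first by apply/funext => x; rewrite mulr0.
rewrite IH convol_scale//; last exact: kern_pow.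
by apply/funext => x /=; ring.
Qed.

(* [low_kern f g r] represents [sum_(i < r) (delta - f)^i * g], so that
   [low_kern f g r * f = pow_kern f r * g]. *)
Fixpoint low_kern f g r : R -> R :=
  if r is r'.+1 then g \+ (low_kern f g r' \- convol f (low_kern f g r')) else cst 0.

Lemma kern_low f g r : kern f -> kern g -> kern (low_kern f g r).
Proof.
move=> kf kg; elim: r => [|r IH]; first exact: kern0.
by apply: kernD => //; apply: kernB => //; exact: kern_convol.
Qed.

Lemma dclass_low f g r : kern f -> kern g -> dclass g -> dclass (low_kern f g r).
Proof.
move=> kf kg dg; elim: r => [|r IH]; first exact: dclass0.
apply: dclassD => //; apply: dclassB => //.
rewrite convolC//; last exact: kern_low.
by apply: dclass_convol => //; exact: kern_low.
Qed.

Lemma convol_low f g r : kern f -> kern g ->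
  convol (low_kern f g r) f = convol (pow_kern f r) g.
Proof.
move=> kf kg; elim: r => [|r IH] /=.
  by rewrite (convolC kern0 kf) (convolC kern0 kg) !convol0.
have kl := kern_low r kf kg; have kp := kern_pow r kf.
have kfl := kern_convol kf kl; have kfp := kern_convol kf kp.
rewrite (convolDl kg (kernB kl kfl) kf) (convolBl kl kfl kf).
rewrite (convolDl kf (kernB kp kfp) kg) (convolBl kp kfp kg).
by rewrite -(convolA kf kl kf) -(convolA kf kp kg) IH (convolC kg kf).
Qed.

Variables (f g : R -> R) (c : R).
Hypotheses (kf : kern f) (kg : kern g) (f1 : integ f = 1) (g1 : integ g = 1).
Hypotheses (sf : smooth1 f) (sg : smooth1 g) (f0 : bsupp c f) (g0 : bsupp c g).
Variable w : R -> R.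
Hypothesis kw : kern w.

Let hf := step_kern f.
Let hg := step_kern g.
Let khf : kern hf. Proof. exact: kern_step. Qed.
Let khg : kern hg. Proof. exact: kern_step. Qed.
Let psi r := derive1n r (f \- g).

(* With [a = f] and [b = g], [high_kern r] represents
   [sum_(i <= r) hf^(r - i) * hg^i * w], which comes from factoring
   [(delta - a)^(r + 1) - (delta - b)^(r + 1)] by [(delta - a) - (delta - b)] and
   replacing each factor [delta - a], [delta - b] by a derivative. *)
Fixpoint step_pow r : R -> R := if r is r'.+1 then convol hg (step_pow r') else w.

Fixpoint high_kern r : R -> R :=
  if r is r'.+1 then convol hf (high_kern r') \+ step_pow r else w.

Lemma kern_step_pow r : kern (step_pow r).
Proof. by elim: r => // r IH; exact: kern_convol. Qed.

Lemma kern_high r : kern (high_kern r).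
Proof.
elim: r => // r IH; apply: kernD; first exact: kern_convol.
exact: (kern_step_pow r.+1).
Qed.

Lemma dclass_high r : dclass w -> dclass (high_kern r).
Proof.
move=> dw.
have ds j : dclass (step_pow j).
  elim: j => // j IH /=; rewrite convolC//; last exact: kern_step_pow.
  by apply: dclass_convol => //; exact: kern_step_pow.
elim: r => // r IH /=; apply: dclassD; last exact: (ds r.+1).
rewrite convolC//; last exact: kern_high.
by apply: dclass_convol => //; exact: kern_high.
Qed.

Let spsi r : smooth1 (psi r).
Proof. by apply: smooth1_derive1n; exact: smooth1B. Qed.

Let psi0 r : bsupp c (psi r).
Proof. by apply: bsupp_derive1n => x cx /=; rewrite f0// g0// subrr. Qed.

Let kpsi r : kern (psi r).
Proof. exact: (@smooth1_kern _ _ _ 0 (@spsi r) (@psi0 r)). Qed.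

Let stepf r : convol hf (psi r.+1) = psi r \- convol f (psi r).
Proof. exact: (@convol_step R c f (psi r) kf f1 (@spsi r) (@psi0 r)). Qed.

Let stepg r : convol hg (psi r.+1) = psi r \- convol g (psi r).
Proof. exact: (@convol_step R c g (psi r) kg g1 (@spsi r) (@psi0 r)). Qed.

(** In terms of the Dirac mass: [hg^r * w * psi_r = w * (delta - g)^r * psi_0]. Each factor [hg]
    lowers the order of the derivative by one and leaves a factor [delta - g]. *)
Let step_pow_psi r : convol (step_pow r) (psi r) =
  convol w (psi 0) \- convol (convol w (pow_kern g r)) (psi 0).
Proof.
have kp0 := kpsi 0.
elim: r => [|r IH].
  rewrite (convol0 kw) (convolC kern0 kp0) (convol0 kp0).
  by apply/funext => x /=; rewrite subr0.
have kpr := kern_pow r kg; have ks := kern_step_pow r; have kr := kpsi r.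
have kr1 := kpsi r.+1; have kgp := kern_convol kg kpr.
have kwp := kern_convol kw kpr; have kwg := kern_convol kw kg.
have kX := kern_convol kw kp0; have kY := kern_convol kwp kp0.
have kwgp := kern_convol kw kgp.
rewrite [step_pow _]/= (convolC khg ks) -(convolA ks khg kr1) stepg.
rewrite (convolBr kr (kern_convol kg kr) ks) (convolA ks kg kr) (convolC ks kg).
rewrite -(convolA kg ks kr) IH (convolBr kX kY kg) [pow_kern g r.+1]/=.
rewrite (convolDr kg (kernB kpr kgp) kw) (convolBr kpr kgp kw).
rewrite (convolDl kwg (kernB kwp kwgp) kp0) (convolBl kwp kwgp kp0).
rewrite (convolA kg kw kp0) (convolA kg kwp kp0) (convolA kg kw kpr).
rewrite (convolC kg kw) (convolA kw kg kpr).
have ringE (a b a' b' : R) : a - b - (a' - b') = a - (a' + (b - b')) by ring.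
by apply/funext => x; exact: ringE.
Qed.

(** Induction along the identity [A^(r+2) - B^(r+2) = B (A^(r+1) - B^(r+1)) + (A - B) A^(r+1)] with
    [A = delta - g] and [B = delta - f], where [A - B = f - g]. The first summand comes from
    [stepf], the second from [step_pow_psi]. *)
Lemma convol_high r : convol (high_kern r) (derive1n r (f \- g)) =
  convol w (pow_kern f r.+1 \- pow_kern g r.+1).
Proof.
have kp0 := kpsi 0.
elim: r => [|r IH].
  rewrite /= (convol0 kf) (convol0 kg); congr convol.
  by apply/funext => x /=; ring.
have kpf := kern_pow r.+1 kf; have kpg := kern_pow r.+1 kg.
have kh := kern_high r; have kr := kpsi r; have kr1 := kpsi r.+1.
have kfp := kern_convol kf kpf; have kgp := kern_convol kg kpg.
have kwf := kern_convol kw kpf; have kwg := kern_convol kw kpg.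
have kS (u : R -> R) (ku : kern u) : pow_kern u r.+2 =
  u \+ (pow_kern u r.+1 \- convol u (pow_kern u r.+1)) by [].
rewrite [high_kern _]/=.
rewrite (convolDl (kern_convol khf kh) (kern_step_pow r.+1) kr1).
rewrite (step_pow_psi r.+1) (convolC khf kh) -(convolA kh khf kr1) stepf.
rewrite (convolBr kr (kern_convol kf kr) kh) (convolA kh kf kr) (convolC kh kf).
rewrite -(convolA kf kh kr) IH (kS f kf) (kS g kg).
have e0 : psi 0 = f \- g by [].
rewrite e0; move: (pow_kern f _) (pow_kern g _) kpf kpg kfp kgp kwf kwg.
move=> k l kpf kpg kfp kgp kwf kwg.
rewrite (convolBr (kernD kf (kernB kpf kfp)) (kernD kg (kernB kpg kgp)) kw).
rewrite (convolDr kf (kernB kpf kfp) kw) (convolBr kpf kfp kw).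
rewrite (convolDr kg (kernB kpg kgp) kw) (convolBr kpg kgp kw).
rewrite (convolBr kpf kpg kw) (convolBr kwf kwg kf).
rewrite (convolBr kf kg kw) (convolBr kf kg kwg).
rewrite (convolA kf kw kpf) (convolA kf kw kpg) (convolC kf kw).
rewrite (convolA kw kf kpf) -(convolA kw kpg kf) (convolC kpg kf).
rewrite (convolA kw kf kpg) -(convolA kw kpg kg) (convolC kpg kg).
by apply/funext => x /=; ring.
Qed.

End reproducing.

Section psi_kernels.
Variables (R : realType) (Psi0 : R -> R) (L : nat).
Hypotheses (s0 : smooth1 Psi0) (b0 : bsupp 1 Psi0) (i0 : integ Psi0 = 1).

Let g := Psi0.
Let f (x : R) := 2 * Psi0 (2 * x).
Let kg : kern g. Proof. exact: (@smooth1_kern _ _ _ 0 s0 b0). Qed.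

Let sf : smooth1 f.
Proof.
have := @smooth1_affine R 2 2 0 _ s0; congr smooth1.
by apply/funext => x; rewrite addr0.
Qed.

Let bf : bsupp 1 f.
Proof.
move=> x x1; rewrite /f b0 ?mulr0// normrM gtr0_norm//; lra.
Qed.

Let kf : kern f. Proof. exact: (@smooth1_kern _ _ _ 0 sf bf). Qed.

Let i1 : integ f = 1.
Proof.
have k2 := @kern_affine R 2 0 _ (lt0r_neq0 (ltr0n _ 2)) kg.
transitivity (integ (fun x => 2 * g (2 * x + 0))).
  by congr integ; apply/funext => x; rewrite addr0.
rewrite integZ// integ_affine// ?gt_eqF// gtr0_norm// i0 mulr1 divff//.
Qed.

Let P (h : R -> R) := pow_kern h L.+1.
Let kPf : kern (P f). Proof. exact: kern_pow. Qed.
Let kPg : kern (P g). Proof. exact: kern_pow. Qed.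

Definition kappa0 := low_kern Psi0 (P Psi0) L.+1.
(** The unit kernel is a square so that its increment from one scale to the next factors as
    [(P f + P g) * (P f - P g)]. The second factor is what [convol_high] produces; the first serves
    as the weight [w], and it puts [kappa1] in [dclass] although the step kernels inside it are
    merely bounded. The factor [P Psi0] inside [kappa0] is the coarsest instance of the same
    square. *)
Definition kappa1 := high_kern f g (P f \+ P g) L.
Definition unit_kern := convol (P Psi0) (P Psi0).

Let kPP : kern (P f \+ P g). Proof. exact: kernD. Qed.

Lemma kern_kappa0 : kern kappa0. Proof. exact: kern_low. Qed.
Lemma kern_kappa1 : kern kappa1. Proof. exact: kern_high. Qed.
Lemma kern_unit_kern : kern unit_kern. Proof. exact: kern_convol. Qed.

Lemma integ_unit_kern : integ unit_kern = 1.
Proof. by rewrite integ_convol// integ_pow// mulr1. Qed.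

Lemma dclass_kappa0 : dclass kappa0.
Proof.
by apply: dclass_low => //; apply: dclass_pow => //; exact: (smooth1_dclass s0 b0).
Qed.

Lemma dclass_kappa1 : dclass kappa1.
Proof.
apply: dclass_high => //; apply: dclassD; apply: dclass_pow => //.
  exact: (smooth1_dclass sf bf).
exact: (smooth1_dclass s0 b0).
Qed.

Lemma smooth_Psi1 : smooth1 (Psi1 Psi0 L).
Proof. by apply: smooth1_derive1n; apply: smooth1B. Qed.

Lemma bsupp_Psi1 : bsupp 1 (Psi1 Psi0 L).
Proof. by apply: bsupp_derive1n => x cx; rewrite -/(f x) bf// b0// subrr. Qed.

Lemma kern_Psi1 : kern (Psi1 Psi0 L).
Proof. exact: (@smooth1_kern _ _ _ 0 smooth_Psi1 bsupp_Psi1). Qed.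

Lemma kappa0_Psi : convol kappa0 Psi0 = unit_kern.
Proof. exact: convol_low. Qed.

Lemma kappa1_Psi : convol kappa1 (Psi1 Psi0 L) =
  (fun x => 2 * unit_kern (2 * x)) \- unit_kern.
Proof.
have -> : Psi1 Psi0 L = derive1n L (f \- g) by [].
rewrite /kappa1 (@convol_high R f g 1)// -!/(P _).
have -> : (fun x => 2 * unit_kern (2 * x)) = convol (P f) (P f).
  by rewrite -convol_scale// -pow_kern_scale.
rewrite (convolDl kPf kPg (kernB kPf kPg)) (convolBr kPf kPg kPf).
rewrite (convolBr kPf kPg kPg) (convolC kPf kPg).
have ringE (a b a' : R) : a - b + (b - a') = a - a' by ring.
by apply/funext => x; exact: ringE.
Qed.

Lemma smooth_Psi j : smooth1 (Psi Psi0 L j).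
Proof.
case: j => [//|j].
have := @smooth1_affine R (2 ^+ j) (2 ^+ j) 0 _ smooth_Psi1; congr smooth1.
by apply/funext => x; rewrite addr0.
Qed.

Lemma bsupp_Psi j : bsupp 1 (Psi Psi0 L j).
Proof.
case: j => [//|j] x x1 /=; rewrite bsupp_Psi1 ?mulr0// normrM gtr0_norm ?exprn_gt0//.
have : 1 <= 2 ^+ j :> R by rewrite exprn_ege1// ler1n.
by move=> h; apply: lt_le_trans x1 _; rewrite ler_peMl.
Qed.

Lemma kern_Psi j : kern (Psi Psi0 L j).
Proof. exact: (@smooth1_kern _ _ _ 0 (@smooth_Psi j) (@bsupp_Psi j)). Qed.

End psi_kernels.

Section scaled_kernels.
Variables (R : realType) (Psi0 Psi1 kappa0 kappa1 unit_kern : R -> R).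
Hypotheses (kP0 : kern Psi0) (kP1 : kern Psi1).
Hypotheses (kk0 : kern kappa0) (kk1 : kern kappa1) (kU : kern unit_kern).
Hypotheses (dk0 : dclass kappa0) (dk1 : dclass kappa1).
Hypothesis iU : integ unit_kern = 1.
Hypothesis eq0 : convol kappa0 Psi0 = unit_kern.
Hypothesis eq1 : convol kappa1 Psi1 =
  (fun x => 2 * unit_kern (2 * x)) \- unit_kern.

Definition dyadic (f : R -> R) j x := 2 ^+ j * f (2 ^+ j * x).
Definition kappa j := if j is j'.+1 then dyadic kappa1 j' else kappa0.
Definition unit_scale := dyadic unit_kern.

Let pow2_gt0 j : 0 < 2 ^+ j :> R. Proof. by rewrite exprn_gt0. Qed.
Let pow2_neq0 j : (2 ^+ j : R) != 0. Proof. by rewrite gt_eqF. Qed.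

Let kern_mul j (h : R -> R) : kern h -> kern (fun x => h (2 ^+ j * x)).
Proof.
move=> kh; have := @kern_affine R (2 ^+ j) 0 _ (pow2_neq0 j) kh; congr kern.
by apply/funext => x; rewrite addr0.
Qed.

Let integ_mul j (h : R -> R) : kern h -> integ (fun x => h (2 ^+ j * x)) = 2 ^- j * integ h.
Proof.
move=> kh; have := @integ_affine R (2 ^+ j) 0 _ (pow2_neq0 j) kh.
rewrite gtr0_norm// => <-.
by congr integ; apply/funext => x; rewrite addr0.
Qed.

Lemma kern_dyadic j (h : R -> R) : kern h -> kern (dyadic h j).
Proof. by move=> kh; apply: kernZ; exact: kern_mul. Qed.

Lemma integ_dyadic j (h : R -> R) : kern h -> integ (dyadic h j) = integ h.
Proof.
by move=> kh; rewrite /dyadic integZ ?integ_mul ?mulrA ?divff ?mul1r//; exact: kern_mul.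
Qed.

Lemma dyadic_bsupp c (h : R -> R) : bsupp c h -> forall j, bsupp (c * 2 ^- j) (dyadic h j).
Proof.
move=> hc j x; rewrite ltr_pdivrMr// => cx; rewrite /dyadic hc ?mulr0//.
by rewrite normrM gtr0_norm// mulrC.
Qed.

Lemma kern_kappa j : kern (kappa j).
Proof. by case: j => [|j] //; exact: kern_dyadic. Qed.

(** By [eq1] and dilation, level [j.+1] contributes [unit_scale j.+1 - unit_scale j], so the sum
    telescopes. *)
Lemma sum_kappa_Psi J x :
  \sum_(j < J.+1) convol (kappa j) (if (j : nat) is i.+1 then dyadic Psi1 i else Psi0) x =
  unit_scale J x.
Proof.
elim: J => [|J IH].
  by rewrite big_ord_recl big_ord0 addr0 eq0 /unit_scale /dyadic expr0 !mul1r.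
rewrite big_ord_recr /= IH (convol_scale (pow2_gt0 J) kk1 kP1) eq1.
rewrite /unit_scale /dyadic /= mulrBr addrC subrK !mulrA -exprSr.
by rewrite -exprS.
Qed.

Lemma kappa_bsupp : exists2 c : R, 0 < c & forall j, bsupp (c * 2 ^- j) (kappa j).
Proof.
have [c [c0 _ _ hc]] := kern_wide 0 kk0.
have [b [b0' _ _ hb]] := kern_wide 0 kk1.
(* The factor 2 appears because [kappa j.+1] is a dilation by [2 ^+ j] only. *)
exists (c + 2 * b); first by rewrite addr_gt0// mulr_gt0.
case=> [|j] x.
  by rewrite expr0 invr1 mulr1 => h; apply: hc; apply: le_lt_trans h; lra.
move=> h; apply: (dyadic_bsupp hb); apply: le_lt_trans h.
rewrite exprS invfM mulrA ler_wpM2r ?invr_ge0 ?(ltW (pow2_gt0 j))//.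
lra.
Qed.

(** Of the [M.+1] factors [2 ^+ j], one comes from the L_1 normalization and [M] from the
    differences. *)
Lemma kappa_dbound M : exists B : R, forall j, dbound M (B * 2 ^+ (j * M.+1)) (kappa j).
Proof.
have [B hB] := dk0 M; have [C hC] := dk1 M.
have B0 := dbound_ge0 hB; have C0 := dbound_ge0 hC.
exists (B + C); case=> [|j] us sM t.
  rewrite mul0n expr0 mulr1; apply: le_trans (hB _ sM t) _.
  by rewrite ler_wpM2r ?absprod_ge0// lerDl.
rewrite /kappa /dyadic diffsZ normrM gtr0_norm//.
have := @dbound_scale R M C (2 ^+ j) _ (pow2_gt0 j) hC us sM t.
move=> h; apply: le_trans (ler_wpM2l (ltW (pow2_gt0 j)) h) _.
rewrite !mulrA ler_wpM2r ?absprod_ge0// -exprM -exprD.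
rewrite mulrC; apply: ler_pM => //; first by rewrite lerDr.
by rewrite -mulnS ler_weXn2l ?ler1n// leq_mul2r leqnSn orbT.
Qed.

Lemma unit_scale_bounds : exists c : R, [/\ 0 < c,
  forall j, bsupp (c * 2 ^- j) (unit_scale j) &
  forall j, integ (fun x => `|unit_scale j x|) <= c].
Proof.
have [c [c0 _ _ hc]] := kern_wide 0 kU.
set I := integ (fun x => `|unit_kern x|).
exists (c + `|I|); split.
- by rewrite ltr_wpDr.
- move=> j x h; apply: (dyadic_bsupp hc); apply: le_lt_trans h.
  by rewrite ler_wpM2r ?invr_ge0 ?(ltW (pow2_gt0 j))// lerDl.
- move=> j; rewrite (_ : (fun _ => _) = dyadic (fun y => `|unit_kern y|) j).
    rewrite integ_dyadic; last exact: kern_norm.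
    by apply: le_trans (ler_norm I) _; rewrite lerDr ltW.
  by apply/funext => x; rewrite /unit_scale /dyadic normrM gtr0_norm.
Qed.

End scaled_kernels.

(** The interface to the rest of the proof: afterwards the kernels [kap] and [U] are known only
    through these properties. *)
Theorem reproducing_kernels (R : realType) (Psi0 : R -> R) (L : nat) :
  smooth1 Psi0 -> bsupp 1 Psi0 -> integ Psi0 = 1 ->
  exists (kap U : nat -> R -> R) (c : R),
  [/\ 0 < c, forall j, kern (kap j), forall j, kern (U j) & forall j, integ (U j) = 1] /\
  [/\ forall j, bsupp (c * 2 ^- j) (kap j), forall j, bsupp (c * 2 ^- j) (U j),
      forall j, integ (fun x => `|U j x|) <= c,
      forall M, exists B : R, forall j, dbound M (B * 2 ^+ (j * M.+1)) (kap j) &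
      forall J x, \sum_(j < J.+1) convol (kap j) (Psi Psi0 L j) x = U J x].
Proof.
move=> s0 b0 i0.
have kk0 := kern_kappa0 L s0 b0; have kk1 := kern_kappa1 L s0 b0.
have kU := kern_unit_kern L s0 b0.
have [c [c0 Uc Ui]] := unit_scale_bounds kU.
have [b bb0 kb] := kappa_bsupp kk0 kk1.
exists (kappa (kappa0 Psi0 L) (kappa1 Psi0 L)), (unit_scale (unit_kern Psi0 L)), (b + c).
split; split.
- exact: addr_gt0.
- by move=> j; exact: kern_kappa.
- by move=> j; exact: kern_dyadic.
- by move=> j; rewrite /unit_scale integ_dyadic//; exact: integ_unit_kern.
- move=> j x h; apply: kb; apply: le_lt_trans h.
  by rewrite ler_wpM2r ?invr_ge0 ?exprn_ge0// lerDl ltW.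
- move=> j x h; apply: Uc; apply: le_lt_trans h.
  by rewrite ler_wpM2r ?invr_ge0 ?exprn_ge0// lerDr ltW.
- by move=> j; apply: le_trans (Ui j) _; rewrite lerDr ltW.
- move=> M; apply: kappa_dbound; [exact: dclass_kappa0|exact: dclass_kappa1].
- move=> J x.
  have kP1 := kern_Psi1 L s0 b0.
  have e0 := kappa0_Psi L s0 b0; have e1 := kappa1_Psi L s0 b0 i0.
  rewrite -(sum_kappa_Psi kP1 kk1 e0 e1 J x).
  by apply: eq_bigr => -[[|j] ij].
Qed.

Local Open Scope complex_scope.

(** * Complex exponentials and the distance to the nearest integer *)

Section complex_exponential.
Variable R : realType.
Implicit Types (s t : R) (z : R[i]).

Lemma cabsM z1 z2 : cabs (z1 * z2) = cabs z1 * cabs z2.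
Proof. exact: ComplexField.Normc.normcM. Qed.

Lemma cabsD z1 z2 : cabs (z1 + z2) <= cabs z1 + cabs z2.
Proof. exact: le_normcD. Qed.

Lemma cabsN z : cabs (- z) = cabs z.
Proof. exact: normcN. Qed.

Lemma cabs0 : cabs (0 : R[i]) = 0.
Proof. exact: ComplexField.Normc.normc0. Qed.

Lemma cabs1 : cabs (1 : R[i]) = 1.
Proof. exact: ComplexField.Normc.normc1. Qed.

Lemma cabs_ge0 z : 0 <= cabs z.
Proof. by rewrite /cabs; case: z => a b; exact: sqrtr_ge0. Qed.

Lemma cabs_real (x : R) : cabs x%:C = `|x|.
Proof. by rewrite /cabs /ComplexField.Normc.normc /= expr0n /= addr0 sqrtr_sqr. Qed.

Lemma cabs_sum (I : Type) (r : seq I) (P : pred I) (F : I -> R[i]) :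
  cabs (\sum_(i <- r | P i) F i) <= \sum_(i <- r | P i) cabs (F i).
Proof.
elim/big_ind2 : _ => //; first by rewrite cabs0.
by move=> x a y b xa yb; apply: le_trans (cabsD _ _) _; exact: lerD.
Qed.

Lemma cabs_prod (I : Type) (r : seq I) (P : pred I) (F : I -> R[i]) :
  cabs (\prod_(i <- r | P i) F i) = \prod_(i <- r | P i) cabs (F i).
Proof.
apply: (big_ind2 (fun x y => cabs x = y)) => //; first exact: cabs1.
by move=> x a y b <- <-; exact: cabsM.
Qed.

Lemma cabsX z n : cabs (z ^+ n) = cabs z ^+ n.
Proof. by elim: n => [|n IH]; rewrite ?cabs1// !exprS cabsM IH. Qed.

Definition unity t : R[i] := expi (2 * pi * t).

Lemma unityD s t : unity (s + t) = unity s * unity t.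
Proof.
by rewrite /unity /expi mulrDr cosD sinD; apply/eqP; rewrite eq_complex /=;
  apply/andP; split; apply/eqP; ring.
Qed.

Lemma unity0 : unity 0 = 1.
Proof. by rewrite /unity /expi mulr0 cos0 sin0. Qed.

Lemma cabs_unity t : cabs (unity t) = 1.
Proof. by rewrite /cabs /= cos2Dsin2 sqrtr1. Qed.

Lemma unity1 : unity 1 = 1.
Proof.
rewrite /unity /expi mulr1 [2 * pi]mulrC mulr_natr cos2pi sin2pi//.
Qed.

Lemma unity_nat n t : unity (n%:R * t) = unity t ^+ n.
Proof.
elim: n => [|n IH]; first by rewrite mul0r unity0.
by rewrite -natr1 mulrDl mul1r unityD IH exprSr.
Qed.

Lemma unity_int (m : int) : unity m%:~R = 1.
Proof.
case: m => n; first by rewrite -pmulrn -[n%:R]mulr1 unity_nat unity1 expr1n.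
have h := unityD (Negz n)%:~R n.+1%:R.
rewrite -[X in _ = _ * unity X]mulr1 unity_nat unity1 expr1n mulr1 in h.
by rewrite -h NegzE mulrNz -pmulrn addNr unity0.
Qed.

Lemma unity_sum (I : Type) (r : seq I) (P : pred I) (F : I -> R) :
  unity (\sum_(i <- r | P i) F i) = \prod_(i <- r | P i) unity (F i).
Proof. by elim/big_rec2 : _ => [|i y x _ <-]; rewrite ?unity0// unityD. Qed.

(** Write [sin y = 2 sin z cos z] with [z = y / 2 <= pi / 4]. On [[0, z]] the cosine is at least
    [c = cos (pi / 4)], so [sin z >= c z] by the mean value theorem, and [2 c^2 = 1]. *)
Lemma sin_ge_half (y : R) : 0 <= y <= pi / 2 -> y / 2 <= sin y.
Proof.
move=> /andP[y0 y1]; set z := y / 2; set c := cos (pi / 4 : R).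
have z0 : 0 <= z by rewrite divr_ge0.
have z1 : z <= pi / 4 by rewrite /z; move: y1; set p := pi; lra.
have p0 : 0 < pi :> R := pi_gt0 R.
have cle x : 0 <= x <= z -> c <= cos x.
  move=> /andP[x0 xz].
  rewrite leNgt; apply/negP; rewrite /c ltr_cos ?in_itv/=; first lra.
    by apply/andP; split; lra.
  by apply/andP; split; lra.
have c2 : c ^+ 2 = 1 / 2.
  have := cos_mulr2n (pi / 4 : R).
  have -> : (pi / 4 : R) *+ 2 = pi / 2 by rewrite mulr2n; lra.
  by rewrite cos_pihalf -/c => h; move: h; rewrite mulr2n; lra.
have c0 : 0 <= c by apply: cos_ge0_pihalf; apply/andP; split; lra.
have sz : c * z <= sin z.
  have [|x] := @MVT_segment R sin cos 0 z z0.
  - by apply: continuous_subspaceT => x; exact: continuous_sin.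
  - rewrite in_itv/= => hx; rewrite sin0 !subr0 => ->.
    by rewrite ler_wpM2r// cle.
have -> : y = z *+ 2 by rewrite mulr2n /z; lra.
rewrite sin_mulr2n mulr2n.
have cz : c <= cos z by apply: cle; rewrite z0 lexx.
have := ler_pM c0 (mulr_ge0 c0 z0) cz sz; rewrite mulrA -expr2 c2; lra.
Qed.

Lemma cabs_sub_unity_sqr t : cabs (1 - unity t) ^+ 2 = 4 * sin (pi * t) ^+ 2.
Proof.
rewrite /cabs /unity /expi /= sqr_sqrtr ?addr_ge0 ?sqr_ge0//.
have -> : 2 * pi * t = (pi * t) *+ 2 by rewrite -mulr_natr; ring.
rewrite sin_mulr2n cos_mulr2n sub0r sqrrN.
have := sin2cos2 (pi * t); move: (cos _) (sin _) => c s h.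
transitivity ((2 - 2 * c ^+ 2) ^+ 2 + 4 * c ^+ 2 * s ^+ 2); first by ring.
by rewrite h; ring.
Qed.

(** The modulus is [2 |sin (pi t)|]; combine [sin_ge_half] with [pi >= 2]. *)
Lemma cabs_sub_unity_ge t : `|t| <= 1 / 2 -> 2 * `|t| <= cabs (1 - unity t).
Proof.
move=> t2; have p0 : 0 < pi :> R := pi_gt0 R.
have h : `|t| <= `|sin (pi * t)|.
  wlog t0 : t t2 / 0 <= t.
    move=> H; have [t0|t0] := leP 0 t; first exact: H.
    by have := H (- t); rewrite normrN mulrN sinN normrN; apply => //; lra.
  rewrite (ger0_norm t0) in t2 *.
  have := @sin_ge_half (pi * t); rewrite mulr_ge0 ?(ltW p0)//= => /(_ _).
  have -> : pi * t <= pi / 2 by rewrite ler_wpM2l ?(ltW p0)//; lra.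
  move=> /(_ isT) h; apply: le_trans (ler_norm _); apply: le_trans h.
  have := pi_ge2 R; nra.
rewrite -(@ler_pXn2r _ 2)// ?nnegrE ?mulr_ge0 ?cabs_ge0//.
rewrite cabs_sub_unity_sqr exprMn -[X in _ <= _ * X]real_normK ?num_real//.
have -> : (2 : R) ^+ 2 = 4 by ring.
by rewrite ler_wpM2l// ler_pXn2r ?nnegrE.
Qed.

Lemma dist_int_le (x : R) (m : int) : dist_int x <= `|x - m%:~R|.
Proof.
apply: ge_inf; last by exists m.
by exists 0 => _ [k _ <-].
Qed.

Lemma cabs_sub_unity_dist (x : R) : 2 * dist_int x <= cabs (1 - unity x).
Proof.
pose m := Num.floor (x + 1 / 2); pose t := x - m%:~R.
have xE : x = m%:~R + t by rewrite /t addrC subrK.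
have /andP[m1 m2] : m%:~R <= x + 1 / 2 < m%:~R + 1.
  by rewrite floor_le /=; have := floorD1_gt (x + 1/2); rewrite intrD.
have t2 : `|t| <= 1 / 2 by rewrite ler_norml; apply/andP; split; rewrite /t; lra.
rewrite {2}xE unityD unity_int mul1r.
apply: le_trans (cabs_sub_unity_ge t2).
by rewrite ler_wpM2l// dist_int_le.
Qed.

Lemma geometric_unity t n : (1 - unity t) * \sum_(a < n) unity (a%:R * t) = 1 - unity t ^+ n.
Proof.
under eq_bigr do rewrite unity_nat.
by rewrite -{2}(expr1n _ n) subrXX; congr (_ * _); apply: eq_bigr => i _; rewrite expr1n mul1r.
Qed.

End complex_exponential.

(** * Fejer approximation of periodizations *)

Section fejer_kernel.
Variable R : realType.
Implicit Types f g h : R -> R.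

(** The Fejer kernel, summed over pairs: the usual weight [1 - |h| / D] of the frequency [h] is the
    number of pairs with [a - b = h], divided by [D]. *)
Definition fejer (D : nat) (t : R) : R :=
  D%:R^-1 * \sum_(a < D) \sum_(b < D) cos (2 * pi * (a%:R - b%:R) * t).

Lemma fejer_sqr D t : fejer D t = D%:R^-1 * cabs (\sum_(a < D) unity (a%:R * t)) ^+ 2.
Proof.
congr (_ * _); rewrite /cabs.
have -> : \sum_(a < D) unity (a%:R * t) =
    (\sum_(a < D) cos (2 * pi * (a%:R * t))) +i* (\sum_(a < D) sin (2 * pi * (a%:R * t))).
  by elim/big_ind3 : _ => // x1 x2 x3 y1 y2 y3 -> ->.
rewrite /= sqr_sqrtr ?addr_ge0 ?sqr_ge0// !expr2 !big_distrlr -big_split /=.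
apply: eq_bigr => a _; rewrite -big_split /=; apply: eq_bigr => b _.
by rewrite -cosB; congr cos; ring.
Qed.

Lemma fejer_ge0 D t : 0 <= fejer D t.
Proof. by rewrite fejer_sqr mulr_ge0// ?invr_ge0// exprn_ge0// cabs_ge0. Qed.

Lemma fejer_le D t : fejer D t <= D%:R.
Proof.
have [->|D0] := posnP D; first by rewrite /fejer big_ord0 mulr0.
have D0' : 0 < D%:R :> R by rewrite ltr0n.
rewrite fejer_sqr mulrC ler_pdivrMr// -expr2 ler_pXn2r ?nnegrE ?cabs_ge0//.
apply: le_trans (cabs_sum _ _ _) _.
under eq_bigr do rewrite cabs_unity.
by rewrite sumr_const card_ord.
Qed.

(** The kernel is [|S|^2 / D] with a geometric sum [S], and [|1 - unity t| * |S| <= 2] while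
    [|1 - unity t| >= 2 |t|]. *)
Lemma fejer_decay D t : `|t| <= 1 / 2 -> D%:R * t ^+ 2 * fejer D t <= 1.
Proof.
move=> t2; have [->|D0] := posnP D; first by rewrite !mul0r.
have D0' : 0 < D%:R :> R by rewrite ltr0n.
rewrite fejer_sqr; set S := cabs _.
have -> : D%:R * t ^+ 2 * (D%:R^-1 * S ^+ 2) = (`|t| * S) ^+ 2.
  by rewrite exprMn real_normK ?num_real//; field; rewrite gt_eqF.
rewrite -[1](expr1n _ 2) ler_pXn2r ?nnegrE ?mulr_ge0 ?cabs_ge0//.
have h : 2 * (`|t| * S) <= 2.
  rewrite mulrA; apply: le_trans (ler_wpM2r (cabs_ge0 _) (cabs_sub_unity_ge t2)) _.
  rewrite -cabsM geometric_unity; apply: le_trans (cabsD _ _) _.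
  by rewrite cabsN cabsX cabs_unity expr1n cabs1.
lra.
Qed.

Lemma measurable_cos_lin (c : R) : measurable_fun setT (fun t : R => cos (c * t)).
Proof.
apply: (measurableT_comp (f := cos)) => //.
by apply: continuous_measurable_fun; exact: continuous_cos.
Qed.

Lemma measurable_sin_lin (c : R) : measurable_fun setT (fun t : R => sin (c * t)).
Proof.
apply: (measurableT_comp (f := sin)) => //.
by apply: continuous_measurable_fun; exact: continuous_sin.
Qed.

Lemma measurable_fejer D : measurable_fun setT (fejer D).
Proof.
apply: measurable_funM => //; apply: measurable_sum => a.
by apply: measurable_sum => b; exact: measurable_cos_lin.
Qed.

Lemma fejer_int D (m : int) t : fejer D (t + m%:~R) = fejer D t.
Proof.
rewrite !fejer_sqr; congr (_ * cabs _ ^+ 2); apply: eq_bigr => a _.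
have aE : a%:R * m%:~R = (Posz a * m)%:~R :> R by rewrite intrM -pmulrn.
by rewrite mulrDr unityD aE unity_int mulr1.
Qed.

(** Half-open, so that its integer translates add up to exactly 1 at every point. *)
Definition halfbox (u : R) : R := ((- (1 / 2) <= u) && (u < 1 / 2))%R%:R.

Definition fejer_box D u := fejer D u * halfbox u.

Lemma kernMl (B : R) g f : measurable_fun setT g -> (forall x, `|g x| <= B) ->
  kern f -> kern (fun x => g x * f x).
Proof.
move=> mg gB kf; have [c [c0 _ fc f0]] := kern_wide 0 kf.
have B0 : 0 <= B by apply: le_trans (gB 0).
split; first by apply: measurable_funM => //; case: kf.
exists (B * c + c); split.
- by rewrite addr_ge0 ?mulr_ge0// ltW.
- move=> x; rewrite normrM; apply: le_trans (ler_pM _ _ (gB x) (fc x)) _ => //.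
  by rewrite lerDl ltW.
- move=> x h; rewrite f0 ?mulr0//; apply: le_lt_trans h.
  by rewrite lerDr mulr_ge0// ltW.
Qed.

Lemma kern_halfbox : kern halfbox.
Proof.
split.
  rewrite (_ : halfbox = \1_(`[- (1/2), 1/2[%classic : set R)).
    by apply: measurable_indic; exact: measurable_itv.
  apply/funext => w; rewrite indicE; congr (nat_of_bool _)%:R.
  by apply/idP/idP; rewrite ?inE /= in_itv.
exists 1; split=> //; first by move=> x; rewrite /halfbox; case: (_ && _); rewrite ?normr0 ?normr1.
move=> x x1; rewrite /halfbox; case: (boolP (_ && _)) => // /andP[h1 h2].
have : `|x| <= 1/2 by rewrite ler_norml h1 ltW. lra.
Qed.

Lemma kern_fejer_box D : kern (fejer_box D).
Proof.
apply: (@kernMl D%:R) kern_halfbox; first exact: measurable_fejer.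
by move=> x; rewrite ger0_norm ?fejer_ge0 ?fejer_le.
Qed.

Lemma halfbox_ge0 u : 0 <= halfbox u. Proof. by rewrite /halfbox ler0n. Qed.

Lemma fejer_box_ge0 D u : 0 <= fejer_box D u.
Proof. by rewrite mulr_ge0 ?fejer_ge0 ?halfbox_ge0. Qed.

Lemma integ_halfbox f : integ (fun u => halfbox u * f u) =
  Rintegral lebesgue_measure `[- (1/2), 1/2[%classic f.
Proof.
rewrite Rintegral_mkcond; congr Rintegral; apply/funext => u.
rewrite patchE /halfbox; case: ifPn => [|].
  by rewrite inE /= in_itv/= => ->; rewrite mul1r.
by rewrite notin_setE /= in_itv/= => /negP/negbTE ->; rewrite mul0r.
Qed.

Lemma integ_cos_period (h : int) : h != 0 ->
  integ (fun u => halfbox u * cos (2 * pi * h%:~R * u)) = 0.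
Proof.
move=> h0; set c := 2 * pi * h%:~R.
have p0 : pi != 0 :> R by rewrite gt_eqF ?pi_gt0.
have c0 : c != 0 by rewrite !mulf_neq0// intr_eq0.
have cc : continuous (fun u : R => cos (c * u)).
  move=> u; apply: (@continuous_comp _ _ _ (fun u => c * u) cos).
    exact: mulrl_continuous.
  exact: continuous_cos.
have dF (x : R) : is_derive x 1 (fun u : R => c^-1 * sin (c * u)) (cos (c * x)).
  have hd := @is_derive1_comp R sin (fun u => c * u) x (cos (c * x)) c _ _.
  have hl : is_derive x 1 (fun u : R => c * u) c.
    have := is_derive_affine c 0 x; congr is_derive.
    by apply/funext => u; rewrite addr0.
  have := is_deriveZ c^-1 (hd (is_derive_sin _) hl).
  move=> hh; apply: (is_derive_eq hh).
  by rewrite /GRing.scale /=; field.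
rewrite integ_halfbox Rintegral_itv_bndo_bndc; last first.
  have hI : lebesgue_measure.-integrable `[-(1/2), 1/2]%classic
      (EFin \o (fun u : R => cos (c * u))).
    apply: continuous_compact_integrable; first exact: segment_compact.
    exact: continuous_subspaceT.
  apply: integrableS hI => //.
  by apply: subset_itvl; rewrite bnd_simp.
rewrite /Rintegral (@continuous_FTC2 _ _ (fun u : R => c^-1 * sin (c * u)))//.
- rewrite mulrN sinN -EFinB /=.
  suff -> : sin (c * (1 / 2)) = 0 :> R by rewrite oppr0 mulr0 subrr.
  have -> : c * (1 / 2) = pi * h%:~R by rewrite /c; field.
  (* The sine vanishes at integer multiples of [pi] because
     [4 sin^2 (pi h) = |1 - unity h|^2 = 0]. *)
  have := cabs_sub_unity_sqr (h%:~R : R).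
  rewrite unity_int subrr cabs0 expr0n /= => /esym/eqP.
  by rewrite mulf_eq0 sqrf_eq0 pnatr_eq0 /= => /eqP.
- lra.
- exact: continuous_subspaceT.
- have cF : continuous (fun u : R => c^-1 * sin (c * u)).
    by move=> x; apply: differentiable_continuous; apply/derivable1_diffP; case: (dF x).
  split.
  + by move=> y _; case: (dF y).
  + by apply: cvg_at_right_filter; exact: cF.
  + by apply: cvg_at_left_filter; exact: cF.
- by move=> y _; rewrite derive1E; apply: derive_val.
Qed.

Lemma integ_sum (I : Type) (r : seq I) (P : pred I) (F : I -> R -> R) :
  (forall i, kern (F i)) ->
  kern (fun x => \sum_(i <- r | P i) F i x) /\
  integ (fun x => \sum_(i <- r | P i) F i x) = \sum_(i <- r | P i) integ (F i).
Proof.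
move=> kF; elim: r => [|i r [IH1 IH2]].
  rewrite big_nil (_ : (fun _ => _) = cst 0); last by apply/funext => x; rewrite big_nil.
  by split; [exact: kern0|rewrite /integ Rintegral_cst// mul0r].
rewrite big_cons; case: ifPn => Pi; last first.
  by rewrite (_ : (fun _ => _) = (fun x => \sum_(i <- r | P i) F i x))//;
    apply/funext => x; rewrite big_cons (negbTE Pi).
rewrite (_ : (fun _ => _) = F i \+ (fun x => \sum_(i <- r | P i) F i x)).
  by split; [exact: kernD|rewrite integD// IH2].
by apply/funext => x; rewrite big_cons Pi.
Qed.

Lemma integ_halfbox1 : integ halfbox = 1.
Proof.
rewrite (_ : halfbox = fun u => halfbox u * cst 1 u).
  rewrite integ_halfbox.
  transitivity (1 * fine (lebesgue_measure (`[- (1 / 2), 1 / 2[%classic : set R))).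
    exact: Rintegral_cst.
  by rewrite lebesgue_measure_itv/= lte_fin ifT -?EFinB /=; lra.
by apply/funext => u; rewrite mulr1.
Qed.

(** Only the [D] diagonal pairs have a nonzero integral over a period. *)
Lemma integ_fejer_box D : (0 < D)%N -> integ (fejer_box D) = 1.
Proof.
move=> D0; have D0' : D%:R != 0 :> R by rewrite pnatr_eq0 -lt0n.
rewrite (_ : fejer_box D = fun u => D%:R^-1 * \sum_(a < D) \sum_(b < D)
    (halfbox u * cos (2 * pi * (a%:R - b%:R) * u))); last first.
  apply/funext => u; rewrite /fejer_box /fejer mulrC mulrCA; congr (_ * _).
  by rewrite mulr_sumr; apply: eq_bigr => a _; rewrite mulr_sumr.
have k1 (a b : nat) : kern (fun u => halfbox u * cos (2 * pi * (a%:R - b%:R) * u)).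
  rewrite (_ : (fun _ => _) = fun u => cos (2 * pi * (a%:R - b%:R) * u) * halfbox u).
    apply: (@kernMl 1) kern_halfbox; first exact: measurable_cos_lin.
    by move=> x; exact: cos_max.
  by apply/funext => u; rewrite mulrC.
have k2 (a : nat) := integ_sum (index_enum 'I_D) xpredT (fun b : 'I_D => k1 a b).
have [k3 e3] := integ_sum (index_enum 'I_D) xpredT (fun a : 'I_D => (k2 a).1).
rewrite integZ// e3.
have e4 (a : 'I_D) : integ (fun x => \sum_(b < D) (halfbox x * cos (2 * pi * (a%:R - b%:R) * x))) = 1.
  rewrite (k2 a).2 (bigD1 a)//= subrr mulr0 [X in integ X + _](_ : _ = halfbox).
    rewrite integ_halfbox1 big1 ?addr0// => b ba.
    have := @integ_cos_period (Posz a - Posz b).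
    rewrite intrB -!pmulrn subr_eq0; apply.
    by apply: contra ba; rewrite eqz_nat eq_sym.
  by apply/funext => u; rewrite mul0r cos0 mulr1.
rewrite (eq_bigr (fun=> 1)) ?sumr_const ?card_ord ?mulVf//.
Qed.

Definition ball_ind (r u : R) : R := (`|u| <= r)%R%:R.

Lemma ball_ind_ge0 r u : 0 <= ball_ind r u. Proof. by rewrite /ball_ind ler0n. Qed.

Lemma kern_ball_ind r : kern (ball_ind r).
Proof.
split.
  rewrite (_ : ball_ind r = \1_(`[- r, r]%classic : set R)).
    by apply: measurable_indic; exact: measurable_itv.
  apply/funext => w; rewrite indicE /ball_ind ler_norml; congr (nat_of_bool _)%:R.
  by apply/idP/idP; rewrite ?inE /= in_itv.
exists (1 + `|r|); split; first by rewrite addr_ge0.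
  move=> x; apply: (@le_trans _ _ 1); last by rewrite lerDl.
  by rewrite /ball_ind; case: (`|x| <= r)%R; rewrite ?normr0 ?normr1.
by move=> x h; rewrite /ball_ind leNgt (_ : r < `|x|)//; have := ler_norm r; lra.
Qed.

Lemma integ_ball_ind r : 0 <= r -> integ (ball_ind r) = 2 * r.
Proof.
move=> r0; rewrite (_ : integ _ = Rintegral lebesgue_measure `[- r, r]%classic (cst 1)).
  transitivity (1 * fine (lebesgue_measure (`[- r, r]%classic : set R))).
    exact: Rintegral_cst.
  rewrite lebesgue_measure_itv/= lte_fin.
  case: ifPn => h /=; first by rewrite mul1r opprK; lra.
  rewrite mul1r; lra.
rewrite Rintegral_mkcond; congr Rintegral; apply/funext => u.
rewrite patchE /ball_ind ler_norml; case: ifPn => [|].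
  by rewrite inE /= in_itv/= => ->.
by rewrite notin_setE /= in_itv/= => /negP/negbTE ->.
Qed.

(** A majorant of [1 / |u|] by step functions on dyadic balls, which makes the logarithm in the
    first moment of the Fejer kernel appear as a count of scales. *)
Lemma dyadic_cover q (u : R) : `|u| <= 1 ->
  `|u| <= 2 ^- q \/ `|u|^-1 <= \sum_(i < q) 2 ^+ i.+1 * ball_ind (2 ^- i) u.
Proof.
move=> u1; elim: q => [|q [IH|IH]]; first by left; rewrite expr0 invr1.
  have [h|h] := leP `|u| (2 ^- q.+1); first by left.
  right; rewrite big_ord_recr /= [X in _ <= _ + _ * X](_ : _ = 1).
    rewrite mulr1; apply: (@le_trans _ _ (2 ^+ q.+1)).
      by rewrite -[leRHS]invrK lef_pV2 ?posrE ?invr_gt0 ?exprn_gt0// ?ltW// (lt_trans _ h)// invr_gt0 exprn_gt0.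
    by rewrite lerDr sumr_ge0// => i _; rewrite mulr_ge0 ?exprn_ge0 ?ball_ind_ge0.
  by rewrite /ball_ind IH.
right; rewrite big_ord_recr /=; apply: le_trans IH _.
by rewrite lerDl mulr_ge0 ?exprn_ge0 ?ball_ind_ge0.
Qed.

(** With [D = 2 ^ q]: inside the ball of radius [1 / D] use [fejer <= D], outside use
    [|u| * fejer <= 1 / (D |u|)] and [dyadic_cover]. Each of the [q] scales contributes [4 / D] and
    the central ball [2 / D]. *)
Lemma fejer_box_moment q :
  integ (fun u => `|u| * fejer_box (2 ^ q) u) <= (4 * q%:R + 2) / 2 ^+ q.
Proof.
set D := (2 ^ q)%N.
have DE : D%:R = 2 ^+ q :> R by rewrite /D natrX.
have D0 : 0 < 2 ^+ q :> R by rewrite exprn_gt0.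
pose G u := ball_ind (2 ^- q) u + \sum_(i < q) (2 ^+ i.+1 / 2 ^+ q) * ball_ind (2 ^- i) u.
have kG0 := integ_sum (index_enum 'I_q) xpredT
  (fun i : 'I_q => kernZ (2 ^+ i.+1 / 2 ^+ q) (kern_ball_ind (2 ^- i))).
have kG : kern G by apply: kernD; [exact: kern_ball_ind|exact: kG0.1].
have kF : kern (fun u => `|u| * fejer_box D u).
  have kb := kern_fejer_box D; split.
    by apply: measurable_funM; [exact: normr_measurable|case: kb].
  have [c [c0 _ fc f0]] := kern_wide 1 kb; exists (c + c); split.
  - by rewrite addr_ge0// ltW.
  - move=> u; have [h|h] := ltP (1/2) `|u|.
      rewrite /fejer_box /halfbox; suff -> : (- (1 / 2) <= u) && (u < 1 / 2) = false.
        by rewrite !mulr0 normr0 addr_ge0// ltW.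
      apply/negP => /andP[h1 h2]; suff : `|u| <= 1/2 by lra.
      by rewrite ler_norml h1 ltW.
    rewrite normrM normr_id; apply: le_trans (_ : 1 * c <= _); last by rewrite mul1r lerDl ltW.
    by apply: ler_pM => //; lra.
  - by move=> u h; rewrite f0 ?mulr0//; lra.
apply: (@le_trans _ _ (integ G)).
  apply: le_integ => // u; rewrite /fejer_box /halfbox /G.
  have S0 : 0 <= \sum_(i < q) (2 ^+ i.+1 / 2 ^+ q) * ball_ind (2 ^- i) u.
    by apply: sumr_ge0 => i _; rewrite !mulr_ge0 ?invr_ge0 ?exprn_ge0 ?ball_ind_ge0.
  case: (boolP (_ && _)) => [/andP[h1 h2]|_]; last first.
    by rewrite !mulr0 addr_ge0 ?ball_ind_ge0.
  rewrite mulr1; have u2 : `|u| <= 1 / 2 by rewrite ler_norml h1 ltW.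
  have u1 : `|u| <= 1 by lra.
  have [h|h] := dyadic_cover q u1.
    rewrite /ball_ind h; apply: (@le_trans _ _ 1); last by rewrite lerDl.
    apply: le_trans (ler_pM _ _ h (fejer_le D u)) _ => //; first exact: fejer_ge0.
    by rewrite DE mulVf// gt_eqF.
  apply: (@le_trans _ _ (\sum_(i < q) (2 ^+ i.+1 / 2 ^+ q) * ball_ind (2 ^- i) u)); last first.
    by rewrite lerDr ball_ind_ge0.
  have [u0e|u0] := eqVneq u 0.
    by move: S0; rewrite {2}u0e normr0 mul0r.
  have un0 : 0 < `|u| by rewrite normr_gt0.
  apply: (@le_trans _ _ (`|u|^-1 / 2 ^+ q)).
    rewrite -invfM -div1r ler_pdivlMr ?mulr_gt0//.
    rewrite (_ : _ * _ = D%:R * u ^+ 2 * fejer D u); first exact: fejer_decay.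
    by rewrite DE -[u ^+ 2]real_normK ?num_real//; ring.
  rewrite ler_pdivrMr// mulr_suml; apply: le_trans h _.
  apply: ler_sum => i _; apply: eq_bound.
  by field; rewrite gt_eqF.
rewrite /G integD; [|exact: kern_ball_ind|exact: kG0.1].
rewrite kG0.2 integ_ball_ind ?invr_ge0 ?exprn_ge0//.
rewrite (eq_bigr (fun=> 4 / 2 ^+ q)); last first.
  move=> i _; rewrite integZ; last exact: kern_ball_ind.
  rewrite integ_ball_ind ?invr_ge0 ?exprn_ge0// exprS.
  by field; rewrite ?gt_eqF ?exprn_gt0.
rewrite sumr_const card_ord -mulr_natr; apply: eq_bound.
by field; rewrite gt_eqF.
Qed.

End fejer_kernel.

Section periodization.
Variable R : realType.
Implicit Types (f g : R -> R) (x t : R) (n N : nat).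

Definition wsum N f x : R := \sum_(i < N) f (x + i%:R).

Lemma wsum_extend (C : R) f x N m : bsupp C f -> (N <= m)%N -> C < x + N%:R ->
  wsum m f x = wsum N f x.
Proof.
move=> f0 Nm CN; rewrite /wsum.
rewrite -(big_mkord xpredT (fun i => f (x + i%:R))) (big_cat_nat (n := N))//=.
rewrite big_mkord [X in _ + X]big_nat [X in _ + X]big1 ?addr0// => i /andP[Ni _].
apply: f0; have : N%:R <= i%:R :> R by rewrite ler_nat.
by have := ler_norm (x + i%:R); lra.
Qed.

Lemma wsum_drop (C : R) f x q N : bsupp C f -> x + q%:R < - C ->
  wsum (q + N) f x = wsum N f (x + q%:R).
Proof.
move=> f0 xC; rewrite /wsum big_split_ord /= big1 ?add0r.
  by apply: eq_bigr => i _; rewrite natrD addrA.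
move=> i _; apply: f0; have : i%:R <= q%:R :> R by rewrite ler_nat ltnW.
by have := ler_norm (- (x + i%:R)); rewrite normrN; lra.
Qed.

(** Both windows run over all translates that meet the support. They are compared after padding to a
    common longer window; a negative shift [m] is handled by exchanging the two sides. *)
Lemma wsum_eq (C : R) f x x' N N' (m : int) : bsupp C f -> x' = x + m%:~R ->
  x < - C -> C < x + N%:R -> x' < - C -> C < x' + N'%:R ->
  wsum N f x = wsum N' f x'.
Proof.
move=> f0.
have main y y' k k' (q : nat) : y' = y + q%:R -> y < - C -> C < y + k%:R ->
    y' < - C -> C < y' + k'%:R -> wsum k f y = wsum k' f y'.
  move=> -> h1 h2 h3 h4; rewrite -(wsum_drop k' f0 h3).
  rewrite -(@wsum_extend C f y k (k + (q + k'))) ?leq_addr//.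
  rewrite -(@wsum_extend C f y (q + k') (k + (q + k'))) ?leq_addl//.
  by rewrite natrD addrA.
case: m => q e h1 h2 h3 h4; first by apply: (main x x' N N' q).
apply/esym; apply: (main x' x N' N q.+1) => //.
by rewrite e NegzE mulrNz -pmulrn subrK.
Qed.

(* The 1-periodization of [f], as a finite sum that is valid when [f] is supported in
   [[-n, n]]. *)
Definition per n f t : R := wsum (2 * n + 3)%N f (Defs.frac t - n.+1%:R).

Lemma frac_itv t : 0 <= Defs.frac t < 1.
Proof.
rewrite /Defs.frac; have := floor_le t; have := floorD1_gt t; rewrite intrD.
by move=> h1 h2; apply/andP; split; lra.
Qed.

Lemma per_eq n f t x N (m : int) : bsupp n%:R f -> x = t + m%:~R ->
  x < - n%:R -> n%:R < x + N%:R -> wsum N f x = per n f t.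
Proof.
move=> f0 e h1 h2; have /andP[t0 t1] := frac_itv t.
apply: (@wsum_eq n%:R _ _ _ _ _ (- m - Num.floor t - Posz n.+1)) => //.
- by rewrite e /Defs.frac !intrB !mulrNz -pmulrn; ring.
- by rewrite -natr1; lra.
- by rewrite natrD natrM -natr1; lra.
Qed.

Lemma per_bound n f t (B : R) : (forall x, `|f x| <= B) ->
  `|per n f t| <= (2 * n + 3)%N%:R * B.
Proof.
move=> fB; apply: le_trans (ler_norm_sum _ _ _) _.
apply: le_trans (ler_sum _ (fun i _ => fB _)) _.
by rewrite sumr_const card_ord mulr_natl lexx.
Qed.

(** [halfbox v = H v - H (v - 1)] for a Heaviside function [H], so the sum telescopes. *)
Lemma sum_halfbox (s : R) N : s <= -1 -> 1 <= s + N%:R ->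
  \sum_(i < N) halfbox (s + i%:R) = 1.
Proof.
move=> h1 h2; pose H (v : R) : R := (- (1 / 2) <= v)%R%:R.
have hE v : halfbox v = H v - H (v - 1).
  rewrite /halfbox /H ltNge.
  have -> : (- (1 / 2) <= v - 1) = (1 / 2 <= v) by apply/idP/idP; lra.
  have [a|a] := leP (- (1 / 2)) v; have [b|b] := leP (1 / 2) v => //=.
  - by rewrite subrr.
  - by rewrite subr0.
  - by exfalso; lra.
  - by rewrite subr0.
have N0 : (0 < N)%N by case: N h2 => // h; exfalso; lra.
rewrite (eq_bigr (fun i : 'I_N => H (s + i.+1%:R - 1) - H (s + i%:R - 1))); last first.
  by move=> i _; rewrite hE -natr1; congr (H _ - _); ring.
rewrite -(big_mkord xpredT (fun i => H (s + i.+1%:R - 1) - H (s + i%:R - 1))).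
rewrite telescope_sumr// /H addr0.
rewrite (_ : (- (1 / 2) <= s + N%:R - 1) = true); last by lra.
rewrite (_ : (- (1 / 2) <= s - 1) = false) ?subr0//.
by apply/negbTE; rewrite -ltNge; lra.
Qed.

Lemma bsupp_convol (a b : R) f g : bsupp a f -> bsupp b g -> bsupp (a + b) (convol f g).
Proof.
move=> fa gb x hx; rewrite /convol (_ : (fun _ => _) = cst 0).
  by rewrite /integ Rintegral_cst// mul0r.
apply/funext => y /=; have [h|h] := ltP b `|y|; first by rewrite gb// mulr0.
by rewrite fa ?mul0r//; have := ler_normD (x - y) y; rewrite subrK; lra.
Qed.

Lemma bsupp_halfbox : bsupp (1 / 2 : R) (@halfbox R).
Proof.
move=> x x1; rewrite /halfbox; case: (boolP (_ && _)) => // /andP[h1 h2].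
have : `|x| <= 1/2 by rewrite ler_norml h1 ltW.
lra.
Qed.

(* [fejer_box] is the Fejer kernel cut to one period, so the periodization of
   [convol (fejer_box D) f] is a trigonometric polynomial; [fejer_rest] stays in the
   class of compactly supported kernels and can be iterated. *)
Definition fejer_rest D f := f \- convol (fejer_box D) f.

Lemma kern_fejer_rest D f : kern f -> kern (fejer_rest D f).
Proof. by move=> kf; apply: kernB => //; apply: kern_convol => //; exact: kern_fejer_box. Qed.

Lemma bsupp_fejer_rest D n f : bsupp n%:R f -> bsupp n.+1%:R (fejer_rest D f).
Proof.
move=> f0 x hx; rewrite /fejer_rest /= f0; last by move: hx; rewrite -natr1; lra.
have hb : bsupp (1 / 2) (@fejer_box R D).
  by move=> y hy; rewrite /fejer_box bsupp_halfbox// mulr0.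
by rewrite (bsupp_convol hb f0) ?subrr//; move: hx; rewrite -natr1; lra.
Qed.

(** Periodizing [fejer_box] restores the full Fejer kernel, because [fejer] is 1-periodic and the
    translates of [halfbox] form a partition of unity. *)
Lemma per_split D n f t : kern f -> bsupp n%:R f ->
  per n f t = per n.+1 (fejer_rest D f) t + integ (fun v => fejer D (t - v) * f v).
Proof.
move=> kf f0; have k1 := kern_fejer_rest D kf; have f1 := @bsupp_fejer_rest D n f f0.
(* The window of length [2 K] that starts at [t - K] covers the supports of [f] and of
   [fejer_rest D f], and still covers that of [halfbox] after a shift by any [v] with [|v| <= n]. *)
pose K := (n + Num.bound `|t| + 3)%N.
have tK : `|t| < (Num.bound `|t|)%:R by exact: archi_boundP.
have KE : K%:R = n%:R + (Num.bound `|t|)%:R + 3 :> R by rewrite /K !natrD.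
have t1 := ler_norm t; have t2 := ler_norm (- t); rewrite normrN in t2.
set x := t + (- Posz K)%:~R.
have xE : x = t - K%:R by rewrite /x mulrNz -pmulrn.
pose N := (K + K)%N.
have NE : N%:R = K%:R + K%:R :> R by rewrite /N natrD.
rewrite -(@per_eq n f t x N (- Posz K))//; [|rewrite xE; lra|rewrite xE NE; lra].
rewrite -(@per_eq n.+1 (fejer_rest D f) t x N (- Posz K))//; last 2 first.
- by rewrite xE -natr1; lra.
- by rewrite xE NE -natr1; lra.
have kb := kern_fejer_box R D.
have -> : wsum N (fejer_rest D f) x =
    wsum N f x - \sum_(i < N) convol (fejer_box D) f (x + i%:R) by rewrite /wsum -sumrB.
rewrite -addrA -[LHS]addr0; congr (_ + _); apply/eqP; rewrite eq_sym addrC subr_eq0.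
apply/eqP/esym.
have [_ <-] := integ_sum (index_enum 'I_N) xpredT
  (fun i : 'I_N => kern_convol_section (x + i%:R) kb kf).
congr integ; apply/funext => v.
have [h|h] := ltP n%:R `|v|.
  by rewrite f0// mulr0 big1// => i _; rewrite mulr0.
rewrite -mulr_suml; congr (_ * _); rewrite /fejer_box.
rewrite (eq_bigr (fun i : 'I_N => fejer D (t - v) * halfbox (x - v + i%:R))); last first.
  move=> i _; congr (_ * halfbox _); last by ring.
  rewrite -(fejer_int D (Posz i - Posz K) (t - v)); congr fejer.
  by rewrite intrB -!pmulrn xE; ring.
have v1 := ler_norm v; have v2 := ler_norm (- v); rewrite normrN in v2.
by rewrite -mulr_sumr sum_halfbox ?mulr1// xE ?NE; lra.
Qed.

(** The Fourier coefficient of [f] at the frequency [a - b], divided by [D] and attached to the pair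
    [(a, b)]. *)
Definition trigc D f (a b : nat) : R[i] :=
  (D%:R^-1)%:C * (integ (fun v => cos (2 * pi * (a%:R - b%:R) * v) * f v) +i*
    - integ (fun v => sin (2 * pi * (a%:R - b%:R) * v) * f v)).

Let kcos c f : kern f -> kern (fun v => cos (c * v) * f v).
Proof.
move=> kf; apply: (@kernMl _ 1) => //; first exact: measurable_cos_lin.
by move=> v; exact: cos_max.
Qed.

Let ksin c f : kern f -> kern (fun v => sin (c * v) * f v).
Proof.
move=> kf; apply: (@kernMl _ 1) => //; first exact: measurable_sin_lin.
by move=> v; exact: sin_max.
Qed.

Lemma fejer_trig D f t : kern f ->
  (integ (fun v => fejer D (t - v) * f v))%:C =
  \sum_(a < D) \sum_(b < D) trigc D f a b * unity ((a%:R - b%:R) * t).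
Proof.
move=> kf.
pose th (a b : nat) : R := 2 * pi * (a%:R - b%:R).
pose A a b := integ (fun v => cos (th a b * v) * f v).
pose B a b := integ (fun v => sin (th a b * v) * f v).
pose X a b := D%:R^-1 * (cos (th a b * t) * A a b + sin (th a b * t) * B a b).
pose Y a b := D%:R^-1 * (sin (th a b * t) * A a b - cos (th a b * t) * B a b).
have E a b : trigc D f a b * unity ((a%:R - b%:R) * t) = X a b +i* Y a b.
  rewrite /trigc /unity /expi -[2 * pi * ((_ - _) * t)]/(2 * pi * ((a%:R - b%:R) * t)).
  rewrite mulrA -/(th a b) -/(A a b) -/(B a b) /X /Y.
  by apply/eqP; rewrite eq_complex /=; apply/andP; split; apply/eqP; ring.
transitivity ((\sum_(a < D) \sum_(b < D) X a b) +i* (\sum_(a < D) \sum_(b < D) Y a b)); last first.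
  elim/big_ind3 : _ => // [x1 x2 x3 y1 y2 y3 <- <- //|a _].
  by elim/big_ind3 : _ => // x1 x2 x3 y1 y2 y3 <- <- //.
(* The imaginary parts cancel: exchanging [a] and [b] changes the sign of [Y]. *)
have -> : \sum_(a < D) \sum_(b < D) Y a b = 0.
  set S := \sum_(a < D) _; suff : S = - S by lra.
  rewrite {1}/S exchange_big /= -sumrN; apply: eq_bigr => a _.
  rewrite -sumrN; apply: eq_bigr => b _.
  have thN : th b a = - th a b by rewrite /th; ring.
  rewrite /Y /A /B thN !mulNr sinN cosN.
  have -> : (fun v => cos (- th a b * v) * f v) = (fun v => cos (th a b * v) * f v).
    by apply/funext => v; rewrite mulNr cosN.
  have -> : (fun v => sin (- th a b * v) * f v) = (fun v => -1 * (sin (th a b * v) * f v)).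
    by apply/funext => v; rewrite [in LHS]mulNr sinN; ring.
  by rewrite integZ; [ring|exact: ksin].
congr (_ +i* _).
rewrite (_ : (fun _ => _) = fun v => D%:R^-1 * \sum_(a < D) \sum_(b < D)
    (cos (th a b * t) * (cos (th a b * v) * f v) + sin (th a b * t) * (sin (th a b * v) * f v))); last first.
  apply/funext => v; rewrite /fejer -mulrA; congr (_ * _).
  rewrite mulr_suml; apply: eq_bigr => a _; rewrite mulr_suml; apply: eq_bigr => b _.
  by rewrite -/(th a b) mulrBr cosB; ring.
have k1 (a b : nat) : kern (fun v => cos (th a b * t) * (cos (th a b * v) * f v) +
    sin (th a b * t) * (sin (th a b * v) * f v)).
  by apply: kernD; apply: kernZ; [exact: kcos|exact: ksin].
have k2 (a : nat) := integ_sum (index_enum 'I_D) xpredT (fun b : 'I_D => k1 a b).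
have [k3 e3] := integ_sum (index_enum 'I_D) xpredT (fun a : 'I_D => (k2 a).1).
rewrite integZ// e3 mulr_sumr; apply: eq_bigr => a _.
rewrite (k2 a).2 mulr_sumr; apply: eq_bigr => b _.
rewrite /X; congr (_ * _); rewrite integD; [|by apply: kernZ; exact: kcos|by apply: kernZ; exact: ksin].
by rewrite !integZ//; [exact: ksin|exact: kcos].
Qed.

Lemma cabs_le_sum (x y : R) : cabs (x +i* y) <= `|x| + `|y|.
Proof.
rewrite /cabs /= -[leRHS]ger0_norm ?addr_ge0// -sqrtr_sqr ler_sqrt ?sqr_ge0//.
rewrite sqrrD !real_normK ?num_real// -addrA [X in _ <= _ + X]addrC.
by rewrite addrA lerDl mulrn_wge0// mulr_ge0.
Qed.

Lemma cabs_trigc D f a b : kern f -> (0 < D)%N ->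
  cabs (trigc D f a b) <= 2 * integ (fun x => `|f x|).
Proof.
move=> kf D0; rewrite /trigc cabsM cabs_real.
have kn := kern_norm kf.
have I0 : 0 <= integ (fun x => `|f x|) by apply: Rintegral_ge0.
have h1 c : `|integ (fun v => cos (c * v) * f v)| <= integ (fun x => `|f x|).
  apply: le_trans (le_norm_integ (kcos _ kf)) _.
  apply: le_integ => //; first by apply: kern_norm; exact: kcos.
  by move=> v; rewrite normrM ler_piMl// cos_max.
have h2 c : `|integ (fun v => sin (c * v) * f v)| <= integ (fun x => `|f x|).
  apply: le_trans (le_norm_integ (ksin _ kf)) _.
  apply: le_integ => //; first by apply: kern_norm; exact: ksin.
  by move=> v; rewrite normrM ler_piMl// sin_max.
rewrite -[leRHS]mul1r; apply: ler_pM => //; first exact: cabs_ge0.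
  by rewrite normfV normr_nat invf_le1 ?ltr0n// ler1n.
apply: le_trans (cabs_le_sum _ _) _; rewrite normrN.
apply: le_trans (lerD (h1 _) (h2 _)) _; lra.
Qed.

Lemma sum_trigc D f : kern f -> (0 < D)%N -> \sum_(a < D) trigc D f a a = (integ f)%:C.
Proof.
move=> kf D0; rewrite (eq_bigr (fun=> (D%:R^-1 * integ f)%:C)); last first.
  move=> a _; rewrite /trigc subrr mulr0.
  have -> : (fun v => cos (0 * v) * f v) = f.
    by apply/funext => v; rewrite mul0r cos0 mul1r.
  have -> : (fun v => sin (0 * v) * f v) = cst 0.
    by apply/funext => v; rewrite mul0r sin0 mul0r.
  rewrite [integ (cst 0)]/integ Rintegral_cst// mul0r oppr0 rmorphM //=.
rewrite sumr_const card_ord -rmorphMn -mulrnAl -mulr_natl divff ?mul1r//.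
by rewrite pnatr_eq0 -lt0n.
Qed.

Lemma kern_moment f : kern f -> kern (fun u => `|u| * f u).
Proof.
move=> kf; have [c [c0 _ fc f0]] := kern_wide 0 kf.
split; first by apply: measurable_funM; [exact: normr_measurable|case: kf].
exists (c * c + c); split.
- by rewrite addr_ge0 ?mulr_ge0// ltW.
- move=> u; have [h|h] := ltP c `|u|.
    by rewrite f0// mulr0 normr0 addr_ge0 ?mulr_ge0// ltW.
  rewrite normrM normr_id; apply: le_trans (ler_pM _ _ h (fc u)) _ => //.
  by rewrite lerDl ltW.
- by move=> u h; rewrite f0 ?mulr0//; apply: le_lt_trans h; rewrite lerDr mulr_ge0// ltW.
Qed.

(** As [fejer_box] has integral 1, differences of the rest are averages of [G t - G (t - y)]. One
    order of [dbound] pays for this increment with a factor [|y|], and averaging yields the first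
    moment. *)
Lemma dbound_fejer_rest D M (B eta : R) f : kern f -> (0 < D)%N ->
  integ (fun u => `|u| * fejer_box D u) <= eta ->
  dbound M.+1 B f -> dbound M (B * eta) (fejer_rest D f).
Proof.
move=> kf D0 het hB us sM t; have kb := kern_fejer_box R D.
have [kd e] := diffs_convol us kf kb.
have B0 := dbound_ge0 hB.
rewrite /fejer_rest (convolC kb kf) diffsB e /= /convol; set G := diffs us f.
have kG := kern_convol_section t kd kb.
have -> : G t - integ (fun y => G (t - y) * fejer_box D y) =
    integ (fun y => (G t - G (t - y)) * fejer_box D y).
  rewrite -[X in X - _]mulr1 -(integ_fejer_box R D0) -integZ// -integB//; last exact: kernZ.
  by congr integ; apply/funext => y /=; ring.
have kH : kern (fun y => (G t - G (t - y)) * fejer_box D y).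
  rewrite (_ : (fun _ => _) = (fun y => G t * fejer_box D y) \- (fun y => G (t - y) * fejer_box D y)).
    by apply: kernB => //; exact: kernZ.
  by apply/funext => y /=; ring.
apply: le_trans (le_norm_integ kH) _.
have km := kern_moment kb.
apply: (@le_trans _ _ (integ (fun u => B * absprod us * (`|u| * fejer_box D u)))).
  apply: le_integ; [exact: kern_norm|exact: kernZ|].
  move=> u; rewrite normrM (ger0_norm (fejer_box_ge0 _ _)) [leRHS]mulrA.
  apply: ler_wpM2r; first exact: fejer_box_ge0.
  have := hB (u :: us); rewrite /= sM => /(_ erefl t).
  by rewrite diffs_diff1 /diff1 /absprod big_cons [`|u| * _]mulrC mulrA.
rewrite integZ// [B * eta * _]mulrAC.
by rewrite ler_wpM2l// mulr_ge0 ?absprod_ge0.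
Qed.

(** [M.+1] Fejer means in succession, each applied to the rest left by the previous one. Every step
    trades one order of smoothness for one first moment and enlarges the support radius by 1. A rest
    at most doubles the L_1 norm, and [2 + 2 * 4 ^+ M.+1 <= 4 ^+ M.+2] bounds the coefficients. *)
Theorem fejer_approx M q n f B : kern f -> bsupp n%:R f -> dbound M.+1 B f ->
  exists c : nat -> nat -> R[i],
  [/\ forall a b, cabs (c a b) <= 4 ^+ M.+1 * integ (fun x => `|f x|),
     \sum_(a < 2 ^ q) c a a = (integ f)%:C &
     forall t, cabs ((per n f t)%:C -
         \sum_(a < 2 ^ q) \sum_(b < 2 ^ q) c a b * unity ((a%:R - b%:R) * t)) <=
       (2 * (n + M.+1) + 3)%N%:R * (B * ((4 * q%:R + 2) / 2 ^+ q) ^+ M.+1)].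
Proof.
set D := (2 ^ q)%N; have D0 : (0 < D)%N by rewrite expn_gt0.
elim: M n f B => [|M IH] n f B kf f0 hB.
  exists (trigc D f); split.
  - move=> a b; apply: le_trans (cabs_trigc _ _ kf D0) _.
    by rewrite ler_wpM2r ?Rintegral_ge0// expr1; lra.
  - exact: sum_trigc.
  - move=> t; rewrite (per_split D t kf f0) rmorphD /= fejer_trig// addrK cabs_real addn1.
    apply: per_bound => x; rewrite expr1.
    have := dbound_fejer_rest kf D0 (fejer_box_moment R q) hB.
    by move=> /(_ [::] erefl x); rewrite /absprod big_nil mulr1.
have k1 := kern_fejer_rest D kf; have f1 := @bsupp_fejer_rest D n f f0.
have h1 := dbound_fejer_rest kf D0 (fejer_box_moment R q) hB.
have [c [c1 c2 c3]] := IH n.+1 _ _ k1 f1 h1.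
have kb := kern_fejer_box R D.
have I0 (g : R -> R) : 0 <= integ (fun x => `|g x|) by exact: Rintegral_ge0.
have I1 : integ (fun x => `|fejer_rest D f x|) <= 2 * integ (fun x => `|f x|).
  have kc := kern_convol kb kf.
  apply: (@le_trans _ _ (integ (fun x => `|f x| + `|convol (fejer_box D) f x|))).
    apply: le_integ; [exact: kern_norm| |by move=> x; exact: ler_normB].
    by apply: kernD; exact: kern_norm.
  rewrite integD; [|exact: kern_norm|exact: kern_norm].
  rewrite mulr2n mulrDl mul1r lerD2l.
  have kn := kern_norm kf.
  apply: (@le_trans _ _ (integ (convol (fejer_box D) (fun x => `|f x|)))).
    apply: le_integ; [exact: kern_norm|exact: kern_convol|].
    move=> x; have ks := kern_convol_section x kb kf.
    apply: le_trans (le_norm_integ ks) _.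
    rewrite /convol; apply: eq_bound.
    congr integ; apply/funext => y.
    by rewrite normrM (ger0_norm (fejer_box_ge0 _ _)).
  by rewrite integ_convol// integ_fejer_box// mul1r.
exists (fun a b => trigc D f a b + c a b); split.
- move=> a b; apply: le_trans (cabsD _ _) _.
  apply: le_trans (lerD (cabs_trigc a b kf D0) (c1 a b)) _.
  have p1 : 1 <= 4 ^+ M.+1 :> R by rewrite exprn_ege1// ler1n.
  have := ler_wpM2l (exprn_ge0 M.+1 (ler0n R 4)) I1.
  rewrite [4 ^+ M.+2]exprS; move: p1 (I0 f) I1.
  move: (4 ^+ M.+1) (integ _) (integ _) => P J I p1 J0 I1 PI.
  by have := ler_wpM2r J0 p1; lra.
- rewrite big_split /= c2 sum_trigc// -rmorphD /=; congr (_%:C).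
  (* The rest has integral 0, so only the first Fejer mean contributes to the frequency 0. *)
  rewrite /fejer_rest integB//; last exact: kern_convol.
  by rewrite integ_convol// integ_fejer_box// mul1r subrr addr0.
- move=> t; rewrite (per_split D t kf f0) rmorphD /= fejer_trig//.
  set T := \sum_(a < D) _; set Q := \sum_(a < D) _.
  have -> : Q = T + \sum_(a < D) \sum_(b < D) c a b * unity ((a%:R - b%:R) * t).
    rewrite /Q /T -big_split; apply: eq_bigr => a _; rewrite -big_split.
    by apply: eq_bigr => b _; rewrite mulrDl.
  have ringE (u v w : R[i]) : u + v - (v + w) = u - w by ring.
  rewrite ringE.
  apply: le_trans (c3 t) _; rewrite addSnnS; apply: eq_bound.
  by rewrite -mulrA -exprS.
Qed.

End periodization.

(** * Abel summation and products of trigonometric polynomials *)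

Section abel.
Variable R : realType.

(** Multiplication by [1 - z] replaces [phi] by its backward difference. There are no boundary terms
    since [phi] vanishes on both sides; the sum becomes one term longer at each of the [M] rounds,
    whence [N + M]. *)
Lemma abel_summation (M N : nat) (phi : R -> R) (z : R[i]) (B : R) :
  cabs z = 1 -> (forall x : R, x <= 0 -> phi x = 0) ->
  (forall x : R, N%:R <= x -> phi x = 0) ->
  (forall t, `|diffs (nseq M 1) phi t| <= B) ->
  cabs (1 - z) ^+ M * cabs (\sum_(i < N) (phi i%:R)%:C * z ^+ i) <= (N + M)%N%:R * B.
Proof.
move=> z1; elim: M N phi => [|M IH] N phi p0 pN pB.
  rewrite expr0 mul1r addn0; apply: le_trans (cabs_sum _ _ _) _.
  apply: le_trans (ler_sum _ (_ : forall i, _ -> _ <= B)) _.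
    by move=> i _; rewrite cabsM cabsX z1 expr1n mulr1 cabs_real; exact: pB.
  by rewrite sumr_const card_ord mulr_natl lexx.
have E : (1 - z) * \sum_(i < N) (phi i%:R)%:C * z ^+ i =
    \sum_(i < N.+1) (diff1 1 phi i%:R)%:C * z ^+ i.
  rewrite /diff1 (eq_bigr (fun i : 'I_N.+1 => (phi i%:R)%:C * z ^+ i -
      (phi (i%:R - 1))%:C * z ^+ i)); last by move=> i _; rewrite rmorphB mulrBl.
  rewrite sumrB big_ord_recr /= pN// mul0r addr0 mulrBl mul1r; congr (_ - _).
  rewrite big_ord_recl /= sub0r p0 ?mul0r ?add0r; last by rewrite lerN10.
  rewrite mulr_sumr; apply: eq_bigr => i _.
  by rewrite /bump /= add1n -natr1 addrK exprS; ring.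
rewrite exprSr -mulrA -cabsM E addnS -addSn; apply: IH.
- by move=> x x0; rewrite /diff1 !p0 ?subrr//; lra.
- by move=> x; rewrite -natr1 => hx; rewrite /diff1 !pN ?subrr//; lra.
- exact: pB.
Qed.

End abel.

Section trig_products.
Variable R : realType.

Lemma prod_sub_le k (x y : 'I_k -> R[i]) (A E : R) : 1 <= A ->
  (forall j, cabs (x j) <= A) -> (forall j, cabs (y j) <= A) ->
  (forall j, cabs (x j - y j) <= E) ->
  cabs (\prod_j x j - \prod_j y j) <= k%:R * A ^+ k * E.
Proof.
move=> A1 xA yA xyE; have A0 : 0 <= A by apply: le_trans A1.
elim: k x y xA yA xyE => [|k IH] x y xA yA xyE.
  by rewrite !big_ord0 subrr cabs0 !mul0r.
have E0 : 0 <= E by apply: le_trans (xyE ord0); exact: cabs_ge0.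
rewrite !big_ord_recr /=; set X := \prod_(i < k) _; set Y := \prod_(i < k) _.
have hX : cabs X <= A ^+ k.
  rewrite cabs_prod -[k in A ^+ k]card_ord -prodr_const.
  by apply: ler_prod => i _; rewrite cabs_ge0 xA.
have hI : cabs (X - Y) <= k%:R * A ^+ k * E by exact: IH.
have -> : X * x ord_max - Y * y ord_max =
  X * (x ord_max - y ord_max) + (X - Y) * y ord_max by ring.
apply: le_trans (cabsD _ _) _; rewrite !cabsM.
apply: (@le_trans _ _ (A ^+ k * E + k%:R * A ^+ k * E * A)).
  by apply: lerD; apply: ler_pM => //; exact: cabs_ge0.
rewrite -natr1 exprS; have Ak := exprn_ge0 k A0.
have : A ^+ k * E <= A * A ^+ k * E.
  by rewrite -mulrA ler_peMl// mulr_ge0.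
by move=> h; rewrite [leRHS](_ : _ = A * A ^+ k * E + k%:R * A ^+ k * E * A) ?lerD2r//; ring.
Qed.

(** The degrees [Dj j] differ, so all index pairs are embedded in ['I_D * 'I_D]; the expanded
    product is then a sum over one type of finite functions, restricted to a family. *)
Lemma trig_prod k (D : nat) (Dj : 'I_k -> nat) (c : 'I_k -> nat -> nat -> R[i])
    (t : 'I_k -> R) : (forall j, (Dj j <= D)%N) ->
  \prod_j \sum_(a < Dj j) \sum_(b < Dj j) c j a b * unity ((a%:R - b%:R) * t j) =
  \sum_(f : {ffun 'I_k -> 'I_D * 'I_D} | f \in family (fun j =>
      [pred p : 'I_D * 'I_D | (p.1 < Dj j)%N && (p.2 < Dj j)%N]))
    (\prod_j c j (f j).1 (f j).2) *
    unity (\sum_j ((f j).1%:R - (f j).2%:R) * t j).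
Proof.
move=> DD.
transitivity (\prod_j \sum_(p : 'I_D * 'I_D | (p.1 < Dj j)%N && (p.2 < Dj j)%N)
    c j p.1 p.2 * unity ((p.1%:R - p.2%:R) * t j)).
  apply: eq_bigr => j _.
  rewrite (big_ord_widen D (fun a => \sum_(b < Dj j) c j a b * unity ((a%:R - b%:R) * t j))) ?DD//.
  under eq_bigr do rewrite (big_ord_widen D (fun b => c j _ b * unity ((_%:R - b%:R) * t j))) ?DD//.
  by rewrite pair_big.
rewrite bigA_distr_big_dep /=.
apply: eq_big => [f|f _]; first by [].
by rewrite big_split /= unity_sum.
Qed.

End trig_products.

(** In this inequality and the next three, [n + 1 + 1] stands for [lat_a], and
    [n + 1 + 1 + (n + 1 + 1 + 1)] for [lat_b]. *)
Lemma shift_left (R : realType) (w n y X : R) : -1 <= y ->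
  - (w + (- (n + 1 + 1) - y)) <= X -> w <= 0 -> n < X.
Proof. lra. Qed.

Lemma shift_right (R : realType) (w n y X : R) : y <= 2 ->
  w + (- (n + 1 + 1) - y) <= X -> n + 1 + 1 + (n + 1 + 1 + 1) <= w -> n < X.
Proof. lra. Qed.

Lemma window_left (R : realType) (n y : R) : -1 <= y -> - (n + 1 + 1 + y) < - n.
Proof. lra. Qed.

Lemma window_right (R : realType) (n y : R) : y <= 2 ->
  n < - (n + 1 + 1 + y) + (n + 1 + 1 + (n + 1 + 1 + 1)).
Proof. lra. Qed.

Lemma window_count (n M N : nat) : (0 < N)%N ->
  (2 * (n * N + M.+1) + 3 <= (2 * n + 2 * M + 5) * N)%N.
Proof.
case: N => // N _.
have -> : ((2 * n + 2 * M + 5) * N.+1 =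
  (2 * n + 2 * M + 5) * N + (2 * n + 2 * M + 5))%N by rewrite mulnS addnC.
have h : ((2 * n) * N <= (2 * n + 2 * M + 5) * N)%N by rewrite leq_mul2r -addnA leq_addr orbT.
rewrite mulnS; lia.
Qed.

Lemma absz_sub_lt (a b c : nat) : (a < c)%N -> (b < c)%N -> (absz (Posz a - Posz b) < c)%N.
Proof. lia. Qed.

(** * Lattice sums of periodized kernels *)

Section lattice_sums.
Variables (R : realType) (eta : nat -> R -> R) (n M : nat) (B0 B1 : R).
Hypothesis keta : forall j, kern (eta j).
Hypothesis eta0 : forall j, bsupp n%:R (eta j).
Hypothesis etaB : forall j x, `|eta j x| <= B0 * 2 ^+ j.
Hypothesis etaM : forall j, dbound M.+1 (B1 * 2 ^+ (j * M.+2)) (eta j).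
Variables (k : nat) (alpha : 'rV[R]_k).

(* The sum over the window of lattice points [(i / N - lat_a, (i - lat_a * N) * alpha)],
   [i < lat_b * N], of a kernel centred at [(y0, y)], periodized in all coordinates but
   the first.  [lat_a] and [lat_b] are such that the window contains the support for
   [-1 <= y0 <= 2]. *)
Definition lat_a := n.+2.
Definition lat_b := (n.+2 + n.+3)%N.

Definition lat_weight (N m0 : nat) (y0 : R) (i : nat) : R :=
  eta m0 (i%:R / N%:R - lat_a%:R - y0).

Definition lat_arg (N i : nat) (y : 'I_k -> R) (j : 'I_k) : R :=
  (i%:R - (lat_a * N)%:R) * alpha 0 j - y j.

Definition lat_sum (N m0 : nat) (mj : 'I_k -> nat) (y0 : R) (y : 'I_k -> R) : R :=
  N%:R^-1 * \sum_(i < lat_b * N) lat_weight N m0 y0 i *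
    \prod_j per n (eta (mj j)) (lat_arg N i y j).

(** A common majorant of 1, of the constants in the bounds for periodizations and for the
    coefficients of their approximants, and of the constant in the Fejer error; see [G1] to [G4]. *)
Definition lat_G : R :=
  4 ^+ M.+1 * (2 * n + 3)%N%:R * (B0 + 1) + (2 * (n + M.+1) + 3)%N%:R * (B1 + 1).

Let B0_ge0 : 0 <= B0.
Proof. by have := le_trans (normr_ge0 _) (etaB 0 0); rewrite expr0 mulr1. Qed.

Let B1_ge0 : 0 <= B1.
Proof. by have := dbound_ge0 (etaM 0); rewrite mul0n expr0 mulr1. Qed.

Lemma integ_norm_eta j : integ (fun x => `|eta j x|) <= (2 * n)%:R * (B0 * 2 ^+ j).
Proof.
have kb := kern_ball_ind (n%:R : R).
apply: (@le_trans _ _ (integ (fun x => (B0 * 2 ^+ j) * ball_ind n%:R x))).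
  apply: le_integ; [exact: kern_norm|exact: kernZ|].
  move=> x; rewrite /ball_ind; have [h|h] := leP `|x| n%:R; first by rewrite mulr1.
  by rewrite (eta0 j h) normr0 mulr0.
by rewrite integZ// integ_ball_ind// natrM mulrC.
Qed.

Section fixed.
(** [tau] is the gain per order of smoothness: [H1] is the gain of one Abel summation at a nonzero
    frequency, [H2] that of one Fejer mean of degree [2 ^ (mj j + v)], and [H3] that of one order in
    the Riemann sum of mesh [1 / N] in the first coordinate. *)
Variables (N m0 v : nat) (mj : 'I_k -> nat) (tau y0 : R) (y : 'I_k -> R).
Hypotheses (N0 : (0 < N)%N) (y0l : -1 <= y0) (y0r : y0 <= 2).
Hypotheses (tau0 : 0 <= tau).
Hypothesis hm0 : (2 ^ m0 <= N)%N.
Hypothesis hmj : forall j, (2 ^ (mj j + v) <= N)%N.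
Hypothesis H1 : forall h : 'rV[int]_k, h != 0 ->
  (forall j, (absz (h ord0 j) < 2 ^ (mj j + v))%N) ->
  2 ^+ m0 <= tau * (N%:R * cabs (1 - unity (inner_int h alpha))).
Hypothesis H2 : forall j, (4 * (mj j + v)%:R + 2) / 2 ^+ v <= tau.
Hypothesis H3 : 2 * 2 ^+ m0 / N%:R <= tau.

Let NR0 : 0 < N%:R :> R. Proof. by rewrite ltr0n. Qed.
Let NR1 : 1 <= N%:R :> R. Proof. by rewrite ler1n. Qed.
Let taup0 : 0 <= tau ^+ M.+1. Proof. exact: exprn_ge0. Qed.
Let T1 : 1 <= (1 + tau) ^+ M.+1. Proof. by rewrite exprn_ege1// lerDl. Qed.
Let taupT : tau ^+ M.+1 <= (1 + tau) ^+ M.+1.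
Proof. by rewrite lerXn2r ?nnegrE ?addr_ge0// lerDr. Qed.

(** One crude bound for the weights, the periodizations, their approximants and the coefficients.
    The factor 2 allows for an approximant being a periodization plus its error. *)
Let A := 2 * lat_G * N%:R * (1 + tau) ^+ M.+1.

Let c1 : 1 <= 4 ^+ M.+1 :> R. Proof. by rewrite exprn_ege1// ler1n. Qed.
Let c2 : 1 <= (2 * n + 3)%N%:R :> R. Proof. by rewrite ler1n addn3. Qed.
Let c3 : 1 <= (2 * (n + M.+1) + 3)%N%:R :> R. Proof. by rewrite ler1n addn3. Qed.

Let G1 : (2 * n + 3)%N%:R * B0 <= lat_G.
Proof.
rewrite /lat_G; move: c1 c2 c3.
move: (4 ^+ M.+1 : R) ((2 * n + 3)%N%:R : R) ((2 * (n + M.+1) + 3)%N%:R : R) => a b c a1 b1 cc1.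
have h1 : b * B0 <= a * (b * B0) by rewrite ler_peMl// mulr_ge0//; lra.
have h2 : 0 <= a * b by rewrite mulr_ge0//; lra.
have h3 : 0 <= c * (B1 + 1) by rewrite mulr_ge0//; [lra|rewrite addr_ge0].
rewrite -mulrA; nra.
Qed.

Let G2 : 4 ^+ M.+1 * ((2 * n)%:R * B0) <= lat_G.
Proof.
have h0 : (2 * n)%:R <= (2 * n + 3)%N%:R :> R by rewrite ler_nat leq_addr.
rewrite /lat_G -mulrA; move: c1 c2 c3 h0.
have d0 : 0 <= (2 * n)%:R :> R by [].
move: d0; move: (4 ^+ _) ((2 * n)%:R) ((2 * n + 3)%N%:R) ((2 * (n + M.+1) + 3)%N%:R) => a d b c d0 a1 b1 cc1 h0.
have h3 : 0 <= c * (B1 + 1) by rewrite mulr_ge0//; [lra|rewrite addr_ge0].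
have h4 : d * B0 <= b * (B0 + 1) by have := ler_wpM2r B0_ge0 h0; lra.
have := ler_wpM2l (le_trans ler01 a1) h4; lra.
Qed.

Let G3 : (2 * (n + M.+1) + 3)%N%:R * B1 <= lat_G.
Proof.
rewrite /lat_G; have h : 0 <= 4 ^+ M.+1 * (2 * n + 3)%N%:R * (B0 + 1) :> R.
  by rewrite !mulr_ge0 ?exprn_ge0 ?addr_ge0.
by have := c3; move: h; move: (_ * (B0 + 1)) => X X0 ?; rewrite mulrDr; lra.
Qed.

Let G4 : 1 <= lat_G.
Proof.
rewrite /lat_G; have h : 0 <= 4 ^+ M.+1 * (2 * n + 3)%N%:R * (B0 + 1) :> R.
  by rewrite !mulr_ge0 ?exprn_ge0 ?addr_ge0.
move: h c3; move: (_ * (B0 + 1)) ((2 * (n + M.+1) + 3)%N%:R) => X c X0 cc.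
by rewrite mulrDr mulr1; have := mulr_ge0 (le_trans ler01 cc) B1_ge0; lra.
Qed.

Let GN1 : 1 <= lat_G * N%:R.
Proof. by have := ler_pM ler01 ler01 G4 NR1; rewrite mulr1. Qed.

Let A1 : 1 <= A.
Proof.
rewrite /A -[2 * _ * _]mulrA.
have h : 1 <= 2 * (lat_G * N%:R) by move: GN1; lra.
by have := ler_pM ler01 ler01 h T1; rewrite mulr1.
Qed.

Let A0 : 0 <= A. Proof. exact: le_trans ler01 A1. Qed.

Let GNA : lat_G * N%:R <= A.
Proof.
rewrite /A -[2 * _ * _]mulrA.
have h : lat_G * N%:R <= 2 * (lat_G * N%:R) by move: GN1; lra.
have := ler_pM (le_trans ler01 GN1) ler01 h T1; rewrite mulr1; exact.
Qed.

Let p2N (m : nat) : (2 ^ m <= N)%N -> 2 ^+ m <= N%:R :> R.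
Proof. by rewrite -natrX ler_nat. Qed.

Let mjN j : 2 ^+ mj j <= N%:R :> R.
Proof. by apply: p2N; apply: leq_trans (hmj j); rewrite leq_pexp2l// leq_addr. Qed.

Let scaleA (X : R) m : 0 <= X -> X <= lat_G -> 2 ^+ m <= N%:R :> R -> X * 2 ^+ m <= lat_G * N%:R.
Proof. by move=> X0 XG mN; apply: ler_pM. Qed.

Let weightA i : `|lat_weight N m0 y0 i| <= A.
Proof.
apply: le_trans (etaB _ _) _; apply: le_trans GNA; apply: scaleA => //; last exact: p2N.
apply: le_trans G1; by rewrite ler_peMl.
Qed.

Let perA j t : `|per n (eta (mj j)) t| <= lat_G * N%:R.
Proof.
apply: le_trans (per_bound _ _ (etaB (mj j))) _.
by rewrite mulrA; apply: scaleA => //; rewrite mulr_ge0.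
Qed.

Let approx j : exists c : nat -> nat -> R[i],
  [/\ forall a b, cabs (c a b) <= lat_G * N%:R,
     \sum_(a < 2 ^ (mj j + v)) c a a = (integ (eta (mj j)))%:C &
     forall t, cabs ((per n (eta (mj j)) t)%:C -
         \sum_(a < 2 ^ (mj j + v)) \sum_(b < 2 ^ (mj j + v)) c a b * unity ((a%:R - b%:R) * t)) <=
       lat_G * N%:R * tau ^+ M.+1].
Proof.
have [c [h1 h2 h3]] := fejer_approx (mj j + v) (keta (mj j)) (eta0 (mj j)) (etaM (mj j)).
exists c; split => //.
  move=> a b; apply: le_trans (h1 a b) _.
  apply: le_trans (ler_wpM2l _ (integ_norm_eta (mj j))) _; first by rewrite exprn_ge0.
  by rewrite !mulrA -(mulrA _ _ B0); apply: scaleA => //; rewrite !mulr_ge0 ?exprn_ge0.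
move=> t; apply: le_trans (h3 t) _.
(* Of the [M.+2] factors [2 ^+ mj j], all but one cancel against the degree [2 ^ (mj j + v)] of the
   [M.+1] Fejer means; the last one is at most [N]. *)
have -> : B1 * 2 ^+ (mj j * M.+2) * ((4 * (mj j + v)%:R + 2) / 2 ^+ (mj j + v)) ^+ M.+1 =
    B1 * 2 ^+ mj j * ((4 * (mj j + v)%:R + 2) / 2 ^+ v) ^+ M.+1.
  rewrite mulnS exprD exprM exprD invfM mulrA -!mulrA; congr (_ * (_ * _)).
  rewrite -exprMn; congr (_ ^+ _); field.
  by rewrite !gt_eqF ?exprn_gt0.
rewrite !mulrA -(mulrA _ B1); apply: ler_pM => //.
- by rewrite !mulr_ge0 ?exprn_ge0.
- by rewrite mulrA; apply: scaleA => //; rewrite mulr_ge0.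
- by rewrite lerXn2r ?nnegrE// divr_ge0 ?exprn_ge0// addr_ge0// mulr_ge0.
Qed.

Let dbound_aff (s b B : R) f : 0 < s -> dbound M.+1 B f ->
  dbound M.+1 (s ^+ M.+1 * B) (fun t => f (s * t + b)).
Proof.
move=> s0 hB; have := @dbound_scale R M.+1 B s (fun t => f (t + b)) s0; apply.
by move=> us sM t; rewrite diffs_shift; exact: hB.
Qed.

Let weight_diff : dbound M.+1 (N%:R^-1 ^+ M.+1 * (B1 * 2 ^+ (m0 * M.+2)))
  (fun x => eta m0 (N%:R^-1 * x + (- lat_a%:R - y0))).
Proof. by apply: dbound_aff; rewrite ?invr_gt0. Qed.

Let pow_regroup (X : R) : X ^+ M.+1 * (N%:R^-1 ^+ M.+1 * (B1 * 2 ^+ (m0 * M.+2))) =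
  B1 * 2 ^+ m0 * (X * 2 ^+ m0 / N%:R) ^+ M.+1.
Proof. by rewrite mulnS exprD exprM !exprMn; ring. Qed.

(** [fejer_approx] with [q = 0], applied to the weight dilated by [N]: the only frequency is then 0,
    the polynomial is the constant integral, and the periodization is the Riemann sum. The first
    moment bound for [q = 0] is 2, which is the 2 in [H3]. *)
Let riemann : `|N%:R^-1 * (\sum_(i < lat_b * N) lat_weight N m0 y0 i) - integ (eta m0)| <=
  (2 * n + 2 * M + 5)%N%:R * A * tau ^+ M.+1.
Proof.
pose f x := eta m0 (N%:R^-1 * x + 0).
have nz : N%:R^-1 != 0 :> R by rewrite gt_eqF ?invr_gt0.
have kf : kern f by exact: kern_affine.
have f0 : bsupp (n * N)%:R f.
  move=> x hx; apply: eta0; rewrite addr0 normrM ger0_norm ?invr_ge0 ?ler0n//.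
  by rewrite mulrC ltr_pdivlMr// -natrM.
have fM : dbound M.+1 (N%:R^-1 ^+ M.+1 * (B1 * 2 ^+ (m0 * M.+2))) f.
  by apply: dbound_aff; rewrite ?invr_gt0.
have [c [_ h2 h3]] := fejer_approx 0 kf f0 fM.
rewrite expn0 in h2 h3.
have := h3 (- (lat_a%:R + y0) * N%:R).
rewrite !big_ord_recl !big_ord0 !addr0 subrr mul0r unity0 mulr1.
move: h2; rewrite big_ord_recl big_ord0 addr0 => ->.
have rB (u w : R) : u%:C - w%:C = (u - w)%:C by rewrite rmorphB.
have iE : integ f = N%:R * integ (eta m0).
  by rewrite /f integ_affine// gtr0_norm ?invr_gt0// invrK.
rewrite rB cabs_real iE.
have <- : wsum (lat_b * N) f (- (lat_a%:R + y0) * N%:R) =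
    per (n * N) f (- (lat_a%:R + y0) * N%:R).
  apply: (@per_eq R _ _ _ _ _ 0) => //; first by rewrite addr0.
    by rewrite natrM -mulNr ltr_pM2r// /lat_a -natr1 -natr1; exact: window_left.
  by rewrite !natrM -mulrDl ltr_pM2r// /lat_b natrD /lat_a -!natr1; exact: window_right.
have -> : wsum (lat_b * N) f (- (lat_a%:R + y0) * N%:R) =
    \sum_(i < lat_b * N) lat_weight N m0 y0 i.
  apply: eq_bigr => i _; rewrite /f /lat_weight addr0; congr (eta m0 _).
  by field; rewrite gt_eqF.
set S := \sum_(_ < _) _; set I := integ _ => h.
have -> : N%:R^-1 * S - I = N%:R^-1 * (S - N%:R * I) by field; rewrite gt_eqF.
rewrite normrM ger0_norm ?invr_ge0 ?ler0n// mulrC ler_pdivrMr//.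
apply: le_trans h _.
rewrite mulr0 add0r expr0 invr1 mulr1 [_ * 2 ^+ M.+1]mulrC pow_regroup.
have h1 : B1 * 2 ^+ m0 * (2 * 2 ^+ m0 / N%:R) ^+ M.+1 <= A * tau ^+ M.+1.
  apply: ler_pM.
  - by rewrite mulr_ge0 ?exprn_ge0.
  - by rewrite exprn_ge0// divr_ge0// mulr_ge0// exprn_ge0.
  - apply: le_trans GNA; apply: scaleA => //; last exact: p2N.
    by apply: le_trans G3; rewrite ler_peMl.
  - by rewrite lerXn2r ?nnegrE// divr_ge0// mulr_ge0// exprn_ge0.
have hc : (2 * (n * N + M.+1) + 3)%N%:R <= (2 * n + 2 * M + 5)%N%:R * N%:R :> R.
  rewrite -natrM ler_nat.
  exact: window_count.
apply: le_trans (ler_pM _ _ hc h1) _ => //.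
  by rewrite !mulr_ge0 ?exprn_ge0 ?divr_ge0 ?mulr_ge0 ?exprn_ge0.
by apply: eq_bound; ring.
Qed.

(** [M.+1] Abel summations: the weight has mesh [1 / N] and scale [2 ^- m0], so that each one gains
    [2 ^+ m0 / (N * |1 - z|) <= tau]. *)
Let trig_term (z : R[i]) : cabs z = 1 -> 2 ^+ m0 <= tau * (N%:R * cabs (1 - z)) ->
  cabs (\sum_(i < lat_b * N) (lat_weight N m0 y0 i)%:C * z ^+ i) <=
  (lat_b * N + M.+1)%N%:R * (A * tau ^+ M.+1).
Proof.
move=> z1 hz.
have p0 : 0 < 2 ^+ m0 :> R by rewrite exprn_gt0.
have c0 : 0 < cabs (1 - z).
  rewrite lt_neqAle cabs_ge0 andbT; apply/eqP => e.
  by move: hz; rewrite -e !mulr0 leNgt p0.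
have H : cabs (1 - z) ^+ M.+1 *
   cabs (\sum_(i < lat_b * N) (lat_weight N m0 y0 i)%:C * z ^+ i) <=
   (lat_b * N + M.+1)%N%:R * (N%:R^-1 ^+ M.+1 * (B1 * 2 ^+ (m0 * M.+2))).
  have := @abel_summation R M.+1 (lat_b * N)
    (fun x => eta m0 (N%:R^-1 * x + (- lat_a%:R - y0))) z
    (N%:R^-1 ^+ M.+1 * (B1 * 2 ^+ (m0 * M.+2))) z1.
  have -> : \sum_(i < lat_b * N) (lat_weight N m0 y0 i)%:C * z ^+ i =
     \sum_(i < lat_b * N) (eta m0 (N%:R^-1 * i%:R + (- lat_a%:R - y0)))%:C * z ^+ i.
    apply: eq_bigr => i _; congr (_%:C * _); rewrite /lat_weight; congr (eta m0 _).
    by rewrite [_ / N%:R]mulrC; ring.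
  apply.
  - move=> x x0; apply: eta0; set u := _ + _.
    have : N%:R^-1 * x <= 0 by rewrite mulr_ge0_le0// invr_ge0 ltW.
    have := ler_norm (- u); rewrite normrN /u /lat_a -!natr1.
    by move=> h1 h2; exact: (shift_left y0l h1 h2).
  - move=> x; rewrite natrM => hx; apply: eta0; set u := _ + _.
    have : lat_b%:R <= N%:R^-1 * x by rewrite mulrC ler_pdivlMr.
    have := ler_norm u; rewrite /u /lat_a /lat_b natrD -!natr1.
    by move=> h1 h2; exact: (shift_right y0r h1 h2).
  - move=> t; have := weight_diff (us := nseq M.+1 1); rewrite size_nseq => /(_ erefl t).
    by rewrite /absprod big_nseq normr1 iter_mulr mulr1 expr1n mulr1.
have cp : 0 < cabs (1 - z) ^+ M.+1 by rewrite exprn_gt0.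
rewrite -(ler_pM2l cp); apply: le_trans H _.
rewrite [leRHS]mulrCA; apply: ler_wpM2l => //.
have -> : N%:R^-1 ^+ M.+1 * (B1 * 2 ^+ (m0 * M.+2)) = B1 * 2 ^+ m0 * (2 ^+ m0 / N%:R) ^+ M.+1.
  by have := pow_regroup 1; rewrite expr1n !mul1r.
rewrite mulrCA -exprMn; apply: ler_pM.
- by rewrite mulr_ge0 ?exprn_ge0.
- by rewrite exprn_ge0// divr_ge0// exprn_ge0.
- apply: le_trans GNA; apply: scaleA => //; last exact: p2N.
  by apply: le_trans G3; rewrite ler_peMl.
- rewrite lerXn2r ?nnegrE ?divr_ge0 ?mulr_ge0 ?cabs_ge0 ?exprn_ge0//.
  by rewrite ler_pdivrMr//; apply: le_trans hz _; apply: eq_bound; ring.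
Qed.

(** The differences of the pairs form a frequency [h], which is nonzero off the diagonal. The phase
    is affine in [i] with slope [h . alpha], so the sum over [i] is of the form treated by
    [trig_term]. *)
Let nondiag (D : nat) (f : {ffun 'I_k -> 'I_D * 'I_D}) (c : 'I_k -> nat -> nat -> R[i]) :
  (forall j a b, cabs (c j a b) <= lat_G * N%:R) ->
  (forall j, ((f j).1 < 2 ^ (mj j + v))%N && ((f j).2 < 2 ^ (mj j + v))%N) ->
  ~~ [forall j, (f j).1 == (f j).2] ->
  cabs (\sum_(i < lat_b * N) (lat_weight N m0 y0 i)%:C *
     ((\prod_j c j (f j).1 (f j).2) *
      unity (\sum_j ((f j).1%:R - (f j).2%:R) * lat_arg N i y j))) <=
  A ^+ k * ((lat_b * N + M.+1)%N%:R * (A * tau ^+ M.+1)).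
Proof.
move=> cG fD nd.
pose h : 'rV[int]_k := \row_j (Posz (f j).1 - Posz (f j).2).
have hE j : (h ord0 j)%:~R = (f j).1%:R - (f j).2%:R :> R by rewrite mxE intrB -!pmulrn.
have h0 : h != 0.
  apply: contra nd => /eqP/rowP he; apply/forallP => j.
  by have := he j; rewrite !mxE => /eqP; rewrite subr_eq0 eqz_nat.
have hb j : (absz (h ord0 j) < 2 ^ (mj j + v))%N.
  by rewrite mxE; have /andP[] := fD j; exact: absz_sub_lt.
pose beta := inner_int h alpha.
pose g := \sum_j ((f j).1%:R - (f j).2%:R) * (- (lat_a * N)%N%:R * alpha 0 j - y j).
have eE (i : nat) : unity (\sum_j ((f j).1%:R - (f j).2%:R) * lat_arg N i y j) =
    unity g * unity beta ^+ i.
  rewrite -unity_nat -unityD; congr unity.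
  rewrite /beta /inner_int mulr_sumr /g -big_split /=; apply: eq_bigr => j _.
  by rewrite hE /lat_arg; ring.
have -> : \sum_(i < lat_b * N) (lat_weight N m0 y0 i)%:C *
     ((\prod_j c j (f j).1 (f j).2) *
      unity (\sum_j ((f j).1%:R - (f j).2%:R) * lat_arg N i y j)) =
   ((\prod_j c j (f j).1 (f j).2) * unity g) *
   \sum_(i < lat_b * N) (lat_weight N m0 y0 i)%:C * unity beta ^+ i.
  by rewrite mulr_sumr; apply: eq_bigr => i _; rewrite eE; ring.
rewrite !cabsM cabs_unity mulr1; apply: ler_pM; rewrite ?cabs_ge0//.
- rewrite cabs_prod -[k in A ^+ k]card_ord -prodr_const.
  by apply: ler_prod => j _; rewrite cabs_ge0 (le_trans (cG _ _ _)).
- by apply: trig_term; [exact: cabs_unity|exact: H1].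
Qed.

(** The powers of [N] come from counting frequencies and from the crude bound [A]; [tau ^+ M.+1] is
    meant to outweigh them. *)
Lemma lat_sum_error :
  `|integ (eta m0) * \prod_j integ (eta (mj j)) - lat_sum N m0 mj y0 y| <=
  (lat_b * k + (lat_b + M.+1) + (2 * n + 2 * M + 5))%N%:R * N%:R ^+ (2 * k) *
    (2 * lat_G * N%:R * (1 + tau) ^+ M.+1) ^+ k.+2 * tau ^+ M.+1.
Proof.
have [c hc] : exists c : 'I_k -> nat -> nat -> R[i], forall j,
  [/\ forall a b, cabs (c j a b) <= lat_G * N%:R,
     \sum_(a < 2 ^ (mj j + v)) c j a a = (integ (eta (mj j)))%:C &
     forall t, cabs ((per n (eta (mj j)) t)%:C -
         \sum_(a < 2 ^ (mj j + v)) \sum_(b < 2 ^ (mj j + v)) c j a b * unity ((a%:R - b%:R) * t)) <=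
       lat_G * N%:R * tau ^+ M.+1].
  by have [c hc] := choice approx; exists c.
have cG j a b : cabs (c j a b) <= lat_G * N%:R by case: (hc j).
pose Q j t := \sum_(a < 2 ^ (mj j + v)) \sum_(b < 2 ^ (mj j + v)) c j a b * unity ((a%:R - b%:R) * t).
have hQ j t : cabs ((per n (eta (mj j)) t)%:C - Q j t) <= lat_G * N%:R * tau ^+ M.+1.
  by case: (hc j).
have GN0 : 0 <= lat_G * N%:R by rewrite mulr_ge0// (le_trans ler01).
have pA j t : cabs (per n (eta (mj j)) t)%:C <= A.
  by rewrite cabs_real; apply: le_trans (perA _ _) GNA.
have QA j t : cabs (Q j t) <= A.
  have -> : Q j t = (per n (eta (mj j)) t)%:C - ((per n (eta (mj j)) t)%:C - Q j t) by rewrite subKr.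
  apply: le_trans (cabsD _ _) _; rewrite cabsN cabs_real.
  have := perA j t; have := hQ j t.
  have : lat_G * N%:R * tau ^+ M.+1 <= lat_G * N%:R * (1 + tau) ^+ M.+1 by rewrite ler_wpM2l.
  have : lat_G * N%:R <= lat_G * N%:R * (1 + tau) ^+ M.+1 by rewrite ler_peMr.
  rewrite /A -[2 * _ * _]mulrA -[2 * _ * _]mulrA; lra.
set P := A ^+ k.+2 * tau ^+ M.+1.
have Ak (a b : nat) : (a <= b)%N -> A ^+ a <= A ^+ b by move=> ab; rewrite ler_weXn2l.
have N2k : 1 <= N%:R ^+ (2 * k) :> R by rewrite exprn_ege1.
have P0 : 0 <= P by rewrite mulr_ge0 ?exprn_ge0.
pose w i := lat_weight N m0 y0 i.
pose Z := \sum_(i < lat_b * N) (w i)%:C * \prod_j Q j (lat_arg N i y j).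
pose I0 := integ (eta m0); pose IP := \prod_j integ (eta (mj j)).
(* replace the periodizations by trigonometric polynomials *)
have step1 : cabs ((lat_sum N m0 mj y0 y)%:C - (N%:R^-1)%:C * Z) <= (lat_b * k)%N%:R * P.
  rewrite /lat_sum rmorphM /= -mulrBr cabsM cabs_real ger0_norm ?invr_ge0 ?ler0n//.
  rewrite rmorph_sum /= /Z -sumrB mulrC ler_pdivrMr//.
  apply: le_trans (cabs_sum _ _ _) _.
  apply: (@le_trans _ _ (\sum_(i < lat_b * N) (k%:R * P))).
    apply: ler_sum => i _.
    rewrite rmorphM rmorph_prod /= -mulrBr cabsM cabs_real.
    have h := prod_sub_le A1 (fun j => pA j (lat_arg N i y j)) (fun j => QA j (lat_arg N i y j))
      (fun j => hQ j (lat_arg N i y j)).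
    apply: le_trans (ler_pM _ _ (weightA i) h) _ => //; first exact: cabs_ge0.
    rewrite /P [leLHS](_ : _ = k%:R * (A * A ^+ k * (lat_G * N%:R)) * tau ^+ M.+1); last ring.
    rewrite [leRHS]mulrA ler_wpM2r// ler_wpM2l// exprS exprS [leLHS]mulrC mulrA.
    by rewrite -[leRHS]mulrA ler_wpM2r// mulr_ge0 ?exprn_ge0.
  rewrite sumr_const card_ord -mulr_natl !natrM; apply: eq_bound; ring.
(* the frequencies h != 0 *)
have step2 : cabs (Z - (\sum_(i < lat_b * N) w i)%:C * IP%:C) <=
    N%:R ^+ (2 * k) * ((lat_b * N + M.+1)%N%:R * P).
  (* All degrees are at most [N] by [hmj], so there are at most [N ^ (2 k)] tuples of pairs. *)
  pose D := N.
  have DD j : (2 ^ (mj j + v) <= D)%N by exact: hmj.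
  pose fam := family (fun j : 'I_k =>
      [pred p : 'I_D * 'I_D | (p.1 < 2 ^ (mj j + v))%N && (p.2 < 2 ^ (mj j + v))%N]).
  pose T (f : {ffun 'I_k -> 'I_D * 'I_D}) (i : nat) : R[i] := (\prod_j c j (f j).1 (f j).2) *
    unity (\sum_j ((f j).1%:R - (f j).2%:R) * lat_arg N i y j).
  have ZE : Z = \sum_(f | f \in fam) \sum_(i < lat_b * N) (w i)%:C * T f i.
    rewrite exchange_big; apply: eq_bigr => i _; rewrite -mulr_sumr; congr (_ * _).
    exact: (trig_prod c (lat_arg N i y) DD).
  (* Diagonal tuples have frequency 0, and their coefficients add up to the product of the
     integrals. *)
  pose diag (f : {ffun 'I_k -> 'I_D * 'I_D}) := [forall j, (f j).1 == (f j).2].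
  have diagE : \sum_(f | (f \in fam) && diag f) \sum_(i < lat_b * N) (w i)%:C * T f i =
      (\sum_(i < lat_b * N) w i)%:C * IP%:C.
    transitivity ((\sum_(i < lat_b * N) w i)%:C *
        \sum_(f : {ffun 'I_k -> 'I_D * 'I_D} | (f \in fam) && diag f) \prod_j c j (f j).1 (f j).2).
      rewrite mulr_sumr; apply: eq_bigr => f /andP[_ /forallP fd].
      rewrite rmorph_sum /= mulr_suml; apply: eq_bigr => i _; rewrite /T.
      rewrite [X in unity X]big1 ?unity0 ?mulr1// => j _.
      by rewrite (eqP (fd j)) subrr mul0r.
    congr (_ * _); rewrite /IP rmorph_prod /=.
    transitivity (\prod_j \sum_(p : 'I_D * 'I_D |
       ((p.1 < 2 ^ (mj j + v))%N && (p.2 < 2 ^ (mj j + v))%N) && (p.1 == p.2)) c j p.1 p.2).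
      rewrite bigA_distr_big_dep /=; apply: eq_bigl => f.
      apply/andP/familyP => [[/familyP f1 /forallP f2] j|f1].
        by rewrite unfold_in /=; have := f1 j; rewrite inE /= => ->; exact: f2.
      split; first by apply/familyP => j; have := f1 j; rewrite unfold_in /= inE => /andP[].
      by apply/forallP => j; have := f1 j; rewrite unfold_in /= => /andP[].
    apply: eq_bigr => j _; have [_ <- _] := hc j.
    rewrite (big_ord_widen D (fun a => c j a a))//.
    rewrite (reindex_onto (fun a : 'I_D => (a, a)) (fun p : 'I_D * 'I_D => p.1)) /=.
      apply: eq_bigl => a; rewrite !eqxx !andbT andbb//.
    by move=> [a b] /= /andP[_ /eqP ->].
  rewrite ZE (bigID diag) /= diagE addrAC subrr add0r.
  apply: le_trans (cabs_sum _ _ _) _.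
  apply: (@le_trans _ _ (\sum_(f : {ffun 'I_k -> 'I_D * 'I_D}) ((lat_b * N + M.+1)%N%:R * P))).
    rewrite [leRHS](bigID (fun f => (f \in fam) && ~~ diag f)) /=.
    rewrite -[leLHS]addr0; apply: lerD; last by apply: sumr_ge0 => f _; rewrite mulr_ge0.
    apply: ler_sum => f /andP[/familyP ff nd].
    have ff' j : ((f j).1 < 2 ^ (mj j + v))%N && ((f j).2 < 2 ^ (mj j + v))%N.
      by have := ff j; rewrite !inE.
    apply: le_trans (nondiag cG ff' nd) _.
    rewrite mulrCA ler_wpM2l// /P mulrA -exprSr ler_wpM2r//.
    by apply: Ak; rewrite leqnSn.
  rewrite sumr_const card_ffun card_prod !card_ord -[leLHS]mulr_natl.
  by rewrite natrX natrM exprM expr2 lexx.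
(* the frequency h = 0 *)
have step3 : `|N%:R^-1 * (\sum_(i < lat_b * N) w i) * IP - I0 * IP| <=
    (2 * n + 2 * M + 5)%N%:R * P.
  rewrite -mulrBl normrM.
  have hIP : `|IP| <= A ^+ k.
    rewrite normr_prod -[k in A ^+ k]card_ord -prodr_const.
    apply: ler_prod => j _; rewrite normr_ge0/=.
    apply: le_trans (le_norm_integ (keta _)) _; apply: le_trans (integ_norm_eta _) _.
    rewrite mulrA; apply: le_trans GNA; apply: scaleA => //; first by rewrite mulr_ge0.
    by apply: le_trans G2; rewrite ler_peMl// mulr_ge0.
  apply: le_trans (ler_pM _ _ riemann hIP) _ => //.
  rewrite [leLHS](_ : _ = (2 * n + 2 * M + 5)%N%:R * (A ^+ k.+1 * tau ^+ M.+1)); last first.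
    by rewrite [A ^+ k.+1]exprS; ring.
  by rewrite ler_wpM2l// ler_wpM2r// Ak.
set X := integ _ * _; set Y := lat_sum _ _ _ _ _.
have XE : X = I0 * IP by [].
have split_err : (X - Y)%:C = - (Y%:C - (N%:R^-1)%:C * Z) -
    (N%:R^-1)%:C * (Z - (\sum_(i < lat_b * N) w i)%:C * IP%:C) -
    (N%:R^-1 * (\sum_(i < lat_b * N) w i) * IP - I0 * IP)%:C.
  rewrite XE !(rmorphB, rmorphM) /=; ring.
rewrite -cabs_real split_err.
apply: le_trans (cabsD _ _) _; rewrite cabsN cabs_real.
apply: le_trans (lerD (cabsD _ _) (lexx _)) _; rewrite !cabsN cabsM cabs_real.
rewrite (ger0_norm (_ : 0 <= N%:R^-1)) ?invr_ge0//.
have h2 : N%:R^-1 * cabs (Z - (\sum_(i < lat_b * N) w i)%:C * IP%:C) <=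
    N%:R ^+ (2 * k) * ((lat_b + M.+1)%N%:R * P).
  rewrite mulrC ler_pdivrMr//; apply: le_trans step2 _.
  rewrite -[leRHS]mulrA; apply: ler_wpM2l; first exact: exprn_ge0.
  rewrite -[leRHS]mulrA [P * N%:R]mulrC [leRHS]mulrA; apply: ler_wpM2r => //.
  by rewrite -natrM ler_nat mulnDl leq_add2l leq_pmulr.
apply: le_trans (lerD (lerD step1 h2) step3) _.
rewrite -[leRHS]mulrA -/A -/P.
have e1 : (lat_b * k)%N%:R * P <= N%:R ^+ (2 * k) * ((lat_b * k)%N%:R * P).
  by rewrite ler_peMl// mulr_ge0.
have e2 : (2 * n + 2 * M + 5)%N%:R * P <= N%:R ^+ (2 * k) * ((2 * n + 2 * M + 5)%N%:R * P).
  by rewrite ler_peMl// mulr_ge0.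
apply: le_trans (lerD (lerD e1 (lexx _)) e2) _.
rewrite (natrD _ (lat_b * k + (lat_b + M.+1))%N) (natrD _ (lat_b * k)%N).
move: ((lat_b * k)%N%:R : R) ((lat_b + M.+1)%N%:R : R) ((2 * n + 2 * M + 5)%N%:R : R) => a b c'.
by apply: eq_bound; ring.
Qed.

End fixed.
End lattice_sums.

Lemma exponent_count (k : nat) : (2 * k + k.+2 = 3 * k + 2)%N.
Proof. lia. Qed.

Lemma minn_split1 (a b v : nat) : (minn (a + b) v - minn a v <= b)%N.
Proof. lia. Qed.

Lemma minn_split2 (a b v : nat) : (minn a v + (minn (a + b) v - minn a v) = minn (a + b) v)%N.
Proof. lia. Qed.

Lemma addn_subnD (a b c d : nat) : (b <= a)%N -> (d <= c)%N ->
  ((a - b) + (c - d) = (a + c) - (b + d))%N.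
Proof. lia. Qed.

(** * Choice of the parameters from the approximation type *)

Section parameters.
Variable R : realType.

Lemma dist_int_ge0 (x : R) : 0 <= dist_int x.
Proof.
apply: lb_le_inf; first by exists `|x - 0%:~R|; exists 0.
by move=> _ [m _ <-].
Qed.

Lemma height_ge1 k (h : 'rV[int]_k) : 1 <= height R h.
Proof.
by rewrite /height; elim/big_ind: _ => //= [x y|i _]; [exact: mulr_ege1|rewrite le_max lexx].
Qed.

Lemma approximation_type_lower k (alpha : 'rV[R]_k) (sigma : R) :
  approximation_type alpha 1 -> 0 < sigma ->
  exists2 c : R, 0 < c & forall h : 'rV[int]_k, h != 0 ->
    c <= height R h `^ (1 + sigma) * dist_int (inner_int h alpha).
Proof.
move=> ht s0.
have : (1%:E < (1 + sigma)%:E)%E by rewrite lte_fin ltrDl.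
rewrite -{1}ht.
move=> /ereal_inf_lt[_ [r [c c0 hc] <-]]; rewrite lte_fin => rs.
exists c => // h h0; apply: le_trans (hc h h0) _.
by apply: ler_wpM2r; [exact: dist_int_ge0|apply: ler_powR (height_ge1 h) _ _ (ltW rs)].
Qed.

(** Absorbs the logarithm in the first moment of the Fejer kernel into a small power of [N]. *)
Lemma dyadic_exponent_le (N x : nat) (e : R) : (2 ^ x <= N)%N -> 0 < e ->
  x%:R <= (e * ln 2)^-1 * N%:R `^ e.
Proof.
move=> xN e0.
have N0 : (0 < N)%N by apply: leq_trans xN; rewrite expn_gt0.
have NR0 : 0 < N%:R :> R by rewrite ltr0n.
have l2 : 0 < ln 2 :> R by rewrite ln_gt0// ltr1n.
have h1 : x%:R * ln 2 <= ln N%:R :> R.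
  by rewrite mulr_natl -lnXn ?ltr0n// ler_ln ?posrE ?exprn_gt0 ?ltr0n// -natrX ler_nat.
have h2 : e * ln N%:R <= N%:R `^ e :> R.
  by rewrite -ln_powR; apply: ltW; apply: ln_sublinear; rewrite powR_gt0.
rewrite mulrC ler_pdivlMr ?mulr_gt0//; apply: le_trans h2.
by rewrite mulrCA ler_wpM2l// ltW.
Qed.

Lemma dyadic_below (X : R) : 1 <= X -> exists v : nat, 2 ^+ v <= X < 2 ^+ v.+1.
Proof.
move=> X1; have X0 : 0 <= X by apply: le_trans X1.
have /andP[h1 h2] := truncn_itv X0.
have t0 : (0 < Num.truncn X)%N by rewrite -ltnS -(ltr_nat R); apply: le_lt_trans h2.
have /andP[h3 h4] := @trunc_log_bounds 2 _ isT t0.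
exists (trunc_log 2 (Num.truncn X)); rewrite -!natrX; apply/andP; split.
  by apply: le_trans h1; rewrite ler_nat.
by apply: lt_le_trans h2 _; rewrite ler_nat.
Qed.

Lemma dyadic_small (c r : R) : 0 < c -> 0 < r -> exists J : nat, c * 2 ^- J < r.
Proof.
move=> c0 r0; exists (Num.truncn (c / r)).+1.
have /andP[_ h1] := truncn_itv (divr_ge0 (ltW c0) (ltW r0)).
rewrite ltr_pdivrMr ?exprn_gt0// mulrC -ltr_pdivrMr//.
by apply: lt_le_trans h1 _; rewrite -natrX ler_nat; exact/ltnW/ltn_expl.
Qed.

Lemma nat_scaled_bound (x e : R) : 0 <= x -> 0 < e -> exists M : nat, x <= M.+1%:R * e.
Proof.
move=> x0 e0; exists (Num.truncn (x / e)); rewrite -ler_pdivrMr//; apply: ltW.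
by have /andP[] := truncn_itv (divr_ge0 x0 (ltW e0)).
Qed.

Lemma height_le_pow k (h : 'rV[int]_k) (e : 'I_k -> nat) :
  (forall j, (absz (h ord0 j) < 2 ^ e j)%N) ->
  height R h <= 2 ^+ (\sum_j e j).
Proof.
move=> hh; rewrite -prodrXr; apply: ler_prod => j _; apply/andP; split.
  by rewrite le_max ler01.
rewrite ge_max exprn_ege1 ?ler1n//= -natrX pmulrn.
rewrite -[Posz _]/(Posz (2 ^ e j)%N) ler_int -abszE lez_nat.
exact: ltnW.
Qed.

(** The first two summands are the exponent of [N] that bounds [2 ^+ (m0 + S)], where [2 ^+ S]
    bounds the height of a frequency; the third is the loss from using the exponent [1 + e0 / 8]
    instead of 1 in the approximation type. *)
Lemma exponent_bookkeeping (k : nat) (e0 : R) : 0 < e0 -> e0 <= 1 ->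
  (1 - e0) + k%:R * (e0 / (4 * k.+1%:R)) +
    e0 / 8 * ((1 - e0) + k%:R * (e0 / (4 * k.+1%:R))) <= 1 - e0 / 2.
Proof.
move=> e00 e01; set e1 := e0 / (4 * _).
have h : k%:R * e1 <= e0 / 4.
  rewrite /e1 -ler_pdivlMr//; last first.
    by rewrite divr_gt0// mulr_gt0// ltr0n.
  rewrite invf_div mulrA -mulrA.
  have -> : e0 / 4 * (4 * k.+1%:R / e0) = k.+1%:R by field; rewrite gt_eqF.
  by rewrite ler_nat.
have h2 : e0 / 8 * (1 - e0 + k%:R * e1) <= e0 / 8 * (5 / 4).
  by apply: ler_wpM2l; lra.
lra.
Qed.

Lemma exponent_arith (a b c : R) : 0 < a -> b <= a / 4 -> 0 < b -> c = b / 2 ->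
  [/\ 1 - a <= 1, 1 - a + b <= 1, b - c = c, 1 - a - 1 <= - c & 1 - a / 2 <= 1 - c].
Proof. by move=> *; split; lra. Qed.

Lemma const_arith (u v : R) : 0 < u -> 0 < v ->
  [/\ 0 <= u + (8 * v + 4), 8 * v + 4 <= u + (8 * v + 4), 2 <= u + (8 * v + 4) &
      u <= u + (8 * v + 4)].
Proof. by move=> *; split; lra. Qed.

Lemma decay_arith (x a m e : R) : x + a <= m * e -> x + - e * m <= - a.
Proof. lra. Qed.

Lemma log_arith (u w c : R) : w <= c * u -> 1 <= u -> 4 * w + 2 <= (4 * c + 2) * u.
Proof. lra. Qed.

Section small_error.
Variables (eta : nat -> R -> R) (n M : nat) (B0 B1 : R).
Hypothesis keta : forall j, kern (eta j).
Hypothesis eta0 : forall j, bsupp n%:R (eta j).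
Hypothesis etaB : forall j x, `|eta j x| <= B0 * 2 ^+ j.
Hypothesis etaM : forall j, dbound M.+1 (B1 * 2 ^+ (j * M.+2)) (eta j).
Variables (k : nat) (alpha : 'rV[R]_k) (e0 A : R).
Hypothesis ht : approximation_type alpha 1.
Hypotheses (e00 : 0 < e0) (e01 : e0 <= 1).
Let e1 := e0 / (4 * k.+1%:R).
Let e2 := e1 / 2.
Hypothesis hA : (3 * k + 2)%N%:R + A <= M.+1%:R * e2.

Let e1_gt0 : 0 < e1. Proof. by rewrite /e1 divr_gt0// mulr_gt0// ltr0n. Qed.
Let e1_le : e1 <= e0 / 4.
Proof.
rewrite /e1 invfM mulrA; apply: ler_piMr; first by rewrite divr_ge0// ltW.
by rewrite invf_le1 ?ltr0n// ler1n.
Qed.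

(** [lat_sum_error] with [tau] of order [N ^ (- e2)]. It loses the powers [2 * k] and [k.+2] of [N],
    which is the [3 * k + 2] in [hA]. Of the exponent [e1] by which the degrees are raised, one half
    absorbs logarithms and the other half is the gain [e2]. *)
Lemma small_error : exists2 C : R, 0 <= C &
  forall (N m0 : nat) (mj : 'I_k -> nat) (y0 : R) (y : 'I_k -> R), (0 < N)%N ->
    -1 <= y0 -> y0 <= 2 -> 2 ^+ (m0 + \sum_j mj j) <= N%:R `^ (1 - e0) ->
  `|integ (eta m0) * \prod_j integ (eta (mj j)) - lat_sum eta n alpha N m0 mj y0 y| <=
    C * N%:R `^ (- A).
Proof.
have [c c0 hc] := approximation_type_lower ht (divr_gt0 e00 (ltr0n R 8)).
pose C1 := (e2 * ln 2)^-1 : R.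
have e20 : 0 < e2 by rewrite divr_gt0.
have l2 : 0 < ln 2 :> R by rewrite ln_gt0// ltr1n.
have C10 : 0 < C1 by rewrite invr_gt0 mulr_gt0.
(* The first summand serves [H1], the second serves [H2] and, being at least 2, also [H3]. *)
pose C2 := (2 * c)^-1 + (8 * C1 + 4) : R.
have ic0 : 0 < (2 * c)^-1 by rewrite invr_gt0 mulr_gt0.
have [C20 C2a C2b C2c] := const_arith ic0 C10.
have [q1 q2 q3 q4 q5] := exponent_arith e00 e1_le e1_gt0 (erefl e2).
pose K := (lat_b n * k + (lat_b n + M.+1) + (2 * n + 2 * M + 5))%N%:R : R.
have B00 : 0 <= B0.
  by have := le_trans (normr_ge0 _) (etaB 0 0); rewrite expr0 mulr1.
have B10 : 0 <= B1 by have := dbound_ge0 (etaM 0); rewrite mul0n expr0 mulr1.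
have G0 : 0 <= lat_G n M B0 B1 by rewrite /lat_G addr_ge0 ?mulr_ge0 ?addr_ge0 ?exprn_ge0.
pose C := K * (2 * lat_G n M B0 B1 * (1 + C2) ^+ M.+1) ^+ k.+2 * C2 ^+ M.+1.
have C0 : 0 <= C.
  have h : 0 <= 1 + C2 by rewrite addr_ge0.
  rewrite /C; apply: mulr_ge0; last exact: exprn_ge0.
  by apply: mulr_ge0 => //; rewrite exprn_ge0// !mulr_ge0// exprn_ge0.
exists C => // N m0 mj y0 y N0 y0l y0r hm.
have NR0 : 0 < N%:R :> R by rewrite ltr0n.
have NR1 : 1 <= N%:R :> R by rewrite ler1n.
have Nne (a : R) : (a == 0) ==> (N%:R != 0 :> R) by rewrite (gt_eqF NR0) implybT.
have Npow (a b : R) : a <= b -> N%:R `^ a <= N%:R `^ b by exact: ler_powR.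
have N1 : N%:R = N%:R `^ 1 :> R by rewrite powRr1.
have X1 : 1 <= N%:R `^ e1 by rewrite -[leLHS](powRr0 N%:R); apply: Npow; exact: ltW.
(* The Fejer degrees exceed the natural scale [2 ^ mj j] by the factor [2 ^ v], about [N ^ e1]; this
   is the source of the gain in [H2], and the degrees still do not exceed [N]. *)
have [v /andP[v1 v2]] := dyadic_below X1.
pose tau := C2 * N%:R `^ (- e2).
have tau0 : 0 <= tau by rewrite mulr_ge0// powR_ge0.
have tauC : tau <= C2.
  rewrite ler_piMr// -[leRHS](powRr0 N%:R); apply: Npow; rewrite oppr_le0; exact: ltW.
have pm0 : 2 ^+ m0 <= N%:R `^ (1 - e0).
  by apply: le_trans hm; rewrite ler_weXn2l ?ler1n// leq_addr.
have pmj j : 2 ^+ mj j <= N%:R `^ (1 - e0).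
  apply: le_trans hm; rewrite ler_weXn2l ?ler1n// (bigD1 j)//=.
  by rewrite addnCA leq_addr.
have hm0 : (2 ^ m0 <= N)%N.
  rewrite -(ler_nat R) natrX [leRHS]N1; apply: le_trans pm0 _; exact: Npow q1.
have hmj j : (2 ^ (mj j + v) <= N)%N.
  rewrite -(ler_nat R) natrX exprD [leRHS]N1.
  apply: le_trans (ler_pM _ _ (pmj j) v1) _; rewrite ?exprn_ge0//.
  rewrite -powRD//; exact: Npow q2.
have H2 j : (4 * (mj j + v)%:R + 2) / 2 ^+ v <= tau.
  have h1 := dyadic_exponent_le (hmj j) e20.
  have h2 : (2 ^+ v)^-1 <= 2 * N%:R `^ (- e1) :> R.
    rewrite powRN ler_pdivlMr ?powR_gt0// mulrC ler_pdivrMr ?exprn_gt0// -exprS; exact: ltW.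
  have h3 : 1 <= N%:R `^ e2 by rewrite -[leLHS](powRr0 N%:R); apply: Npow; exact: ltW.
  apply: le_trans (ler_pM _ _ (_ : _ <= (4 * C1 + 2) * N%:R `^ e2) h2) _.
  - by rewrite addr_ge0// mulr_ge0.
  - by rewrite invr_ge0 exprn_ge0.
  - exact: log_arith h1 h3.
  have -> : (4 * C1 + 2) * N%:R `^ e2 * (2 * N%:R `^ (- e1)) =
     (8 * C1 + 4) * (N%:R `^ e2 * N%:R `^ (- e1)) by ring.
  rewrite -powRD// (_ : e2 + - e1 = - e2); last by rewrite -[LHS]opprB q3.
  by apply: ler_wpM2r; [exact: powR_ge0|].
have H3 : 2 * 2 ^+ m0 / N%:R <= tau.
  have h1 : 2 * 2 ^+ m0 / N%:R <= 2 * (N%:R `^ (1 - e0) * N%:R `^ (- 1)).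
    by rewrite powRN -N1 -!mulrA ler_wpM2l// ler_wpM2r ?invr_ge0.
  apply: le_trans h1 _; rewrite -powRD//.
  by apply: ler_pM => //; exact: Npow q4.
have H1 (h : 'rV[int]_k) : h != 0 ->
    (forall j, (absz (h ord0 j) < 2 ^ (mj j + v))%N) ->
    2 ^+ m0 <= tau * (N%:R * cabs (1 - unity (inner_int h alpha))).
  move=> hn hj; have Hh := height_le_pow hj.
  have h1 := hc h hn.
  set dd := dist_int _ in h1.
  have d0 : 0 <= dd by exact: dist_int_ge0.
  have h2 : 2 * dd <= cabs (1 - unity (inner_int h alpha)) by exact: cabs_sub_unity_dist.
  set S := (\sum_j (mj j + v))%N in Hh.
  have S1 : (S = \sum_j mj j + k * v)%N.
    by rewrite /S big_split /= sum_nat_const card_ord.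
  have vk : 2 ^+ (k * v) <= N%:R `^ (k%:R * e1).
    rewrite mulnC exprM [k%:R * e1]mulrC powRrM powR_mulrn ?powR_ge0//.
    by rewrite lerXn2r ?nnegrE ?exprn_ge0 ?powR_ge0.
  have pp : 2 ^+ (m0 + S) <= N%:R `^ ((1 - e0) + k%:R * e1).
    rewrite S1 addnA exprD powRD//; apply: ler_pM; rewrite ?exprn_ge0//.
  have pS : 2 ^+ S <= N%:R `^ ((1 - e0) + k%:R * e1).
    by apply: le_trans pp; rewrite ler_weXn2l ?ler1n// leq_addl.
  have hs : (2 ^+ S) `^ (e0 / 8) <= N%:R `^ ((e0 / 8) * ((1 - e0) + k%:R * e1)) :> R.
    rewrite [e0 / 8 * _]mulrC [leRHS]powRrM; apply: ge0_ler_powR; rewrite ?nnegrE ?exprn_ge0 ?powR_ge0//.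
    by rewrite divr_ge0// ltW.
  have Hp : height R h `^ (1 + e0 / 8) <= 2 ^+ S * (2 ^+ S) `^ (e0 / 8).
    have p0 : 0 <= 2 ^+ S :> R by rewrite exprn_ge0.
    have -> : 2 ^+ S * (2 ^+ S) `^ (e0 / 8) = (2 ^+ S) `^ (1 + e0 / 8) :> R.
      by rewrite powRD ?powRr1//; apply/implyP => _; rewrite gt_eqF ?exprn_gt0.
    apply: ge0_ler_powR => //; rewrite ?nnegrE ?exprn_ge0//.
      by rewrite addr_ge0// divr_ge0// ltW.
    exact: le_trans ler01 (height_ge1 h).
  (* The scale of the first coordinate and the height of the frequency enter through their product,
     which is why a bound on the total level is enough. *)
  have main : 2 ^+ (m0 + S) * (2 ^+ S) `^ (e0 / 8) <= N%:R `^ (1 - e2).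
    apply: le_trans (ler_pM _ _ pp hs) _; rewrite ?exprn_ge0 ?powR_ge0//.
    rewrite -powRD//; apply: Npow.
    exact: le_trans (exponent_bookkeeping k e00 e01) q5.
  have P0 : 0 < 2 ^+ S * (2 ^+ S) `^ (e0 / 8) :> R.
    by rewrite mulr_gt0 ?powR_gt0 ?exprn_gt0.
  have h3 : c <= 2 ^+ S * (2 ^+ S) `^ (e0 / 8) * dd.
    by apply: le_trans h1 _; apply: ler_wpM2r.
  have h4 : (2 * c)^-1 * N%:R `^ (- e2) * (N%:R * (2 * dd)) <=
      tau * (N%:R * cabs (1 - unity (inner_int h alpha))).
    apply: ler_pM.
    - by rewrite mulr_ge0 ?powR_ge0// ltW.
    - by rewrite !mulr_ge0.
    - by rewrite /tau ler_wpM2r ?powR_ge0.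
    - by rewrite ler_wpM2l.
  apply: le_trans h4.
  have -> : (2 * c)^-1 * N%:R `^ (- e2) * (N%:R * (2 * dd)) =
     (N%:R `^ 1 * N%:R `^ (- e2)) * (dd / c).
    by rewrite -N1; field; rewrite gt_eqF.
  rewrite -powRD//.
  apply: (@le_trans _ _ (2 ^+ (m0 + S) * (2 ^+ S) `^ (e0 / 8) * (dd / c))); last first.
    by apply: ler_wpM2r main; rewrite divr_ge0// ltW.
  rewrite exprD -!mulrA ler_peMr ?exprn_ge0// !mulrA ler_pdivlMr// mul1r.
  exact: h3.
have := lat_sum_error keta eta0 etaB etaM y N0 y0l y0r tau0 hm0 hmj H1 H2 H3.
move=> /le_trans; apply.
have Q (e : nat) : N%:R ^+ e = N%:R `^ e%:R :> R by rewrite powR_mulrn.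
rewrite -/K.
apply: (@le_trans _ _ (K * N%:R ^+ (2 * k) *
   (2 * lat_G n M B0 B1 * N%:R * (1 + C2) ^+ M.+1) ^+ k.+2 * tau ^+ M.+1)).
  apply: ler_wpM2r; first exact: exprn_ge0.
  apply: ler_wpM2l; first by rewrite mulr_ge0 ?exprn_ge0.
  have u1 : 0 <= 1 + tau by rewrite addr_ge0.
  have u2 : 0 <= 1 + C2 by rewrite addr_ge0.
  have G2 : 0 <= 2 * lat_G n M B0 B1 * N%:R by rewrite !mulr_ge0.
  have u3 := mulr_ge0 G2 (exprn_ge0 M.+1 u1).
  have u4 := mulr_ge0 G2 (exprn_ge0 M.+1 u2).
  apply: lerXn2r => //; apply: ler_wpM2l => //; apply: lerXn2r => //.
  by rewrite lerD2l.
have -> : K * N%:R ^+ (2 * k) *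
   (2 * lat_G n M B0 B1 * N%:R * (1 + C2) ^+ M.+1) ^+ k.+2 * tau ^+ M.+1 =
   C * (N%:R `^ (2 * k)%N%:R * N%:R `^ (k.+2)%:R * (N%:R `^ (- e2)) ^+ M.+1).
  rewrite /tau /C -!Q.
  move: (1 + C2) (2 * lat_G n M B0 B1) (N%:R `^ (- e2)) => u w z.
  by rewrite [w * N%:R]mulrC -[N%:R * w * _]mulrA exprMn [(C2 * z) ^+ _]exprMn; ring.
apply: ler_wpM2l => //.
rewrite -[in leLHS](powR_mulrn _ (powR_ge0 _ _)) -powRrM -!powRD//.
apply: Npow.
have -> : (2 * k)%N%:R + k.+2%:R = (3 * k + 2)%N%:R :> R by rewrite -natrD exponent_count.
exact: decay_arith hA.
Qed.

End small_error.

(** * Bumps of finite smoothness and domination by a coarser level *)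

Lemma norm_arith1 (x u : R) : `|x| <= 1 / 2 -> 1 / 2 < `|x - u| ->
  `|u| < `|x - 1 / 2| -> `|u| < `|x + 1 / 2| -> False.
Proof.
case: (ger0P x) => ?; case: (ger0P u) => ?; case: (ger0P (x - u)) => ?;
case: (ger0P (x - 1 / 2)) => ?; case: (ger0P (x + 1 / 2)) => ?; lra.
Qed.

Lemma norm_arith2 (x u : R) : 1 / 2 < `|x| -> `|x - u| <= 1 / 2 ->
  `|u| < `|x - 1 / 2| -> `|u| < `|x + 1 / 2| -> False.
Proof.
case: (ger0P x) => ?; case: (ger0P u) => ?; case: (ger0P (x - u)) => ?;
case: (ger0P (x - 1 / 2)) => ?; case: (ger0P (x + 1 / 2)) => ?; lra.
Qed.

Lemma diff1_ball_ind (u : R) (x : R) : `|diff1 u (ball_ind (1 / 2)) x| <=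
  ball_ind `|u| (x - 1 / 2) + ball_ind `|u| (x + 1 / 2).
Proof.
rewrite /diff1 /ball_ind.
have [c|c] := leP `|x - 1 / 2| `|u|.
  apply: (@le_trans _ _ 1); last by rewrite lerDl.
  exact: norm_bool_sub.
have [d|d] := leP `|x + 1 / 2| `|u|.
  apply: (@le_trans _ _ 1); last by rewrite lerDr.
  exact: norm_bool_sub.
have [a|a] := leP `|x| (1 / 2); have [b|b] := leP `|x - u| (1 / 2); rewrite ?subrr ?normr0 ?addr_ge0//.
- by exfalso; exact: norm_arith1 a b c d.
- by exfalso; exact: norm_arith2 a b c d.
Qed.

Lemma integ_diff1_ball_ind (u : R) :
  kern (diff1 u (ball_ind (1 / 2 : R))) /\
  integ (fun x => `|diff1 u (ball_ind (1 / 2)) x|) <= 4 * `|u|.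
Proof.
have kb r : kern (ball_ind (r : R)) by exact: kern_ball_ind.
have ks (r b : R) : kern (fun x => ball_ind r (x + b)).
  have := @kern_affine R 1 b (ball_ind r) (oner_neq0 _) (kb r).
  by rewrite (_ : (fun x => _ (1 * x + b)) = fun x => ball_ind r (x + b))//; apply/funext => x; rewrite mul1r.
have k1 : kern (diff1 u (ball_ind (1 / 2 : R))).
  exact: (kernB (kb (1 / 2)) (ks (1 / 2) (- u))).
split => //.
apply: (@le_trans _ _ (integ ((fun x => ball_ind `|u| (x + - (1 / 2))) \+ (fun x => ball_ind `|u| (x + 1 / 2))))).
  by apply: le_integ; [exact: kern_norm|exact: kernD|move=> x; exact: diff1_ball_ind].
rewrite integD// !integ_shift// integ_ball_ind//; move: `|u| => w; lra.
Qed.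

(** One difference goes to the box, where it has L_1 norm at most [4 |u|]; the others go to [f]. *)
Lemma dbound_convol_box M (B : R) f : kern f -> dbound M B f ->
  dbound M.+1 (4 * B) (convol f (ball_ind (1 / 2))).
Proof.
move=> kf hf [//|u us] [sM] t /=.
have kb := kern_ball_ind (1 / 2 : R).
have [kd id_] := integ_diff1_ball_ind u.
have -> : diff1 u (convol f (ball_ind (1 / 2))) = convol f (diff1 u (ball_ind (1 / 2))).
  have [_ /= h] := diffs_convol [:: u] kb kf.
  by rewrite (convolC kf kb) h convolC.
have [_ ->] := diffs_convol us kf kd.
have [kD _] := diffs_convol us kf kd.
apply: le_trans (le_norm_integ (kern_convol_section _ kD kd)) _.
apply: (@le_trans _ _ (integ (fun y => B * absprod us * `|diff1 u (ball_ind (1 / 2)) y|))).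
  apply: le_integ; [|by apply: kernZ; exact: kern_norm|].
    by apply: kern_norm; exact: kern_convol_section.
  by move=> y; rewrite normrM ler_wpM2r// hf.
rewrite integZ; last exact: kern_norm.
rewrite /absprod big_cons -/(absprod us).
have a0 : 0 <= B * absprod us.
  by have := hf us sM 0; apply: le_trans.
apply: le_trans (ler_wpM2l a0 id_) _.
by apply: eq_bound; ring.
Qed.

(** A spline: an indicator convolved with [M] boxes of integral 1. Each box gains one order and eats
    [1 / 2] of the plateau on either side, so the induction starts from a wider plateau. *)
Lemma bump_exists M (c : R) : 0 <= c -> exists b C B,
  [/\ kern b, bsupp C b, forall x, 0 <= b x, forall x, `|x| <= c -> 1 <= b x & dbound M B b].
Proof.
elim: M c => [|M IH] c c0.
  exists (ball_ind c), c, 1; split.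
  - exact: kern_ball_ind.
  - by move=> x cx; rewrite /ball_ind leNgt cx.
  - exact: ball_ind_ge0.
  - by move=> x cx; rewrite /ball_ind cx.
  - move=> [|//] _ t; rewrite /absprod big_nil mulr1 /= /ball_ind.
    by have := norm_bool_sub R (`|t| <= c) false; rewrite subr0.
have [|b [C [B [kb b0 bp b1 bB]]]] := IH (c + 1 / 2); first by rewrite addr_ge0.
have kh := kern_ball_ind (1 / 2 : R).
exists (convol b (ball_ind (1 / 2))), (C + 1 / 2), (4 * B); split.
- exact: kern_convol.
- by apply: bsupp_convol => // x cx; rewrite /ball_ind leNgt cx.
- move=> x; rewrite -(_ : integ (fun _ => 0) = 0 :> R); last first.
    by rewrite /integ Rintegral_cst// mul0r.
  apply: le_integ; [exact: kern0|exact: kern_convol_section|].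
  by move=> y; rewrite mulr_ge0// ball_ind_ge0.
- move=> x xc.
  rewrite -[leLHS](_ : integ (ball_ind (1 / 2)) = 1); last by rewrite integ_ball_ind//; lra.
  apply: le_integ => //; first exact: kern_convol_section.
  move=> y; rewrite {1}/ball_ind; have [h|h] := leP `|y| (1 / 2); last first.
    by rewrite mulr_ge0// ball_ind_ge0.
  rewrite /ball_ind h mulr1; apply: b1; apply: le_trans (ler_normB _ _) _.
  by apply: lerD.
- exact: dbound_convol_box.
Qed.

(** Take as much as possible from the first coordinate and recurse. It serves to lower the levels
    until they have a prescribed total. *)
Lemma exists_sub_sum k (f : 'I_k -> nat) (s : nat) : (s <= \sum_j f j)%N ->
  exists2 g : 'I_k -> nat, (forall j, (g j <= f j)%N) & (\sum_j g j)%N = s.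
Proof.
elim: k f s => [|k IH] f s.
  by rewrite big_ord0 leqn0 => /eqP ->; exists f => //; rewrite big_ord0.
rewrite big_ord_recl => h.
have [|g gf gs] := IH (fun j => f (lift ord0 j)) (s - minn s (f ord0))%N.
  by have [a|a] := leqP s (f ord0); rewrite ?subnn// leq_subLR.
exists (fun i => if unlift ord0 i is Some j then g j else minn s (f ord0)).
  move=> i; case: (unliftP ord0 i) => [j ->|->]; first exact: gf.
  exact: geq_minr.
rewrite big_ord_recl unlift_none; under eq_bigr do rewrite liftK.
by rewrite gs addnC subnK// geq_minl.
Qed.

Lemma dyadic_family_bounds (b : R -> R) (n M : nat) (B0 B1 : R) :
  kern b -> bsupp n%:R b -> (forall x, `|b x| <= B0) -> dbound M.+1 B1 b ->
  [/\ forall j, kern (dyadic b j), forall j, bsupp n%:R (dyadic b j),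
     forall j x, `|dyadic b j x| <= B0 * 2 ^+ j &
     forall j, dbound M.+1 (B1 * 2 ^+ (j * M.+2)) (dyadic b j)].
Proof.
move=> kb b0 bB bM; split=> j.
- exact: kern_dyadic.
- move=> x nx; rewrite /dyadic b0 ?mulr0// normrM ger0_norm ?exprn_ge0//.
  by apply: lt_le_trans nx _; rewrite ler_peMl// exprn_ege1// ler1n.
- by move=> x; rewrite /dyadic normrM ger0_norm ?exprn_ge0// mulrC ler_wpM2r// exprn_ge0.
- have hs := @dbound_scale R M.+1 B1 (2 ^+ j) b (exprn_gt0 _ (ltr0n _ 2)) bM.
  move=> us sM t; rewrite /dyadic diffsZ normrM ger0_norm ?exprn_ge0//.
  have -> : B1 * 2 ^+ (j * M.+2) * absprod us = 2 ^+ j * ((2 ^+ j) ^+ M.+1 * B1 * absprod us).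
    by rewrite mulnS exprD exprM; ring.
  by rewrite ler_wpM2l ?exprn_ge0//; exact: hs.
Qed.

(** On the support of [kap j] one has [2^i |x| <= 2^j |x| <= c], where [b] is at least 1, so
    [dyadic b i >= 2 ^+ i] there. *)
Lemma dominated_dyadic (kap : nat -> R -> R) (b : R -> R) (c B : R) :
  0 < c -> (forall j, bsupp (c * 2 ^- j) (kap j)) ->
  (forall j x, `|kap j x| <= B * 2 ^+ j) ->
  (forall x, 0 <= b x) -> (forall x, `|x| <= c -> 1 <= b x) ->
  forall i j x, (i <= j)%N -> `|kap j x| <= B * 2 ^+ (j - i) * dyadic b i x.
Proof.
move=> c0 kc kB b0 b1 i j x ij.
have B0 : 0 <= B by have := le_trans (normr_ge0 _) (kB 0%N 0); rewrite expr0 mulr1.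
have [h|h] := leP `|x| (c * 2 ^- j); last first.
  by rewrite (kc _ _ h) normr0 /dyadic !mulr_ge0 ?exprn_ge0.
apply: le_trans (kB j x) _; rewrite -[in leLHS](subnK ij) exprD mulrA.
rewrite /dyadic ler_wpM2l ?mulr_ge0 ?exprn_ge0// ler_peMr ?exprn_ge0//.
apply: b1; rewrite normrM ger0_norm ?exprn_ge0//.
apply: (@le_trans _ _ (2 ^+ j * (c * 2 ^- j))).
  by apply: ler_pM => //; rewrite ?exprn_ge0// ler_weXn2l// ler1n.
by rewrite mulrCA divff ?mulr1// gt_eqF ?exprn_gt0.
Qed.

Lemma dominated_per (f g : R -> R) (n : nat) (C : R) t :
  (forall x, `|f x| <= C * g x) -> `|per n f t| <= C * per n g t.
Proof.
move=> h; rewrite /per /wsum mulr_sumr; apply: le_trans (ler_norm_sum _ _ _) _.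
by apply: ler_sum.
Qed.

Lemma dominated_lat_sum (kap et : nat -> R -> R) (n k : nat) (alpha : 'rV[R]_k) (B : R)
    N m0 m0' (mj mj' : 'I_k -> nat) y0 y :
  (forall i j x, (i <= j)%N -> `|kap j x| <= B * 2 ^+ (j - i) * et i x) ->
  (m0' <= m0)%N -> (forall j, (mj' j <= mj j)%N) ->
  `|lat_sum kap n alpha N m0 mj y0 y| <=
    B ^+ k.+1 * 2 ^+ ((m0 - m0') + \sum_j (mj j - mj' j)) *
    lat_sum et n alpha N m0' mj' y0 y.
Proof.
move=> h hm0 hmj; rewrite /lat_sum normrM ger0_norm ?invr_ge0// mulrCA.
rewrite ler_wpM2l ?invr_ge0// mulr_sumr; apply: le_trans (ler_norm_sum _ _ _) _.
apply: ler_sum => i _; rewrite normrM normr_prod.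
have -> : B ^+ k.+1 * 2 ^+ (m0 - m0' + \sum_j (mj j - mj' j)) *
   (lat_weight et n N m0' y0 i * \prod_j per n (et (mj' j)) (lat_arg n alpha N i y j)) =
  (B * 2 ^+ (m0 - m0') * lat_weight et n N m0' y0 i) *
  \prod_j (B * 2 ^+ (mj j - mj' j) * per n (et (mj' j)) (lat_arg n alpha N i y j)).
  rewrite !big_split /= prodrXr prodr_const card_ord exprD exprS.
  by ring.
apply: ler_pM => //.
- by apply: prodr_ge0.
- exact: h.
- apply: ler_prod => j _; rewrite normr_ge0 /=; apply: dominated_per => x; exact: h.
Qed.

Lemma sup_arith (a d z : R) : 0 <= a -> 0 <= d -> 0 <= z ->
  a + (1 + 2 * z) * d <= (a + 2 * d) * (1 + z).
Proof. by move=> a0 d0 z0; have := mulr_ge0 a0 z0; have := mulr_ge0 d0 z0; nra. Qed.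

Section sup_bound.
Variables (kap : nat -> R -> R) (c B : R).
Hypothesis c0 : 0 < c.
Hypothesis kkap : forall j, kern (kap j).
Hypothesis kapc : forall j, bsupp (c * 2 ^- j) (kap j).
Hypothesis kapB : forall j x, `|kap j x| <= B * 2 ^+ j.
Variables (k : nat) (alpha : 'rV[R]_k) (e0 : R).
Hypothesis ht : approximation_type alpha 1.
Hypotheses (e00 : 0 < e0) (e01 : e0 <= 1).

Let B_ge0 : 0 <= B.
Proof. by have := le_trans (normr_ge0 _) (kapB 0%N 0); rewrite expr0 mulr1. Qed.

Lemma integ_norm_kap j : integ (fun x => `|kap j x|) <= 2 * c * B.
Proof.
have kb := kern_ball_ind (c * 2 ^- j).
apply: (@le_trans _ _ (integ (fun x => (B * 2 ^+ j) * ball_ind (c * 2 ^- j) x))).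
  apply: le_integ; [exact: kern_norm|exact: kernZ|].
  move=> x; rewrite /ball_ind; have [h|h] := leP `|x| (c * 2 ^- j); first by rewrite mulr1.
  by rewrite (kapc h) normr0 mulr0.
rewrite integZ// integ_ball_ind; last by rewrite mulr_ge0 ?invr_ge0 ?exprn_ge0// ltW.
apply: eq_bound; field; by rewrite gt_eqF ?exprn_gt0.
Qed.

Lemma norm_integ_kap j : `|integ (kap j)| <= 2 * c * B.
Proof. exact: le_trans (le_norm_integ (kkap j)) (integ_norm_kap j). Qed.

(** Lower the levels until their total is at most [v], where [2^v <= N^(1 - e0) < 2^(v+1)], and
    dominate by the nonnegative bump there. Its lattice sum is bounded by [small_error], and the
    price is [2^(S - v)], at most twice [2^S N^-(1 - e0)]. The radius [n] stays free above [n0] so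
    that one value can serve the bump and the kernels [kap]. *)
Lemma sup_error : exists n0 : nat, forall n, (n0 <= n)%N -> exists2 C : R, 0 <= C &
  forall (N m0 : nat) (mj : 'I_k -> nat) (y0 : R) (y : 'I_k -> R), (0 < N)%N ->
    -1 <= y0 -> y0 <= 2 ->
  `|integ (kap m0) * \prod_j integ (kap (mj j)) - lat_sum kap n alpha N m0 mj y0 y| <=
    C * (1 + 2 ^+ (m0 + \sum_j mj j) * N%:R `^ (- (1 - e0))).
Proof.
pose e2 := e0 / (4 * k.+1%:R) / 2.
have e20 : 0 < e2 by rewrite !divr_gt0// mulr_gt0// ltr0n.
(* [A = 0] in [small_error]: the lattice sums of the bump need only be bounded. *)
have [M0 hM0] := nat_scaled_bound (addr_ge0 (ler0n R (3 * k + 2)) (lexx 0)) e20.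
have [b [Cb [Bb [kb b0 bp b1 bB]]]] := bump_exists M0.+1 (ltW c0).
have [Bs [Bs0 _ bs _]] := kern_wide 0 kb.
exists (Num.truncn Cb).+1 => n hn.
have bn : bsupp n%:R b.
  move=> x nx; apply: b0; apply: le_lt_trans nx.
  have [Cb0|Cb0] := leP Cb 0; first exact: le_trans Cb0 (ler0n _ _).
  have /andP[_ h] := truncn_itv (ltW Cb0).
  by apply: le_trans (ltW h) _; rewrite ler_nat.
have [k1 k2 k3 k4] := dyadic_family_bounds kb bn bs bB.
have [C C0 hC] := small_error k1 k2 k3 k4 ht e00 e01 hM0.
have dom := dominated_dyadic c0 kapc kapB bp b1.
pose I := `|integ b|.
pose K1 := (2 * c * B) ^+ k.+1; pose K2 := B ^+ k.+1 * (I ^+ k.+1 + C).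
have cB0 : 0 <= 2 * c * B by rewrite !mulr_ge0// ltW.
have K10 : 0 <= K1 by exact: exprn_ge0.
have K20 : 0 <= K2 by rewrite mulr_ge0 ?exprn_ge0// addr_ge0 ?exprn_ge0 ?normr_ge0.
exists (K1 + 2 * K2); first by rewrite addr_ge0// mulr_ge0.
move=> N m0 mj y0 y N0 y0l y0r.
have NR1 : 1 <= N%:R :> R by rewrite ler1n.
have NR0 : 0 < N%:R :> R by rewrite ltr0n.
have X1 : 1 <= N%:R `^ (1 - e0).
  by rewrite -[leLHS](powRr0 N%:R) ler_powR// subr_ge0.
have [v /andP[v1 v2]] := dyadic_below X1.
set S := (m0 + \sum_j mj j)%N; set Y := 2 ^+ S * _.
have Y0 : 0 <= Y by rewrite mulr_ge0 ?powR_ge0 ?exprn_ge0.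
have [m0' [mj' [h0 hj hs]]] : exists (m0' : nat) (mj' : 'I_k -> nat),
   [/\ (m0' <= m0)%N, forall j, (mj' j <= mj j)%N & (m0' + \sum_j mj' j)%N = minn S v].
  have [|g gf gs] := @exists_sub_sum k mj (minn S v - minn m0 v)%N.
    exact: minn_split1.
  exists (minn m0 v), g; split=> //; first exact: geq_minl.
  by rewrite gs minn_split2.
have hsum : (m0 - m0' + \sum_j (mj j - mj' j) = S - minn S v)%N.
  rewrite -hs /S sumnB// addn_subnD//; exact: leq_sum.
have small' : 2 ^+ (m0' + \sum_j mj' j) <= N%:R `^ (1 - e0).
  by apply: le_trans v1; rewrite hs ler_weXn2l ?ler1n// geq_minr.
have H := hC N m0' mj' y0 y N0 y0l y0r small'.
rewrite oppr0 powRr0 mulr1 in H.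
have D := dominated_lat_sum n alpha N y0 y dom h0 hj.
rewrite hsum in D.
have hI : `|integ (dyadic b m0') * \prod_j integ (dyadic b (mj' j))| <= I ^+ k.+1.
  rewrite normrM normr_prod !integ_dyadic//; under eq_bigr do rewrite integ_dyadic//.
  by rewrite prodr_const card_ord -exprS.
have L : lat_sum (dyadic b) n alpha N m0' mj' y0 y <= I ^+ k.+1 + C.
  rewrite -[leLHS](subKr (integ (dyadic b m0') * \prod_j integ (dyadic b (mj' j)))).
  apply: le_trans (ler_norm _) _; apply: le_trans (ler_normB _ _) _.
  exact: lerD.
have hI2 : `|integ (kap m0) * \prod_j integ (kap (mj j))| <= K1.
  rewrite /K1 normrM normr_prod exprS; apply: ler_pM => //; first exact: prodr_ge0.
    exact: norm_integ_kap.
  rewrite -[k in leRHS]card_ord -prodr_const; apply: ler_prod => j _.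
  by rewrite normr_ge0 norm_integ_kap.
have P : 2 ^+ (S - minn S v) <= 1 + 2 * Y :> R.
  have [Sv|Sv] := leqP S v; first by rewrite subnn expr0 lerDl mulr_ge0.
  apply: (@le_trans _ _ (2 * Y)); last by rewrite lerDr.
  rewrite /Y powRN mulrA ler_pdivlMr ?powR_gt0//.
  apply: le_trans (ler_wpM2l _ (ltW v2)) _; first exact: exprn_ge0.
  by rewrite -exprS -exprD addnS subnK// ltnW.
apply: le_trans (ler_normB _ _) _.
apply: (@le_trans _ _ (K1 + (1 + 2 * Y) * K2)).
  apply: lerD => //; apply: le_trans D _.
  rewrite -mulrA [leRHS]mulrC /K2 -[leRHS]mulrA; apply: ler_wpM2l; first exact: exprn_ge0.
  rewrite [leRHS]mulrC; apply: le_trans (ler_wpM2l _ L) _; first exact: exprn_ge0.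
  by apply: ler_wpM2r => //; rewrite addr_ge0 ?exprn_ge0 ?normr_ge0.
exact: sup_arith.
Qed.

End sup_bound.

End parameters.

(** * Convolution on R^d *)

Section Rd.
Variables (R : realType) (n : nat).
Local Notation V := ('rV[R]_n).
Local Notation mu := (lebesgue_rV R n).
Implicit Types (f g h : V -> R) (phi psi : 'I_n -> R -> R).

Definition boxd (c : R) : set V := [set x | forall i, `|x 0 i| <= c].

Lemma measurable_coordR (i : 'I_n) : measurable_fun [set: V] (fun x : V => x 0 i).
Proof. exact: measurable_coord. Qed.

Lemma measurable_boxd c : measurable (boxd c).
Proof.
rewrite (_ : boxd c = \bigcap_(i in [set: 'I_n]) [set x : V | `|x 0 i| <= c]).
  apply: fin_bigcap_measurable => // i _.
  rewrite -[X in measurable X]setTI.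
  have -> : [set x : V | `|x 0 i| <= c] = (fun x : V => x 0 i) @^-1` `[-c, c]%classic.
    by apply/seteqP; split=> x /=; rewrite in_itv/= ler_norml.
  exact: measurable_coordR.
by apply/seteqP; split=> x h; [move=> i _|move=> i]; exact: h.
Qed.

Definition kernd f := measurable_fun setT f /\ exists c : R,
  [/\ 0 <= c, forall x, `|f x| <= c & forall x, ~ boxd c x -> f x = 0].

Definition integd f : R := Rintegral mu setT f.

Definition tens phi (x : V) : R := \prod_i phi i (x 0 i).

Lemma sub_boxd (a b : R) : a <= b -> boxd a `<=` boxd b.
Proof. by move=> ab x h i; apply: le_trans ab. Qed.

Lemma kernd_wide f (C : R) : kernd f -> exists c : R,
  [/\ 0 < c, C <= c, forall x, `|f x| <= c & forall x, ~ boxd c x -> f x = 0].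
Proof.
move=> [_ [c [c0 fc f0]]]; exists (c + `|C| + 1).
have C0 := normr_ge0 C; have CC := ler_norm C.
have cc : c <= c + `|C| + 1 by rewrite -addrA lerDl addr_ge0.
split.
- by rewrite ltr_wpDl ?addr_ge0.
- by rewrite addrAC (le_trans CC)// lerDr addr_ge0.
- by move=> x; apply: le_trans (fc x) _.
- by move=> x h; apply: f0 => h'; apply: h; exact: sub_boxd h'.
Qed.

Lemma kernd_intro f (c b : R) : measurable_fun setT f ->
  (forall x, `|f x| <= c) -> (forall x, ~ boxd b x -> f x = 0) -> kernd f.
Proof.
move=> mf fc f0; split=> //; exists (`|c| + `|b|); split.
- by rewrite addr_ge0.
- by move=> x; apply: le_trans (fc x) _; rewrite (le_trans (ler_norm _))// lerDl.
- move=> x h; apply: f0 => h'; apply: h; apply: sub_boxd h'.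
  by rewrite (le_trans (ler_norm _))// lerDr.
Qed.

Lemma kerndD f g : kernd f -> kernd g -> kernd (f \+ g).
Proof.
move=> kf kg; have [c [c0 _ fc f0]] := kernd_wide 0 kf.
have [b [b0 bc gb g0]] := kernd_wide c kg.
apply: (@kernd_intro _ (c + b) b).
- by apply: measurable_funD; [case: kf|case: kg].
- by move=> x; rewrite (le_trans (ler_normD _ _))// lerD.
- by move=> x h /=; rewrite g0// f0 ?addr0// => h'; apply: h; exact: sub_boxd h'.
Qed.

Lemma kerndMl f g (c : R) : measurable_fun setT g -> (forall x, `|g x| <= c) -> kernd f ->
  kernd (fun x => g x * f x).
Proof.
move=> mg gc kf; have [b [b0 _ fb f0]] := kernd_wide 0 kf.
apply: (@kernd_intro _ (c * b) b).
- by apply: measurable_funM => //; case: kf.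
- by move=> x; rewrite normrM ler_pM.
- by move=> x h; rewrite f0 ?mulr0.
Qed.

Lemma kerndZ (a : R) f : kernd f -> kernd (fun x => a * f x).
Proof. by move=> kf; apply: (@kerndMl _ _ `|a|). Qed.

Lemma kerndB f g : kernd f -> kernd g -> kernd (f \- g).
Proof.
move=> kf kg; rewrite (_ : f \- g = f \+ (fun x => -1 * g x)).
  by apply: kerndD => //; exact: kerndZ.
by apply/funext => x /=; rewrite mulN1r.
Qed.

Lemma kernd_norm f : kernd f -> kernd (fun x => `|f x|).
Proof.
move=> kf; have [c [c0 _ fc f0]] := kernd_wide 0 kf.
apply: (@kernd_intro _ c c).
- by apply: measurableT_comp => //; case: kf.
- by move=> x; rewrite normr_id.
- by move=> x /f0 ->; rewrite normr0.
Qed.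

Lemma kernd0 : kernd (fun _ => 0).
Proof. by apply: (@kernd_intro _ 0 0) => // x; rewrite normr0. Qed.

Lemma kernd_sum (I : Type) (r : seq I) (F : I -> V -> R) : (forall i, kernd (F i)) ->
  kernd (fun x => \sum_(i <- r) F i x).
Proof.
move=> kF; elim: r => [|i r IH].
  by rewrite (_ : (fun _ => _) = fun _ => 0); [exact: kernd0|apply/funext => x; rewrite big_nil].
rewrite (_ : (fun _ => _) = F i \+ (fun x => \sum_(i <- r) F i x)); first exact: kerndD.
by apply/funext => x; rewrite big_cons.
Qed.

End Rd.

Section Rd_measure.
Variable R : realType.

Lemma lebesgue_rVS n : lebesgue_rV R n.+1 = lebesgue_rV_step (lebesgue_rV R n) :> (set _ -> \bar R).
Proof. by []. Qed.

Lemma boxd_cons n (c : R) (z : R * 'rV[R]_n) :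
  boxd c (rV_cons z) <-> (`[- c, c]%classic : set R) z.1 /\ boxd c z.2.
Proof.
case: z => x v /=; rewrite in_itv/= -ler_norml; split=> [h|[h1 h2] i].
  split=> /=; first by have := h ord0; rewrite rV_cons0.
  by move=> j /=; have := h (lift ord0 j); rewrite rV_consS.
case: (unliftP ord0 i) => [j ->|->]; first by rewrite rV_consS; exact: h2.
by rewrite rV_cons0.
Qed.

Lemma boxd_fin n c : (lebesgue_rV R n (boxd c) < +oo)%E.
Proof.
elim: n => [|n IH]; first by rewrite /= diracE ltry.
rewrite lebesgue_rVS /lebesgue_rV_step /pushforward.
have -> : @rV_cons R n @^-1` boxd c = (`[-c, c]%classic : set (measurableTypeR R)) `*` boxd c.
  by apply/seteqP; split=> -[x v] /=; rewrite boxd_cons.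
rewrite [X in (X < _)%E](_ : _ = (@lebesgue_measure R (`[(- c)%R, c]%classic) * lebesgue_rV R n (boxd c))%E).
  rewrite lte_mul_pinfty// ?ge0_fin_numE//; exact: lebesgue_itv_fin.
by apply: product_measure1E => //; exact: measurable_boxd.
Qed.

Lemma kernd_integrable n (f : 'rV[R]_n -> R) : kernd f ->
  (lebesgue_rV R n).-integrable setT (EFin \o f).
Proof.
move=> [mf [c [c0 fc f0]]].
by apply: (@bounded_integrable _ _ _ _ (boxd c) c) => //; [exact: measurable_boxd|exact: boxd_fin].
Qed.

Lemma integdD n (f g : 'rV[R]_n -> R) : kernd f -> kernd g -> integd (f \+ g) = integd f + integd g.
Proof. by move=> /kernd_integrable kf /kernd_integrable kg; rewrite /integd RintegralD. Qed.

Lemma integdB n (f g : 'rV[R]_n -> R) : kernd f -> kernd g -> integd (f \- g) = integd f - integd g.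
Proof. by move=> /kernd_integrable kf /kernd_integrable kg; rewrite /integd RintegralB. Qed.

Lemma integdZ n (f : 'rV[R]_n -> R) (a : R) : kernd f -> integd (fun x => a * f x) = a * integd f.
Proof. by move=> /kernd_integrable kf; rewrite /integd RintegralZl. Qed.

Lemma le_integd n (f g : 'rV[R]_n -> R) : kernd f -> kernd g -> (forall x, f x <= g x) ->
  integd f <= integd g.
Proof. by move=> /kernd_integrable kf /kernd_integrable kg h; apply: le_Rintegral. Qed.

Lemma le_norm_integd n (f : 'rV[R]_n -> R) : kernd f -> `|integd f| <= integd (fun x => `|f x|).
Proof. by move=> /kernd_integrable kf; apply: le_normr_Rintegral. Qed.

Lemma integd0 n : integd (fun _ : 'rV[R]_n => 0) = 0.
Proof. by rewrite /integd Rintegral_cst// mul0r. Qed.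

Lemma integd_sum n (I : Type) (r : seq I) (F : I -> 'rV[R]_n -> R) : (forall i, kernd (F i)) ->
  integd (fun x => \sum_(i <- r) F i x) = \sum_(i <- r) integd (F i).
Proof.
move=> kF; elim: r => [|i r IH].
  rewrite big_nil -[RHS](integd0 n); congr integd.
  by apply/funext => x; rewrite big_nil.
rewrite big_cons -IH -integdD//; last exact: kernd_sum.
by congr integd; apply/funext => x; rewrite big_cons.
Qed.

Lemma measurable_tens n (phi : 'I_n -> R -> R) : (forall i, kern (phi i)) ->
  measurable_fun setT (tens phi).
Proof.
move=> kp; apply: measurable_prod => i _.
by apply: measurableT_comp; [case: (kp i)|exact: measurable_coordR].
Qed.

Lemma kernd_tens n (phi : 'I_n -> R -> R) : (forall i, kern (phi i)) -> kernd (tens phi).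
Proof.
move=> kp.
have [c hc] := choice (fun i => kern_wide 0 (kp i)).
apply: (@kernd_intro _ _ _ (\prod_i c i) (\sum_i c i)).
- exact: measurable_tens.
- move=> x; rewrite /tens normr_prod; apply: ler_prod => i _.
  by rewrite normr_ge0 /=; case: (hc i).
- move=> x /existsNP[i /negP]; rewrite -ltNge => h.
  rewrite /tens (bigD1 i)//=; have [_ _ _ ->] := hc i; first by rewrite mul0r.
  apply: le_lt_trans h; rewrite (bigD1 i)//= lerDl; apply: sumr_ge0 => j _.
  by case: (hc j).
Qed.

Lemma integd0d (f : 'rV[R]_0 -> R) : integd f = f 0.
Proof.
have mf : measurable_fun setT f.
  move=> _ Y mY; rewrite setTI.
  have [h|h] := pselect (Y (f 0)).
    rewrite (_ : _ @^-1` _ = setT); first exact: measurableT.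
    by apply/seteqP; split=> // x _ /=; rewrite (_ : x = 0)//; apply/rowP => -[].
  rewrite (_ : _ @^-1` _ = set0); first exact: measurable0.
  by apply/seteqP; split=> // x /=; rewrite (_ : x = 0)//; apply/rowP => -[].
rewrite /integd /Rintegral /= integral_dirac//; last exact/measurable_EFinP.
by rewrite diracT mul1e.
Qed.

Lemma integd_cons n (f : 'rV[R]_n.+1 -> R) : kernd f ->
  integd f = Rintegral (@lebesgue_measure R \x lebesgue_rV R n)%E setT (f \o @rV_cons R n).
Proof.
move=> kf; rewrite /integd /Rintegral.
have mf : measurable_fun setT (EFin \o f) by apply/measurable_EFinP; case: kf.
have intf := kernd_integrable kf.
rewrite -(@integral_pushforward _ _ _ _ _ _ (@measurable_rV_cons R n)
  (@lebesgue_measure R \x lebesgue_rV R n)%E setT (EFin \o f))//.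
have [mf' [c [c0 fc f0]]] := kf.
rewrite preimage_setT.
apply: (@bounded_integrable_prod _ _ _ _ _ (@lebesgue_measure R) (lebesgue_rV R n)
  (`[- c, c]%classic) (boxd c) c (f \o @rV_cons R n)) => //.
- exact: measurable_boxd.
- exact: lebesgue_itv_fin.
- exact: boxd_fin.
- by apply: measurableT_comp => //; exact: measurable_rV_cons.
- by move=> z; exact: fc.
- by move=> z h; apply: f0; rewrite boxd_cons.
Qed.

Lemma integd_tens n (phi : 'I_n -> R -> R) : (forall i, kern (phi i)) ->
  integd (tens phi) = \prod_i integ (phi i).
Proof.
elim: n phi => [|n IH] phi kp; first by rewrite integd0d /tens !big_ord0.
have kt := kernd_tens kp.
have kt' : kernd (tens (fun j => phi (lift ord0 j))) by apply: kernd_tens.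
have E (z : R * 'rV[R]_n) : tens phi (rV_cons z) =
    phi ord0 z.1 * tens (fun j => phi (lift ord0 j)) z.2.
  rewrite /tens big_ord_recl rV_cons0; congr (_ * _).
  by apply: eq_bigr => j _; rewrite rV_consS.
rewrite integd_cons//.
have [mf [c [c0 fc f0]]] := kt.
have -> : Rintegral (@lebesgue_measure R \x lebesgue_rV R n)%E setT (tens phi \o @rV_cons R n) =
  integ (fun x => integd (fun v => tens phi (rV_cons (x, v)))).
  apply: (@Rintegral_fubini1 _ _ _ _ _ (@lebesgue_measure R) (lebesgue_rV R n)
    (`[- c, c]%classic) (boxd c) c (tens phi \o @rV_cons R n)) => //.
  - exact: measurable_boxd.
  - exact: lebesgue_itv_fin.
  - exact: boxd_fin.
  - by apply: measurableT_comp => //; exact: measurable_rV_cons.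
  - by move=> z; exact: fc.
  - by move=> z h; apply: f0; rewrite boxd_cons.
rewrite big_ord_recl -IH//.
rewrite mulrC -integZ//; congr integ; apply/funext => x.
rewrite mulrC -integdZ//; congr integd; apply/funext => v; exact: E.
Qed.

Lemma rV_nbhs_box n (A : set 'rV[R]_n) (x : 'rV[R]_n) : nbhs x A ->
  exists2 e : R, 0 < e & forall y : 'rV[R]_n, (forall i, `|x 0 i - y 0 i| < e) -> A y.
Proof.
move=> /nbhs_ballP[e /= e0 h]; exists e => // y hy; apply: h.
by split=> // i j; rewrite !ord1; exact: hy.
Qed.

(** The measurable sets are generated by the coordinates, so an open set is written as the countable
    union of the cubes with rational centre and radius [1 / (q.2 + 1)] that it contains. *)
Lemma open_rV_measurable n (A : set 'rV[R]_n) : open A -> measurable A.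
Proof.
move=> oA.
pose box (q : 'rV[rat]_n * nat) : set 'rV[R]_n :=
  [set x | forall i, `|x 0 i - ratr (q.1 0 i)| < q.2.+1%:R^-1].
have mbox q : measurable (box q).
  rewrite (_ : box q = \bigcap_(i in [set: 'I_n]) [set x : 'rV[R]_n | `|x 0 i - ratr (q.1 0 i)| < q.2.+1%:R^-1]).
    apply: fin_bigcap_measurable => // i _.
    rewrite -[X in measurable X]setTI.
    have -> : [set x : 'rV[R]_n | `|x 0 i - ratr (q.1 0 i)| < q.2.+1%:R^-1] =
      (fun x : 'rV[R]_n => x 0 i) @^-1` `](ratr (q.1 0 i) - q.2.+1%:R^-1), (ratr (q.1 0 i) + q.2.+1%:R^-1)[%classic.
      by apply/seteqP; split=> x /=; rewrite in_itv/= ltr_distl.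
    exact: measurable_coordR.
  by apply/seteqP; split=> x h; [move=> i _|move=> i]; exact: h.
pose F q : set 'rV[R]_n := if `[< box q `<=` A >] then box q else set0.
have -> : A = \bigcup_q F q.
  apply/seteqP; split=> [x Ax|x [q _]]; last by rewrite /F; case: asboolP => // h; exact: h.
  have [e e0 he] := rV_nbhs_box (oA x Ax).
  (* Radius below [e / 2]: a cube of this size containing [x] lies in the [e]-neighbourhood of
     [x]. *)
  have [m /= hm] : exists m : nat, m.+1%:R^-1 < e / 2.
    have /andP[_ h] := truncn_itv (divr_ge0 (ler0n R 2) (ltW e0)).
    by exists (Num.truncn (2 / e)); rewrite invf_plt ?posrE ?divr_gt0// invf_div.
  have im0 : 0 < m.+1%:R^-1 :> R by rewrite invr_gt0.
  have hq i : exists q : rat, `|x 0 i - ratr q| < m.+1%:R^-1.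
    have /rat_in_itvoo[q] : x 0 i - m.+1%:R^-1 < x 0 i + m.+1%:R^-1.
      by rewrite ltrD2l (lt_trans _ im0)// oppr_lt0.
    rewrite in_itv/= => /andP[q1 q2]; exists q.
    by rewrite ltr_distlC q1.
  have [q {}hq] := choice hq.
  exists (\row_i q i, m) => //; rewrite /F; case: asboolP => [_|].
    by move=> i /=; rewrite mxE; exact: hq.
  case=> y hy; apply: he => i.
  have := hy i; rewrite /= mxE => h1.
  apply: le_lt_trans (ler_distD (ratr (q i)) _ _) _.
  rewrite [e]splitr; apply: ltrD; first exact: lt_trans (hq i) hm.
  by rewrite distrC (lt_trans h1).
apply: countable_bigcupT_measurable; first exact: countableP.
by move=> q; rewrite /F; case: asboolP.
Qed.

Lemma continuous_rV_measurable n (f : 'rV[R]_n -> R) : continuous f -> measurable_fun setT f.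
Proof.
move=> cf mD; apply: (measurability _ (RGenOInfty.measurableE R)) => //.
move=> /= _ [_ [a ->] <-]; rewrite setTI; apply: open_rV_measurable; rewrite preimage_itvoy.
apply: (@open_comp _ _ f [set y | a < y]); last exact: open_gt.
by move=> x _; exact: cf.
Qed.

Lemma tens_translate n (phi : 'I_n -> R -> R) (x : 'rV[R]_n) :
  (fun y => tens phi (x - y)) = tens (fun i u => phi i (x 0 i - u)).
Proof. by apply/funext => y; apply: eq_bigr => i _; rewrite !mxE. Qed.

Lemma kern_reflect (f : R -> R) (b : R) : kern f -> kern (fun u => f (b - u)).
Proof.
move=> kf; rewrite (_ : (fun _ => _) = fun u => f (-1 * u + b)).
  by apply: kern_affine => //; rewrite oppr_eq0 oner_neq0.
by apply/funext => u; rewrite mulN1r addrC.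
Qed.

Lemma kern_translate (f : R -> R) (b : R) : kern f -> kern (fun u => f (u - b)).
Proof.
move=> kf; rewrite (_ : (fun _ => _) = fun u => f (1 * u + - b)).
  by apply: kern_affine => //; rewrite oner_neq0.
by apply/funext => u; rewrite mul1r.
Qed.

Lemma kernd_tens_reflect n (phi : 'I_n -> R -> R) (x : 'rV[R]_n) : (forall i, kern (phi i)) ->
  kernd (fun y => tens phi (x - y)).
Proof. by move=> kp; rewrite tens_translate; apply: kernd_tens => i; exact: kern_reflect. Qed.

Lemma integd_tens_reflect n (phi : 'I_n -> R -> R) (x : 'rV[R]_n) : (forall i, kern (phi i)) ->
  integd (fun y => tens phi (x - y)) = \prod_i integ (phi i).
Proof.
move=> kp; rewrite tens_translate integd_tens; last by move=> i; exact: kern_reflect.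
by apply: eq_bigr => i _; rewrite integ_refl.
Qed.

Lemma tens_translateR n (phi : 'I_n -> R -> R) (x : 'rV[R]_n) :
  (fun y => tens phi (y - x)) = tens (fun i u => phi i (u - x 0 i)).
Proof. by apply/funext => y; apply: eq_bigr => i _; rewrite !mxE. Qed.

Lemma tens_norm n (phi : 'I_n -> R -> R) x :
  `|tens phi x| = tens (fun i u => `|phi i u|) x.
Proof. exact: normr_prod. Qed.

Lemma kernd_mul n (f g : 'rV[R]_n -> R) : kernd f -> kernd g -> kernd (fun x => f x * g x).
Proof.
move=> kf kg; have [c [_ _ fc _]] := kernd_wide 0 kf.
by apply: (kerndMl (c := c)) => //; case: kf.
Qed.

Lemma measurable_tens_sub n (psi : 'I_n -> R -> R) : (forall i, kern (psi i)) ->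
  measurable_fun [set: 'rV[R]_n * 'rV[R]_n] (fun w => tens psi (w.1 - w.2)).
Proof.
move=> kp; rewrite (_ : (fun w => _) = fun w : 'rV[R]_n * 'rV[R]_n =>
    \prod_i psi i (w.1 0 i - w.2 0 i)); last first.
  by apply/funext => w; apply: eq_bigr => i _; rewrite !mxE.
apply: measurable_prod => i _.
apply: (measurableT_comp (f := psi i)); first by case: (kp i).
apply: measurable_funB.
  exact: (measurableT_comp (@measurable_coordR R n i) measurable_fst).
exact: (measurableT_comp (@measurable_coordR R n i) measurable_snd).
Qed.

Section convolution.
Variables (n : nat) (h : 'rV[R]_n -> R) (psi : 'I_n -> R -> R).
Hypotheses (kh : kernd h) (kpsi : forall i, kern (psi i)).

Definition tconv (y : 'rV[R]_n) : R := integd (fun z => h z * tens psi (y - z)).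

Lemma kernd_tconv : kernd tconv.
Proof.
have [c [c0 _ hc h0]] := kernd_wide 0 kh.
have [b [b0 _ pb p0]] := kernd_wide 0 (kernd_tens kpsi).
pose F (w : 'rV[R]_n * 'rV[R]_n) := h w.2 * tens psi (w.1 - w.2).
have mF : measurable_fun setT F.
  apply: measurable_funM; last exact: measurable_tens_sub.
  by apply: measurableT_comp => //; case: kh.
have FB w : `|F w| <= c * b by rewrite normrM ler_pM.
have F0 w : ~ (boxd (b + c) w.1 /\ boxd c w.2) -> F w = 0.
  move=> hw; rewrite /F; have [h2|h2] := pselect (boxd c w.2); last by rewrite h0 ?mul0r.
  rewrite p0 ?mulr0// => h1; apply: hw; split=> // i.
  have := h1 i; have := h2 i; rewrite !mxE => a1 a2.
  rewrite -[w.1 0 i](subrK (w.2 0 i)); apply: le_trans (ler_normD _ _) _.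
  exact: lerD.
have mb c' : measurable (boxd c' : set 'rV[R]_n) by exact: measurable_boxd.
have ob c' : (lebesgue_rV R n (boxd c') < +oo)%E by exact: boxd_fin.
apply: (@kernd_intro _ _ _ (c * b * fine (lebesgue_rV R n (boxd c))) (b + c)).
- exact: (measurable_Rintegral1 (mb _) (mb _) (ob _) (ob _) mF FB F0).
- move=> y; apply: le_Rintegral_bound => //.
  + exact: ob.
  + by have [] := kernd_mul kh (kernd_tens_reflect y kpsi).
  + by move=> z; exact: (FB (y, z)).
  + by move=> z hz; apply: (F0 (y, z)) => -[].
- move=> y hy; rewrite /tconv (_ : (fun z => _) = fun _ => 0) ?integd0//.
  by apply/funext => z; apply: (F0 (y, z)) => -[].
Qed.

Lemma tconv_swap (phi : 'rV[R]_n -> R) : kernd phi ->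
  integd (fun y => tconv y * phi y) =
  integd (fun z => h z * integd (fun y => tens psi (y - z) * phi y)).
Proof.
move=> kphi.
have [c [c0 _ hc h0]] := kernd_wide 0 kh.
have [b [b0 _ pb p0]] := kernd_wide 0 (kernd_tens kpsi).
have [a [a0 _ fa f0]] := kernd_wide 0 kphi.
pose F (w : 'rV[R]_n * 'rV[R]_n) := phi w.1 * (h w.2 * tens psi (w.1 - w.2)).
have mF : measurable_fun setT F.
  apply: measurable_funM; first by apply: measurableT_comp => //; case: kphi.
  apply: measurable_funM; last exact: measurable_tens_sub.
  by apply: measurableT_comp => //; case: kh.
have FB w : `|F w| <= a * (c * b) by rewrite !normrM ler_pM// ?mulr_ge0// ler_pM.
have F0 w : ~ (boxd a w.1 /\ boxd c w.2) -> F w = 0.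
  move=> hw; rewrite /F; have [h2|h2] := pselect (boxd c w.2); last by rewrite h0 ?mul0r ?mulr0.
  by rewrite f0 ?mul0r// => h1; apply: hw.
have mb c' : measurable (boxd c' : set 'rV[R]_n) by exact: measurable_boxd.
have ob c' : (lebesgue_rV R n (boxd c') < +oo)%E by exact: boxd_fin.
have := Rintegral_fubini (mb a) (mb c) (ob a) (ob c) mF FB F0.
have ktr y : kernd (fun z => h z * tens psi (y - z)).
  by apply: kernd_mul => //; exact: kernd_tens_reflect.
have -> : Rintegral (lebesgue_rV R n) setT
    (fun y => Rintegral (lebesgue_rV R n) setT (fun z => F (y, z))) =
    integd (fun y => tconv y * phi y).
  congr integd; apply/funext => y.
  by rewrite [RHS]mulrC -integdZ.
move=> ->; congr integd; apply/funext => z.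
rewrite -integdZ.
  by congr integd; apply/funext => y; rewrite /F /=; ring.
apply: kernd_mul => //; rewrite tens_translateR; apply: kernd_tens => i.
exact: kern_translate.
Qed.

(** The kernel has total mass 1, so the difference averages [h x - h z] over points within [rho];
    [c ^+ n] bounds the L_1 norm of the tensor product. *)
Lemma approx_identity (rho eps c : R) (x : 'rV[R]_n) : 0 <= eps ->
  (forall i, bsupp rho (psi i)) -> (forall i, integ (psi i) = 1) ->
  (forall i, integ (fun u => `|psi i u|) <= c) ->
  (forall y : 'rV[R]_n, (forall i, `|x 0 i - y 0 i| <= rho) -> `|h x - h y| <= eps) ->
  `|h x - tconv x| <= eps * c ^+ n.
Proof.
move=> eps0 ps p1 pc hx.
have kt := kernd_tens_reflect x kpsi.
have khx := kernd_mul kh kt.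
have -> : h x - tconv x = integd (fun z => (h x - h z) * tens psi (x - z)).
  have {1}-> : h x = integd (fun z => h x * tens psi (x - z)).
    by rewrite integdZ// integd_tens_reflect// big1 ?mulr1.
  rewrite -integdB//; last exact: kerndZ.
  by congr integd; apply/funext => z; rewrite mulrBl.
have k1 : kernd (fun z => (h x - h z) * tens psi (x - z)).
  rewrite (_ : (fun z => _) = (fun z => h x * tens psi (x - z)) \- (fun z => h z * tens psi (x - z))).
    by apply: kerndB => //; exact: kerndZ.
  by apply/funext => z; rewrite mulrBl.
have kn i : kern (fun u => `|psi i u|) by exact: kern_norm.
apply: le_trans (le_norm_integd k1) _.
apply: (@le_trans _ _ (integd (fun z => eps * tens (fun i u => `|psi i u|) (x - z)))).
  apply: le_integd; [exact: kernd_norm|by apply: kerndZ; exact: kernd_tens_reflect|].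
  move=> z; rewrite normrM tens_norm.
  have [e|ne] := eqVneq (tens psi (x - z)) 0; first by rewrite -tens_norm e normr0 !mulr0.
  rewrite ler_wpM2r//; first by rewrite -tens_norm.
  apply: hx => i; rewrite leNgt; apply/negP => hi.
  move/eqP: ne; apply; rewrite /tens (bigD1 i)//= ps ?mul0r// !mxE//.
rewrite integdZ; last exact: kernd_tens_reflect.
rewrite integd_tens_reflect//; apply: ler_wpM2l => //.
rewrite -[n in c ^+ n]card_ord -prodr_const; apply: ler_prod => i _; rewrite pc andbT.
rewrite -(_ : integ (fun _ => 0) = 0 :> R); first by apply: le_integ => //; exact: kern0.
by rewrite /integ Rintegral_cst// mul0r.
Qed.
End convolution.

End Rd_measure.

(** * The continued Kronecker set and its lattice sums *)

Section lattice_points.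
Variables (R : realType) (k n N : nat) (alpha : 'rV[R]_k).
Hypothesis N0 : (0 < N)%N.

(* The Kronecker set, extended to a neighbourhood of the unit cube: integer translates
   in the last [k] coordinates, and the sequence continued to other values of [i] in the
   first one. *)
Definition lattice_point (q : 'I_(lat_b n * N) * {ffun 'I_k -> 'I_(lat_b n)}) : 'rV[R]_k.+1 :=
  rV_cons (q.1%:R / N%:R - (lat_a n)%:R,
    \row_j (Defs.frac ((q.1%:R - (lat_a n * N)%N%:R) * alpha 0 j) + (q.2 j)%:R - (lat_a n)%:R)).

Lemma rV_subE p (x y : 'rV[R]_p) i : (x - y) 0 i = x 0 i - y 0 i.
Proof. by rewrite !mxE. Qed.

Lemma lattice_point0 q : lattice_point q 0 ord0 = q.1%:R / N%:R - (lat_a n)%:R.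
Proof. by rewrite /lattice_point rV_cons0. Qed.

Lemma lattice_pointS q j : lattice_point q 0 (lift ord0 j) =
  Defs.frac ((q.1%:R - (lat_a n * N)%N%:R) * alpha 0 j) + (q.2 j)%:R - (lat_a n)%:R.
Proof. by rewrite /lattice_point rV_consS mxE. Qed.

Lemma lattice_window_left (n' t y : R) : t < 1 -> -1 <= y -> t - (n' + 1 + 1) - y < - n'.
Proof. lra. Qed.

Lemma lattice_window_right (n' t y : R) : 0 <= t -> y <= 2 ->
  n' < t - (n' + 1 + 1) - y + (n' + 1 + 1 + (n' + 1 + 1 + 1)).
Proof. lra. Qed.

(** For fixed [i] the sum over the integer translates factors over the coordinates, and each factor
    is a full periodization since the window of translates covers the support whenever
    [-1 <= y 0 i <= 2]. *)
Lemma sum_lattice_tens (eta : nat -> R -> R) (m : 'I_k.+1 -> nat) (y : 'rV[R]_k.+1) :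
  (forall j, bsupp n%:R (eta j)) -> (forall i, -1 <= y 0 i <= 2) ->
  N%:R^-1 * \sum_q tens (fun i => eta (m i)) (lattice_point q - y) =
  lat_sum eta n alpha N (m ord0) (fun j => m (lift ord0 j)) (y 0 ord0)
    (fun j => y 0 (lift ord0 j)).
Proof.
move=> e0 hy; rewrite /lat_sum; congr (_ * _).
rewrite -(pair_bigA _ (fun i l => tens (fun i => eta (m i)) (lattice_point (i, l) - y))) /=.
apply: eq_bigr => i _.
transitivity (\sum_(l : {ffun 'I_k -> 'I_(lat_b n)}) lat_weight eta n N (m ord0) (y 0 ord0) i *
   \prod_j eta (m (lift ord0 j)) (Defs.frac ((i%:R - (lat_a n * N)%N%:R) * alpha 0 j) - (lat_a n)%:R
      - y 0 (lift ord0 j) + (l j)%:R)).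
  apply: eq_bigr => l _; rewrite /tens big_ord_recl; congr (_ * _).
    by rewrite rV_subE lattice_point0.
  apply: eq_bigr => j _; congr (eta _ _).
  by rewrite rV_subE lattice_pointS; ring.
rewrite -mulr_sumr; congr (_ * _).
rewrite -(bigA_distr_bigA (fun j (l : 'I_(lat_b n)) => eta (m (lift ord0 j))
   (Defs.frac ((i%:R - (lat_a n * N)%N%:R) * alpha 0 j) - (lat_a n)%:R - y 0 (lift ord0 j) + l%:R))).
apply: eq_bigr => j _.
set t := (i%:R - _) * alpha 0 j; set yj := y 0 _.
have /andP[t0 t1] := frac_itv t.
have /andP[y1 y2] := hy (lift ord0 j).
rewrite -(@per_eq R n (eta (m (lift ord0 j))) _ (Defs.frac t - (lat_a n)%:R - yj) (lat_b n)
   (- Num.floor t - Posz (lat_a n))) //.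
- by rewrite /lat_arg /Defs.frac -/t -/yj !intrB mulrNz -!pmulrn; ring.
- by rewrite /lat_a -!natr1; exact: lattice_window_left.
- by rewrite /lat_b natrD /lat_a -!natr1; exact: lattice_window_right.
Qed.

(** In the half-open cube there remain only the indices from [lat_a * N] up to, but not including,
    [(lat_a + 1) * N], and the one translate that is [lat_a] in every coordinate; these points are
    the Kronecker set. *)
Lemma sum_lattice_kronecker (h : 'rV[R]_k.+1 -> R) :
  (forall (x : 'rV[R]_k.+1) (i : 'I_k.+1), ~~ (0 <= x 0 i < 1) -> h x = 0) ->
  \sum_q h (lattice_point q) = \sum_(i < N) h (kronecker_points alpha i).
Proof.
move=> h0.
have NR0 : 0 < N%:R :> R by rewrite ltr0n.
pose P (i : nat) (l : {ffun 'I_k -> 'I_(lat_b n)}) : 'rV[R]_k.+1 :=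
  rV_cons (i%:R / N%:R - (lat_a n)%:R,
    \row_j (Defs.frac ((i%:R - (lat_a n * N)%N%:R) * alpha 0 j) + (l j)%:R - (lat_a n)%:R)).
rewrite -(pair_bigA _ (fun i l => h (lattice_point (i, l)))) /=.
have P0 i l : P i l 0 ord0 = i%:R / N%:R - (lat_a n)%:R.
  by rewrite /P rV_cons0.
have PS i l j : P i l 0 (lift ord0 j) =
  Defs.frac ((i%:R - (lat_a n * N)%N%:R) * alpha 0 j) + (l j)%:R - (lat_a n)%:R.
  by rewrite /P rV_consS mxE.
rewrite -(big_mkord xpredT (fun i => \sum_l h (P i l))).
have ab : (lat_a n < lat_b n)%N by rewrite /lat_a /lat_b addnS ltnS leq_addr.
have c1 : (lat_a n * N <= (lat_a n).+1 * N)%N by rewrite leq_mul2r leqnSn orbT.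
have c2 : ((lat_a n).+1 * N <= lat_b n * N)%N by rewrite leq_mul2r ab orbT.
rewrite (@big_cat_nat _ _ _ (lat_a n * N))//=; last exact: leq_trans c1 c2.
rewrite [X in X + _]big1_seq ?add0r; last first.
  move=> i /andP[_]; rewrite mem_index_iota => /andP[_ iN]; apply: big1 => l _.
  apply: (h0 _ ord0); rewrite P0 negb_and -ltNge subr_lt0 ltr_pdivrMr//.
  by rewrite -natrM ltr_nat iN.
rewrite (@big_cat_nat _ _ _ ((lat_a n).+1 * N))//=.
rewrite [X in _ + X]big1_seq ?addr0; last first.
  move=> i /andP[_]; rewrite mem_index_iota => /andP[iN _]; apply: big1 => l _.
  apply: (h0 _ ord0); rewrite P0 negb_and -!leNgt [1 <= _]lerBrDr nat1r ler_pdivlMr//.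
  by rewrite -natrM ler_nat iN orbT.
rewrite -{1}[(lat_a n * N)%N]add0n big_addn mulSn addnK big_mkord.
apply: eq_bigr => i _.
pose l0 : {ffun 'I_k -> 'I_(lat_b n)} := [ffun=> Ordinal ab].
rewrite (bigD1 l0)//= big1 ?addr0; last first.
  move=> l ll0.
  have [j jl] : exists j, l j != l0 j.
    apply/existsP; apply: contraNT ll0; rewrite negb_exists => /forallP hj.
    by apply/eqP/ffunP => j; apply/eqP; have := hj j; rewrite negbK.
  apply: (h0 _ (lift ord0 j)); rewrite PS.
  have /andP[t0 t1] := frac_itv (((i + lat_a n * N)%N%:R - (lat_a n * N)%N%:R) * alpha 0 j).
  set t := Defs.frac _ in t0 t1 *.
  have : (l j < lat_a n)%N || (lat_a n < l j)%N.
    by rewrite -neq_ltn; move: jl; rewrite ffunE -val_eqE.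
  rewrite negb_and -ltNge -leNgt => /orP[a|a]; apply/orP; [left|right].
    have : (l j).+1%:R <= (lat_a n)%:R :> R by rewrite ler_nat.
    by rewrite -natr1; move: ((l j)%:R : R) ((lat_a n)%:R : R) => u w; clear -t1; lra.
  have : (lat_a n).+1%:R <= (l j)%:R :> R by rewrite ler_nat.
  by rewrite -natr1; move: ((l j)%:R : R) ((lat_a n)%:R : R) => u w; clear -t0; lra.
congr h; rewrite /kronecker_points; congr rV_cons; congr pair.
  by rewrite natrD natrM mulrDl mulfK ?gt_eqF// addrK.
by apply/rowP => j; rewrite !mxE ffunE /= natrD !addrK.
Qed.

End lattice_points.

(** * The error as a sum over levels *)

Section telescoping.
Variables (R : realType) (d : nat) (h : 'rV[R]_d -> R).
Variables (kap P U : nat -> R -> R) (I : finType) (X : I -> 'rV[R]_d) (w : R).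
Hypotheses (kh : kernd h) (h0 : forall x : 'rV[R]_d, ~ (forall i, 0 <= x 0 i <= 1) -> h x = 0).
Hypotheses (kk : forall j, kern (kap j)) (kP : forall j, kern (P j)) (kU : forall j, kern (U j)).
Hypothesis P0 : forall j, bsupp 1 (P j).
Hypothesis repr : forall J x, \sum_(j < J.+1) convol (kap j) (P j) x = U J x.
Hypothesis U1 : forall j, integ (U j) = 1.

(** The indicator of [[-1, 2]^d], as a tensor product. It contains the support of every [Psi_m * h],
    as [h] lives in the unit cube and [Psi_m] in [[-1, 1]^d]. *)
Definition window (x : 'rV[R]_d) : R := tens (fun _ u => ball_ind (3 / 2) (u - 1 / 2)) x.

Lemma kernd_window : kernd window.
Proof. by apply: kernd_tens => i; apply: kern_translate; exact: kern_ball_ind. Qed.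

Lemma windowE (x : 'rV[R]_d) : window x = [forall i, (-1 <= x 0 i <= 2)]%:R.
Proof.
have E (u : R) : ball_ind (3 / 2) (u - 1 / 2) = (-1 <= u <= 2)%R%:R.
  rewrite /ball_ind ler_norml; congr (nat_of_bool _)%:R.
  by apply/andP/andP => -[a b]; split; lra.
rewrite /window /tens; under eq_bigr do rewrite E.
case: (boolP [forall i, _]) => [/forallP a|].
  by rewrite big1// => i _; rewrite a.
by rewrite negb_forall => /existsP[i /negbTE a]; rewrite (bigD1 i)//= a mul0r.
Qed.

Lemma window_sq (x : 'rV[R]_d) : window x * window x = window x.
Proof. by rewrite windowE; case: [forall _, _]; rewrite ?mulr1 ?mulr0. Qed.

Lemma window_bound (x : 'rV[R]_d) : 0 <= window x <= 1.
Proof. by rewrite windowE ler0n lern1; case: [forall _, _]. Qed.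

Lemma tens_outside (m : 'I_d -> nat) (y z : 'rV[R]_d) : (forall i, 0 <= z 0 i <= 1) ->
  ~~ [forall i, -1 <= y 0 i <= 2] -> tens (fun i => P (m i)) (y - z) = 0.
Proof.
move=> zc; rewrite negb_forall => /existsP[i hi].
rewrite /tens (bigD1 i)//= P0 ?mul0r// rV_subE.
have /andP[z0 z1] := zc i; move: hi; rewrite negb_and -!ltNge ltr_normr.
move: (y 0 i) (z 0 i) z0 z1 => u v z0 z1 /orP[hi|hi]; apply/orP; [right|left]; lra.
Qed.

Section level.
Variable m : 'I_d -> nat.

Definition level_const : R := \prod_i integ (kap (m i)).

(** The function [e_m] of the overview. The window gives the constant term compact support, which is
    harmless because it is only integrated against functions supported there. *)
Definition level_error (y : 'rV[R]_d) : R :=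
  level_const * window y - w * \sum_q tens (fun i => kap (m i)) (X q - y).

Lemma kernd_level_error : kernd level_error.
Proof.
apply: (@kerndB R d (fun y => level_const * window y)
  (fun y => w * \sum_q tens (fun i => kap (m i)) (X q - y))).
  by apply: kerndZ; exact: kernd_window.
by apply: kerndZ; apply: kernd_sum => q; exact: kernd_tens_reflect.
Qed.

Lemma tconv_window (y : 'rV[R]_d) : tconv h (fun i => P (m i)) y * window y =
  tconv h (fun i => P (m i)) y.
Proof.
rewrite windowE; case: (boolP [forall i, _]) => [_|hy]; first by rewrite mulr1.
rewrite mulr0 /tconv (_ : (fun z => _) = fun _ => 0) ?integd0//; apply/funext => z.
have [zc|zc] := pselect (forall i, 0 <= z 0 i <= 1); last by rewrite h0 ?mul0r.
by rewrite tens_outside// mulr0.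
Qed.

(** By Fubini the kernels of a level meet their [P] and convolve with it, coordinate by
    coordinate. *)
Lemma level_integral :
  integd (fun y => tconv h (fun i => P (m i)) y * level_error y) =
  integd (fun z => h z * (\prod_i (integ (kap (m i)) * integ (P (m i))) -
     w * \sum_q \prod_i convol (kap (m i)) (P (m i)) (X q 0 i - z 0 i))).
Proof.
have kpm i : kern (P (m i)) by [].
rewrite tconv_swap//; last exact: kernd_level_error.
congr integd; apply/funext => z.
have [zc|zc] := pselect (forall i, 0 <= z 0 i <= 1); last by rewrite h0 ?mul0r.
congr (_ * _).
have kT : kernd (fun y => tens (fun i => P (m i)) (y - z)).
  by rewrite tens_translateR; apply: kernd_tens => i; exact: kern_translate.
have E : (fun y => tens (fun i => P (m i)) (y - z) * level_error y) =
   (fun y => level_const * tens (fun i => P (m i)) (y - z)) \-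
   (fun y => w * \sum_q tens (fun i => P (m i)) (y - z) * tens (fun i => kap (m i)) (X q - y)).
  apply/funext => y; rewrite /level_error mulrBr; congr (_ - _).
    rewrite windowE; case: (boolP [forall i, _]) => [_|hy]; first by rewrite mulr1 mulrC.
    by rewrite tens_outside// mul0r !mulr0.
  by rewrite mulrCA; congr (_ * _); exact: mulr_sumr.
have kq q : kernd (fun y => tens (fun i => P (m i)) (y - z) * tens (fun i => kap (m i)) (X q - y)).
  by apply: kernd_mul => //; exact: kernd_tens_reflect.
rewrite E integdB; last 2 first.
  exact: kerndZ.
  by apply: kerndZ; exact: kernd_sum.
rewrite !integdZ//; last exact: kernd_sum.
rewrite integd_sum//; congr (_ - w * _).
  rewrite big_split /=; congr (_ * _).
  rewrite tens_translateR integd_tens; last by move=> i; exact: kern_translate.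
  by apply: eq_bigr => i _; rewrite integ_shift.
apply: eq_bigr => q _.
pose phi i u := P (m i) (u - z 0 i) * kap (m i) (X q 0 i - u).
have kphi i : kern (phi i).
  by apply: (@kernM R (fun u => P (m i) (u - z 0 i)) (fun u => kap (m i) (X q 0 i - u)));
    [exact: kern_translate|exact: kern_reflect].
have -> : (fun y => tens (fun i => P (m i)) (y - z) * tens (fun i => kap (m i)) (X q - y)) = tens phi.
  apply/funext => y; rewrite /tens -big_split /=; apply: eq_bigr => i _.
  by rewrite !rV_subE.
rewrite integd_tens//; apply: eq_bigr => i _.
rewrite /convol -[RHS](@integ_shift R (- z 0 i)); last exact: kern_convol_section.
congr integ; apply/funext => u; rewrite /phi mulrC; congr (kap _ _ * _).
ring.
Qed.

End level.

(** Summing over all multi-indices bounded by [J] factors over the coordinates, and each factor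
    collapses to [U J] by [repr]; the constant terms add up to 1 because [U J] has integral 1. *)
Lemma sum_levels J :
  \sum_(m : {ffun 'I_d -> 'I_J.+1})
    integd (fun y => tconv h (fun i => P (m i)) y * level_error (fun i => m i) y) =
  integd h - w * \sum_q tconv h (fun _ => U J) (X q).
Proof.
have E1 : \sum_(j < J.+1) integ (kap j) * integ (P j) = 1.
  rewrite -(U1 J) (_ : U J = fun x => \sum_(j < J.+1) convol (kap j) (P j) x).
    have [|_ ->] := @integ_sum R _ (index_enum 'I_J.+1) xpredT (fun j : 'I_J.+1 => convol (kap j) (P j)).
      by move=> j; exact: kern_convol.
    by apply: eq_bigr => j _; rewrite integ_convol.
  by apply/funext => x; rewrite repr.
pose A (m : {ffun 'I_d -> 'I_J.+1}) := \prod_i (integ (kap (m i)) * integ (P (m i))).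
pose T (m : {ffun 'I_d -> 'I_J.+1}) q (z : 'rV[R]_d) :=
  \prod_i convol (kap (m i)) (P (m i)) (X q 0 i - z 0 i).
have kT m q : kernd (T m q).
  rewrite (_ : T m q = fun z => tens (fun i => convol (kap (m i)) (P (m i))) (X q - z)).
    by apply: kernd_tens_reflect => i; exact: kern_convol.
  by apply/funext => z; apply: eq_bigr => i _; rewrite rV_subE.
have kG m : kernd (fun z => h z * (A m - w * \sum_q T m q z)).
  rewrite (_ : (fun z => _) = (fun z => A m * h z) \- (fun z => h z * (w * \sum_q T m q z))).
    apply: kerndB; first exact: kerndZ.
    by apply: kernd_mul => //; apply: kerndZ; exact: kernd_sum.
  by apply/funext => z /=; ring.
under eq_bigr do rewrite level_integral.
rewrite -(@integd_sum R d _ (index_enum _) (fun m z => h z * (A m - w * \sum_q T m q z)))//.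
have -> : (fun z => \sum_m h z * (A m - w * \sum_q T m q z)) =
    h \- (fun z => w * \sum_q h z * tens (fun _ => U J) (X q - z)).
  apply/funext => z; rewrite -mulr_sumr sumrB -mulr_sumr exchange_big /=.
  have -> : \sum_m A m = 1.
    rewrite /A -(bigA_distr_bigA (fun i (j : 'I_J.+1) => integ (kap j) * integ (P j))).
    by rewrite big1.
  rewrite mulrBr mulr1 mulrCA; congr (_ - w * _); rewrite mulr_sumr.
  apply: eq_bigr => q _; congr (_ * _).
  rewrite /T -(bigA_distr_bigA (fun i (j : 'I_J.+1) => convol (kap j) (P j) (X q 0 i - z 0 i))).
  by apply: eq_bigr => i _; rewrite repr rV_subE.
have kq q : kernd (fun z => h z * tens (fun _ => U J) (X q - z)).
  by apply: kernd_mul => //; exact: kernd_tens_reflect.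
rewrite integdB//; last by apply: kerndZ; exact: kernd_sum.
by rewrite integdZ ?integd_sum//; exact: kernd_sum.
Qed.

Lemma quadrature_limit (c E : R) : 0 < c -> continuous h ->
  (forall j, bsupp (c * 2 ^- j) (U j)) -> (forall j, integ (fun u => `|U j u|) <= c) ->
  (forall J, `|\sum_(m : {ffun 'I_d -> 'I_J.+1})
    integd (fun y => tconv h (fun i => P (m i)) y * level_error (fun i => m i) y)| <= E) ->
  `|integd h - w * \sum_q h (X q)| <= E.
Proof.
move=> c0 ch Uc Ui hE; apply/ler_addgt0Pr => eps eps0.
have cd0 : 0 < c ^+ d by exact: exprn_gt0.
pose K := `|w| * #|I|%:R * c ^+ d + 1.
have K0 : 0 < K by rewrite ltr_wpDl// !mulr_ge0// ltW.
have e0 : 0 < eps / K by rewrite divr_gt0.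
have hq q : exists J0 : nat, forall J, (J0 <= J)%N ->
    `|h (X q) - tconv h (fun _ => U J) (X q)| <= eps / K * c ^+ d.
  have [|r r0 hr] := @rV_nbhs_box R d [set y | `|h (X q) - h y| < eps / K] (X q).
    by have /cvgr_dist_lt /(_ _ e0) := ch (X q).
  have [J0 hJ0] := dyadic_small c0 r0.
  exists J0 => J JJ; apply: (@approx_identity R d h (fun _ => U J) kh _ (c * 2 ^- J)) => //.
  - exact: ltW.
  - move=> y hy; apply: ltW; apply: hr => i; apply: le_lt_trans (hy i) _.
    apply: le_lt_trans hJ0; rewrite ler_pM2l// lef_pV2 ?posrE ?exprn_gt0//.
    by rewrite ler_weXn2l// ler1n.
have [J0 {}hq] := choice hq.
(* One level that is fine enough at all of the finitely many points. *)
pose J := (\sum_q J0 q)%N.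
have hJ q : `|h (X q) - tconv h (fun _ => U J) (X q)| <= eps / K * c ^+ d.
  by apply: hq; rewrite /J (bigD1 q)//= leq_addr.
have := hE J; rewrite sum_levels => h1.
have -> : integd h - w * \sum_q h (X q) = (integd h - w * \sum_q tconv h (fun _ => U J) (X q))
   - w * \sum_q (h (X q) - tconv h (fun _ => U J) (X q)) by rewrite sumrB; ring.
apply: le_trans (ler_normB _ _) _; apply: lerD => //.
rewrite normrM; apply: le_trans (ler_wpM2l (normr_ge0 _) (ler_norm_sum _ _ _)) _.
apply: le_trans (ler_wpM2l (normr_ge0 _) (ler_sum _ (fun q _ => hJ q))) _.
rewrite sumr_const -[(_ * _) *+ _]mulr_natl.
have -> : `|w| * (#|I|%:R * (eps / K * c ^+ d)) = eps * ((`|w| * #|I|%:R * c ^+ d) / K).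
  by field; rewrite gt_eqF.
by rewrite ler_piMr ?ltW// ltr_pdivrMr// mul1r /K ltrDl.
Qed.

End telescoping.

(** * Hoelder's inequality with a free parameter, and exponents *)

Section holder.
Variable R : realType.

Lemma one_powR (a : R) : 1 `^ a = 1 :> R.
Proof. by rewrite powR1. Qed.

Lemma powR_antitone (x y a : R) : 0 < x -> x <= y -> a <= 0 -> y `^ a <= x `^ a.
Proof.
move=> x0 xy a0.
have [b b0 ->] : exists2 b, 0 <= b & a = - b by exists (- a); rewrite ?oppr_ge0 ?opprK.
rewrite !powRN.
have y0 : 0 < y by apply: lt_le_trans xy.
rewrite lef_pV2 ?posrE ?powR_gt0//.
by apply: ge0_ler_powR; rewrite ?nnegrE// ltW.
Qed.

Lemma powRDpos (x a b : R) : 0 < x -> x `^ (a + b) = x `^ a * x `^ b.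
Proof. by move=> x0; rewrite powRD//; apply/implyP => _; rewrite gt_eqF. Qed.

(** If [x > a], the second term is [x (x / a)^(r - 1) >= x]. A suitable choice of [a] after
    integration replaces Hoelder's inequality, with no conjugate exponent and with [r = 1]
    included. *)
Lemma young_pointwise (a x r : R) : 0 < a -> 0 <= x -> 1 <= r ->
  x <= a + a `^ (1 - r) * x `^ r.
Proof.
move=> a0 x0 r1; have [xa|ax] := leP x a.
  by rewrite (le_trans xa)// lerDl mulr_ge0// powR_ge0.
have x1 : 0 < x by apply: lt_trans ax.
apply: (@le_trans _ _ (a `^ (1 - r) * x `^ r)); last by rewrite lerDr ltW.
have -> : a `^ (1 - r) * x `^ r = x * (a `^ (1 - r) * x `^ (r - 1)).
  have -> : x `^ r = x * x `^ (r - 1).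
    by rewrite -[X in X * _]powRr1// -powRDpos// addrC subrK.
  by ring.
apply: ler_peMr => //.
rewrite -[r - 1]opprB powRN ler_pdivlMr ?powR_gt0// mul1r.
by apply: powR_antitone => //; [exact: ltW|rewrite subr_le0].
Qed.

Lemma kernd_powR n (F : 'rV[R]_n -> R) (r : R) : kernd F -> 1 <= r ->
  kernd (fun x => `|F x| `^ r).
Proof.
move=> kF r1; have [c [c0 _ fc f0]] := kernd_wide 0 kF.
have r0 : 0 <= r by apply: le_trans r1.
apply: (@kernd_intro _ _ _ (c `^ r) c).
- apply: (measurableT_comp (f := fun x : R => x `^ r)); first exact: measurable_powR.
  by apply: measurableT_comp => //; case: kF.
- move=> x; rewrite ger0_norm ?powR_ge0//.
  by apply: ge0_ler_powR; rewrite ?nnegrE// ltW.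
- by move=> x /f0 ->; rewrite normr0 powR0// gt_eqF// (lt_le_trans ltr01).
Qed.

Lemma product_bound (x a c p e S : R) : x <= a + c * p -> 0 <= c -> 0 <= p -> 0 <= e ->
  e <= S -> x * e <= a * e + c * S * p.
Proof.
move=> h c0 p0 e0 eS; apply: le_trans (ler_wpM2r e0 h) _.
by rewrite mulrDl lerD2l mulrAC ler_wpM2r// ler_wpM2l.
Qed.

Lemma holder_bound n (F e : 'rV[R]_n -> R) (a r S E Q : R) : kernd F -> kernd e ->
  0 < a -> 1 <= r -> (forall x, `|e x| <= S) ->
  integd (fun x => `|e x|) <= E -> integd (fun x => `|F x| `^ r) <= Q ->
  `|integd (fun x => F x * e x)| <= a * E + a `^ (1 - r) * S * Q.
Proof.
move=> kF ke a0 r1 eS eE FQ.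
have S0 : 0 <= S by apply: le_trans (eS 0).
have kFe := kernd_mul kF ke; have kn := kernd_norm ke; have kp := kernd_powR kF r1.
apply: le_trans (le_norm_integd kFe) _.
apply: (@le_trans _ _ (integd ((fun x => a * `|e x|) \+ (fun x => a `^ (1 - r) * S * `|F x| `^ r)))).
  apply: le_integd; [exact: kernd_norm|by apply: kerndD; exact: kerndZ|].
  move=> x /=; rewrite normrM; have h := young_pointwise a0 (normr_ge0 (F x)) r1.
  exact: (product_bound h (powR_ge0 _ _) (powR_ge0 _ _) (normr_ge0 _) (eS x)).
rewrite integdD; [|exact: kerndZ|exact: kerndZ]; rewrite !integdZ//.
apply: lerD; first by rewrite ler_pM2l.
by rewrite ler_wpM2l// mulr_ge0// powR_ge0.
Qed.

Lemma geometric_sum d J (q : R) : 0 <= q -> q < 1 ->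
  \sum_(m : {ffun 'I_d -> 'I_J.+1}) q ^+ (\sum_i m i) <= (1 - q)^-1 ^+ d.
Proof.
move=> q0 q1.
under eq_bigr do rewrite -prodrXr.
rewrite -(bigA_distr_bigA (fun i (j : 'I_J.+1) => q ^+ j)) prodr_const card_ord.
have p0 : 0 < 1 - q by rewrite subr_gt0.
have s0 : 0 <= \sum_(j < J.+1) q ^+ j by apply: sumr_ge0 => j _; exact: exprn_ge0.
rewrite lerXn2r ?nnegrE ?invr_ge0 ?(ltW p0)//.
rewrite -[leRHS]mul1r ler_pdivlMr// mulrC -opprB mulNr -subrX1 opprB.
by rewrite lerBlDr lerDl exprn_ge0.
Qed.

(** As [X <= N], the spare factor [N ^ (- e2)] is at most [X ^ (- e2)], which is summable over the
    levels. *)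
Lemma small_level_arith (X N s e0 e2 delta : R) : 0 < X -> 1 <= N -> X <= N `^ (1 - e0) ->
  0 <= e0 -> 0 <= e2 -> 0 <= delta ->
  N `^ (- (s + e2)) <= N `^ (- (s - delta)) * X `^ (- e2).
Proof.
move=> X0 N1 XN e00 e20 d0.
have N0 : 0 < N by apply: lt_le_trans N1.
rewrite opprD powRDpos//; apply: ler_pM; rewrite ?powR_ge0//.
  by apply: ler_powR => //; rewrite lerN2 gerBl.
apply: powR_antitone => //; last by rewrite oppr_le0.
apply: le_trans XN _; rewrite -[leRHS]powRr1; last exact: ltW.
by apply: ler_powR => //; rewrite gerBl.
Qed.

(** Split off [X ^ (- e2)] for summability and use [X >= N^(1 - e0)] on the rest of the exponent,
    which is not positive since [e2 <= s - r^-1]. What remains is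
    [(1 - e0) (s - e2) >= s - delta]. *)
Lemma large_level_arith (X N s r e0 e2 delta : R) : 1 <= N -> N `^ (1 - e0) <= X ->
  0 <= e2 -> e2 <= s - r^-1 -> e2 + e0 * s <= delta -> 0 <= e0 ->
  X `^ (- s) * (X * N `^ (- (1 - e0))) `^ (r^-1) <= N `^ (- (s - delta)) * X `^ (- e2).
Proof.
move=> N1 ZX e20 e2s ed e00.
have N0 : 0 < N by apply: lt_le_trans N1.
have Z0 : 0 < N `^ (1 - e0) by rewrite powR_gt0.
have X0 : 0 < X by apply: lt_le_trans ZX.
set Z := N `^ (1 - e0) in ZX Z0.
have -> : N `^ (- (1 - e0)) = Z `^ (- 1) by rewrite /Z -powRrM mulrN1.
rewrite powRM ?powR_ge0 ?(ltW X0)//.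
rewrite -powRrM mulN1r mulrA -powRDpos//.
have -> : - s + r^-1 = - e2 + - (s - r^-1 - e2) by ring.
rewrite powRDpos// -mulrA [leRHS]mulrC; apply: ler_wpM2l; first exact: powR_ge0.
apply: (@le_trans _ _ (Z `^ (- (s - r^-1 - e2)) * Z `^ (- r^-1))).
  apply: ler_wpM2r; first exact: powR_ge0.
  by apply: powR_antitone => //; rewrite oppr_le0 subr_ge0.
rewrite -powRDpos// /Z -powRrM; apply: ler_powR => //.
move: (r^-1) e2s => t e2s; have := mulr_ge0 e00 e20; nra.
Qed.

End holder.

Lemma integ_box_window (R : realType) d : integd (@window R d) = 3 ^+ d.
Proof.
rewrite /window integd_tens; last by move=> i; apply: kern_translate; exact: kern_ball_ind.
rewrite -[d in RHS]card_ord -prodr_const; apply: eq_bigr => i _.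
by rewrite integ_shift ?integ_ball_ind; [field|apply: divr_ge0|exact: kern_ball_ind].
Qed.

(** * Sup and L_1 bounds for the error of one level *)

Section level_bounds.
Variables (R : realType) (k n N : nat) (alpha : 'rV[R]_k) (kap : nat -> R -> R).
Hypothesis N0 : (0 < N)%N.
Hypotheses (kk : forall j, kern (kap j)) (k0 : forall j, bsupp n%:R (kap j)).
Variable m : 'I_k.+1 -> nat.

Local Notation err := (level_error kap (@lattice_point R k n N alpha) N%:R^-1 m).

Definition windowed_error (y : 'rV[R]_k.+1) : R := err y * window y.

Lemma kernd_windowed_error : kernd windowed_error.
Proof. by apply: kernd_mul; [exact: kernd_level_error|exact: kernd_window]. Qed.

Lemma windowed_error_bound (S : R) :
  (forall (y0 : R) (y : 'I_k -> R), -1 <= y0 -> y0 <= 2 ->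
    `|integ (kap (m ord0)) * \prod_j integ (kap (m (lift ord0 j))) -
      lat_sum kap n alpha N (m ord0) (fun j => m (lift ord0 j)) y0 y| <= S) ->
  forall y, `|windowed_error y| <= S * window y.
Proof.
move=> hS y; rewrite /windowed_error windowE.
case: (boolP [forall i, _]) => [/forallP hy|_]; last by rewrite !mulr0 normr0.
rewrite !mulr1 /level_error windowE; have -> /= : [forall i, -1 <= y 0 i <= 2] by apply/forallP.
rewrite mulr1 /level_const big_ord_recl sum_lattice_tens//.
by have /andP[y1 y2] := hy ord0; exact: hS.
Qed.

(** The triangle inequality suffices: there are [lat_b ^ k.+1 * N] points, each of weight [1 / N],
    and every translated kernel has L_1 norm at most [D ^+ k.+1]. *)
Lemma integd_windowed_error (D : R) : (forall j, integ (fun u => `|kap j u|) <= D) ->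
  integd (fun y => `|windowed_error y|) <= (3 ^+ k.+1 + (lat_b n)%:R ^+ k.+1) * D ^+ k.+1.
Proof.
move=> hD.
have NR0 : 0 < N%:R :> R by rewrite ltr0n.
have D0 : 0 <= D.
  by apply: le_trans (normr_ge0 (integ (kap 0))) _; apply: le_trans (le_norm_integ (kk 0)) (hD 0%N).
have kn i : kern (fun u => `|kap (m i) u|) by exact: kern_norm.
pose T q (y : 'rV[R]_k.+1) := tens (fun i u => `|kap (m i) u|) (@lattice_point R k n N alpha q - y).
have kT q : kernd (T q) by exact: kernd_tens_reflect.
pose K := D ^+ k.+1.
have pD (f : 'I_k.+1 -> R) : (forall i, 0 <= f i <= D) -> \prod_i f i <= K.
  move=> hf; rewrite /K -[k.+1 in leRHS]card_ord -prodr_const.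
  by apply: ler_prod => i _; exact: hf.
have K0 : 0 <= K by exact: exprn_ge0.
apply: (@le_trans _ _ (integd ((fun y => K * window y) \+ (fun y => N%:R^-1 * \sum_q T q y)))).
  apply: le_integd.
  - by apply: kernd_norm; exact: kernd_windowed_error.
  - apply: kerndD; first by apply: kerndZ; exact: kernd_window.
    by apply: kerndZ; exact: kernd_sum.
  move=> y /=; have /andP[w0 w1] := window_bound y.
  rewrite normrM (ger0_norm w0) /level_error.
  apply: le_trans (ler_wpM2r w0 (ler_normB _ _)) _.
  rewrite mulrDl; apply: lerD.
    rewrite normrM (ger0_norm w0) -mulrA window_sq ler_wpM2r// normr_prod; apply: pD => i.
    by rewrite normr_ge0 /=; apply: le_trans (le_norm_integ (kk _)) (hD _).
  apply: le_trans (ler_piMr _ w1) _; first exact: normr_ge0.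
  rewrite normrM ger0_norm ?invr_ge0// ler_wpM2l ?invr_ge0//.
  apply: le_trans (ler_norm_sum _ _ _) _; apply: ler_sum => q _.
  by rewrite tens_norm.
rewrite integdD; last 2 first.
  by apply: kerndZ; exact: kernd_window.
  by apply: kerndZ; exact: kernd_sum.
rewrite !integdZ; [|exact: kernd_sum|exact: kernd_window].
rewrite integd_sum// integ_box_window mulrDl [K * _]mulrC lerD2l.
have hT q : integd (T q) <= K.
  rewrite integd_tens_reflect//; apply: pD => i; rewrite hD andbT.
  by apply: le_trans (normr_ge0 (integ (kap (m i)))) (le_norm_integ (kk _)).
rewrite mulrC ler_pdivrMr//.
apply: le_trans (ler_sum _ (fun q _ => hT q)) _.
rewrite sumr_const card_prod card_ffun !card_ord -[leLHS]mulr_natl natrM natrM natrX.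
rewrite /K; move: (D ^+ k.+1) => w.
by apply: eq_bound; rewrite exprS; ring.
Qed.

End level_bounds.

Lemma pow_level (R : realType) (e : R) (n : nat) : (2 `^ (- e)) ^+ n = (2 ^+ n) `^ (- e) :> R.
Proof. by rewrite -powR_mulrn ?powR_ge0// -powRrM mulrC powRrM powR_mulrn. Qed.

(** [a] solves [a^r = Y X^(- s r)], so that both terms of [holder_bound] have the same order. *)
Lemma large_level_balance (R : realType) (X Y s r : R) : 0 < X -> 0 < Y -> 1 <= r ->
  let a := X `^ (- s) * Y `^ (r^-1) in a `^ (1 - r) * Y * X `^ (- (s * r)) = a.
Proof.
move=> X0 Y0 r1 a.
have r0 : r != 0 by rewrite gt_eqF// (lt_le_trans ltr01).
have a0 : 0 < a by rewrite mulr_gt0 ?powR_gt0.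
have -> : a `^ (1 - r) * Y * X `^ (- (s * r)) = a `^ (1 - r) * (Y * X `^ (- (s * r))).
  by rewrite mulrA.
have -> : Y * X `^ (- (s * r)) = a `^ r.
  rewrite /a powRM ?powR_ge0// -!powRrM mulVf// powRr1 ?(ltW Y0)// mulNr mulrC.
  by rewrite [s * r]mulrC.
by rewrite -powRDpos// subrK powRr1// ltW.
Qed.

(** * The error estimate for one real function *)

Section core.
Variables (R : realType) (k : nat) (alpha : 'rV[R]_k) (Psi0 : R -> R) (L : nat).
Hypotheses (ht : approximation_type alpha 1).
Hypotheses (sm : smooth1 Psi0) (b0 : bsupp 1 Psi0) (i0 : integ Psi0 = 1).
Variables (s r V delta : R).
Hypotheses (r1 : 1 <= r) (rs : r^-1 < s) (V0 : 0 <= V) (delta0 : 0 < delta).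

Lemma core_parameters : exists e0 e2 : R,
  [/\ 0 < e0 <= 1, 0 < e2, e2 <= s - r^-1 & e2 + e0 * s <= delta].
Proof.
have ri0 : 0 < r^-1 by rewrite invr_gt0 (lt_le_trans ltr01).
have s0 : 0 < s by apply: lt_trans rs.
have h1 : 0 < s - r^-1 by rewrite subr_gt0.
exists (Num.min 1 (delta / 2 / s)), (Num.min (s - r^-1) (delta / 2)); split.
- by rewrite lt_min ltr01 !divr_gt0//= ge_min lexx.
- by rewrite lt_min h1 divr_gt0.
- by rewrite ge_min lexx.
- have h2 : Num.min 1 (delta / 2 / s) * s <= delta / 2.
    by rewrite -ler_pdivlMr// ge_min lexx orbT.
  have h3 : Num.min (s - r^-1) (delta / 2) <= delta / 2 by rewrite ge_min lexx orbT.
  by rewrite [leRHS]splitr lerD.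
Qed.

Theorem core_estimate : exists2 C : R, 0 <= C & forall (N : nat) (h : 'rV[R]_k.+1 -> R), (0 < N)%N ->
  continuous h -> kernd h ->
  (forall x : 'rV[R]_k.+1, ~ (forall i, 0 <= x 0 i <= 1) -> h x = 0) ->
  (forall (x : 'rV[R]_k.+1) (i : 'I_k.+1), ~~ (0 <= x 0 i < 1) -> h x = 0) ->
  (forall m : 'I_k.+1 -> nat, integd (fun y => `|tconv h (fun i => Psi Psi0 L (m i)) y| `^ r) <=
     V * (2 ^+ (\sum_i m i)) `^ (- (s * r))) ->
  `|integd h - N%:R^-1 * \sum_(i < N) h (kronecker_points alpha i)| <= C * N%:R `^ (- (s - delta)).
Proof.
have [kap [U [c [[c0 kk kU U1] [kc Uc Ui kD repr]]]]] := reproducing_kernels L sm b0 i0.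
have [e0 [e2 [/andP[e00 e01] e20 e2s ed]]] := core_parameters.
have s0 : 0 < s by apply: lt_trans rs; rewrite invr_gt0 (lt_le_trans ltr01).
pose A := s + e2.
pose e3 := e0 / (4 * k.+1%:R) / 2.
have e30 : 0 < e3 by rewrite !divr_gt0// mulr_gt0// ltr0n.
have A0 : 0 <= A by rewrite /A addr_ge0// ltW.
have [M hM] := nat_scaled_bound (addr_ge0 (ler0n R (3 * k + 2)) A0) e30.
have [B hB] : exists B, forall j x, `|kap j x| <= B * 2 ^+ j.
  have [B hB] := kD 0%N; exists B => j x.
  by have := hB j [::] erefl x; rewrite /absprod big_nil mulr1 muln1.
have B0 : 0 <= B by have := le_trans (normr_ge0 _) (hB 0%N 0); rewrite expr0 mulr1.
have [B1 hB1] := kD M.+1.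
have [n0 hn0] := sup_error c0 kk kc hB ht e00 e01.
(* Large enough for the bump of [sup_error] and for the support radius [c] of the kernels. *)
pose n := (n0 + (Num.truncn c).+1)%N.
have cn : c <= n%:R.
  have /andP[_ h1] := truncn_itv (ltW c0).
  by apply: le_trans (ltW h1) _; rewrite ler_nat leq_addl.
have kn j : bsupp n%:R (kap j).
  move=> x nx; apply: kc; apply: le_lt_trans nx; apply: le_trans cn.
  by rewrite ler_piMr ?(ltW c0)// invf_le1 ?exprn_gt0// exprn_ege1// ler1n.
have [C2 C20 hC2] := hn0 n (leq_addr _ _).
have [C1 C10 hC1] := small_error kk kn hB hB1 ht e00 e01 hM.
pose D := 2 * c * B.
have hD j : integ (fun u => `|kap j u|) <= D by exact: (integ_norm_kap c0 kk kc hB).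
have D0 : 0 <= D by rewrite /D !mulr_ge0// ltW.
pose C3 := (3 ^+ k.+1 + (lat_b n)%:R ^+ k.+1) * D ^+ k.+1.
have C30 : 0 <= C3 by rewrite mulr_ge0 ?addr_ge0 ?exprn_ge0.
pose q : R := 2 `^ (- e2).
have q0 : 0 <= q by exact: powR_ge0.
have q1 : q < 1.
  rewrite /q powRN invf_lt1 ?powR_gt0// -[ltLHS](one_powR e2).
  by apply: gt0_ltr_powR; rewrite ?nnegrE// ltr1n.
pose C4 := C1 * 3 ^+ k.+1 + C1 * V + (C3 + 2 * C2 * V).
have C40 : 0 <= C4 by rewrite !addr_ge0// !mulr_ge0// exprn_ge0.
exists (C4 * (1 - q)^-1 ^+ k.+1).
  by rewrite mulr_ge0// exprn_ge0// invr_ge0 subr_ge0 ltW.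
move=> N h N0 ch kh h0 h0' hF.
have NR1 : 1 <= N%:R :> R by rewrite ler1n.
have NR0 : 0 < N%:R :> R by rewrite ltr0n.
pose X (q : 'I_(lat_b n * N) * {ffun 'I_k -> 'I_(lat_b n)}) := lattice_point alpha q.
have kP j := @kern_Psi R Psi0 L sm b0 j.
have P0 j := @bsupp_Psi R Psi0 L b0 j.
have level (m : 'I_k.+1 -> nat) :
    `|integd (fun y => tconv h (fun i => Psi Psi0 L (m i)) y * level_error kap X N%:R^-1 m y)| <=
    C4 * N%:R `^ (- (s - delta)) * q ^+ (\sum_i m i).
  have -> : (fun y => tconv h (fun i => Psi Psi0 L (m i)) y * level_error kap X N%:R^-1 m y) =
     (fun y => tconv h (fun i => Psi Psi0 L (m i)) y * windowed_error n N alpha kap m y).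
    by apply/funext => y; rewrite -[in LHS](tconv_window h0 P0) /windowed_error -mulrA [window _ * _]mulrC.
  set F := tconv h _.
  have kF : kernd F by apply: kernd_tconv => // i; exact: kP.
  have kE : kernd (windowed_error n N alpha kap m) by exact: kernd_windowed_error.
  set nm := (\sum_i m i)%N.
  have mE : (m ord0 + \sum_j m (lift ord0 j))%N = nm by rewrite /nm big_ord_recl.
  pose x : R := 2 ^+ nm.
  have x1 : 1 <= x by rewrite /x exprn_ege1// ler1n.
  have x0 : 0 < x by apply: lt_le_trans x1.
  have sr0 : 0 <= s * r by rewrite mulr_ge0// ltW// (lt_le_trans ltr01).
  rewrite /q pow_level -/x.
  have := hF m; rewrite -/F -/nm -/x => FQ.
  have [small|large] := leP x (N%:R `^ (1 - e0)).
    pose S := C1 * N%:R `^ (- A).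
    have S0 : 0 <= S by rewrite mulr_ge0 ?powR_ge0.
    have eS y : `|windowed_error n N alpha kap m y| <= S * window y.
      apply: windowed_error_bound => // y0 y' y0l y0r.
      by apply: hC1 => //; rewrite mE.
    have eS' y : `|windowed_error n N alpha kap m y| <= S.
      apply: le_trans (eS y) _; rewrite ler_piMr//; by have /andP[] := window_bound y.
    have eE : integd (fun y => `|windowed_error n N alpha kap m y|) <= S * 3 ^+ k.+1.
      rewrite -(integ_box_window R k.+1) -integdZ; last exact: kernd_window.
      by apply: le_integd => //; [exact: kernd_norm|apply: kerndZ; exact: kernd_window].
    have FQ' : integd (fun y => `|F y| `^ r) <= V.
      apply: le_trans FQ _; rewrite ler_piMr// -[leRHS](one_powR (- (s * r))).
      by apply: powR_antitone => //; rewrite oppr_le0.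
    (* On small levels [a = 1] is enough: sup norm and L_1 norm of the error are both of order
       [N ^ (- (s + e2))]. *)
    apply: le_trans (holder_bound kF kE ltr01 r1 eS' eE FQ') _.
    rewrite one_powR !mul1r -mulrDr.
    have h1 := @small_level_arith R x N%:R s e0 e2 delta x0 NR1 small (ltW e00) (ltW e20) (ltW delta0).
    have h2 : S <= C1 * (N%:R `^ (- (s - delta)) * x `^ (- e2)) by rewrite ler_wpM2l.
    apply: le_trans (ler_wpM2r _ h2) _; first by rewrite addr_ge0// exprn_ge0.
    rewrite -!mulrA mulrCA [leRHS]mulrCA; apply: ler_wpM2l; first exact: powR_ge0.
    rewrite mulrCA [leRHS]mulrC; apply: ler_wpM2l; first exact: powR_ge0.
    by rewrite mulrDr /C4 lerDl addr_ge0// !mulr_ge0.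
  pose Y := x * N%:R `^ (- (1 - e0)).
  have Y1 : 1 <= Y.
    by rewrite /Y powRN ler_pdivlMr ?powR_gt0// mul1r ltW.
  have Y0 : 0 < Y by apply: lt_le_trans Y1.
  pose S := 2 * C2 * Y.
  have eS' y : `|windowed_error n N alpha kap m y| <= S.
    apply: (@le_trans _ _ (S * window y)); last first.
      rewrite ler_piMr//; first by rewrite !mulr_ge0// ltW.
      by have /andP[] := window_bound y.
    apply: windowed_error_bound => // y0 y' y0l y0r.
    (* On large levels [Y >= 1], so [1 + Y <= 2 Y]. *)
    apply: le_trans (hC2 _ _ _ _ _ N0 y0l y0r) _; rewrite mE -/x -/Y /S.
    by rewrite [2 * C2]mulrC -mulrA ler_wpM2l// mulr_natl mulr2n lerD2r.
  have eE : integd (fun y => `|windowed_error n N alpha kap m y|) <= C3.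
    exact: integd_windowed_error.
  pose a := x `^ (- s) * Y `^ (r^-1).
  have a0 : 0 < a by rewrite mulr_gt0 ?powR_gt0.
  apply: le_trans (holder_bound kF kE a0 r1 eS' eE FQ) _.
  have -> : a * C3 + a `^ (1 - r) * S * (V * x `^ (- (s * r))) =
     a * C3 + 2 * C2 * V * (a `^ (1 - r) * Y * x `^ (- (s * r))) by rewrite /S; ring.
  rewrite (large_level_balance s x0 Y0 r1) -/a.
  have h1 := @large_level_arith R x N%:R s r e0 e2 delta NR1 (ltW large) (ltW e20) e2s ed (ltW e00).
  have -> : a * C3 + 2 * C2 * V * a = (C3 + 2 * C2 * V) * a by ring.
  rewrite -[leRHS]mulrA; apply: ler_pM => //.
  - by rewrite addr_ge0// !mulr_ge0.
  - exact: ltW.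
  - by rewrite /C4 lerDr addr_ge0// !mulr_ge0// exprn_ge0.
rewrite -(sum_lattice_kronecker n alpha N0 h0').
apply: (@quadrature_limit R k.+1 h kap (Psi Psi0 L) U _ X N%:R^-1 kh h0 kk kP kU P0 repr U1 c) => //.
move=> J; apply: le_trans (ler_norm_sum _ _ _) _.
apply: le_trans (ler_sum _ (fun (m : {ffun 'I_k.+1 -> 'I_J.+1}) _ => level (fun i => m i))) _.
rewrite -mulr_sumr mulrAC -!mulrA ler_wpM2l//.
by apply: ler_wpM2r; [exact: powR_ge0|exact: geometric_sum].
Qed.
End core.

(** * From distributions to continuous functions *)

Section tensor_test_functions.
Variables (R : realType) (n : nat).
Local Notation V := ('rV[R]_n).
Implicit Types phi : 'I_n -> R -> R.

Lemma tens_subE phi (x y : V) : tens phi (x - y) = tens (fun i u => phi i (x 0 i - u)) y.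
Proof. exact: (congr1 (fun f => f y) (tens_translate phi x)). Qed.

Lemma tens_shift phi (y : V) (i : 'I_n) (t : R) :
  tens phi (t *: delta_mx 0 i + y) =
  phi i (t + y 0 i) * \prod_(j | j != i) phi j (y 0 j).
Proof.
rewrite /tens (bigD1 i)//=; congr (_ * _).
  by rewrite !mxE !eqxx mulr1.
apply: eq_bigr => j ji; congr (phi j _).
by rewrite !mxE (negbTE ji) andbF mulr0 add0r.
Qed.

Lemma is_derive_tens phi (y : V) (i : 'I_n) : derivable (phi i) (y 0 i) 1 ->
  derivable (tens phi) y (delta_mx 0 i) /\
  'D_(delta_mx 0 i) (tens phi) y =
    tens (fun j => if j == i then derive1 (phi j) else phi j) y.
Proof.
move=> df.
pose C := \prod_(j | j != i) phi j (y 0 j).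
have E : (fun h : R => h^-1 *: ((tens phi \o shift y) (h *: delta_mx 0 i) - tens phi y)) =
  (fun h : R => C * (h^-1 *: ((phi i \o shift (y 0 i)) (h *: 1) - phi i (y 0 i)))).
  apply/funext => h /=; rewrite tens_shift.
  have -> : tens phi y = phi i (y 0 i) * C by rewrite /tens (bigD1 i).
  have -> : h%:A = h by exact: mulr1.
  rewrite -/C -mulrBl; set D := phi i _ - phi i _.
  by change (h^-1 * (D * C) = C * (h^-1 * D)); ring.
have lim1 : (fun h : R => C * (h^-1 *: ((phi i \o shift (y 0 i)) (h *: 1) - phi i (y 0 i)))) @ 0^' -->
    C * 'D_1 (phi i) (y 0 i).
  by apply: cvgMl_tmp; exact: df.
split; first by rewrite /derivable E; apply/cvg_ex; exists (C * 'D_1 (phi i) (y 0 i)).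
rewrite /derive E; have -> := cvg_lim _ lim1; last exact: norm_hausdorff.
rewrite /tens (bigD1 i)//= eqxx derive1E mulrC; congr (_ * _).
by apply: eq_bigr => j /negbTE ->.
Qed.

Lemma mpartial_tens phi (l : seq 'I_n) : (forall i, smooth1 (phi i)) ->
  mpartial l (tens phi) = tens (fun i => derive1n (count_mem i l) (phi i)).
Proof.
move=> sp; elim: l => [//|i l IH]; rewrite /mpartial /= -/(mpartial l (tens phi)) IH.
apply/funext => y.
have [_ ->] := @is_derive_tens (fun i => derive1n (count_mem i l) (phi i)) y i (sp i _ _).
congr (tens _ y); apply/funext => j; rewrite eq_sym.
by case: eqP => _; rewrite ?add1n ?add0n.
Qed.

Lemma continuous_tens phi : (forall i, continuous (phi i)) -> continuous (tens phi).
Proof.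
move=> cp; rewrite /tens.
elim: (index_enum _) => [|i s IH].
  by rewrite (_ : (fun _ => _) = fun _ => 1); [exact: cst_continuous|apply/funext => y; rewrite big_nil].
rewrite (_ : (fun _ => _) = fun y : V => phi i (y 0 i) * \prod_(j <- s) phi j (y 0 j)); last first.
  by apply/funext => y; rewrite big_cons.
move=> y; apply: continuousM; last exact: IH.
by apply: continuous_comp; [exact: coord_continuous|exact: cp].
Qed.

Lemma smooth_tens phi : (forall i, smooth1 (phi i)) -> smooth (tens phi).
Proof.
move=> sp l; rewrite mpartial_tens//; split.
  by apply: continuous_tens => i; exact: smooth1_continuous.
move=> i x; have [] := @is_derive_tens (fun i => derive1n (count_mem i l) (phi i)) x i (sp i _ _).
by [].
Qed.

Lemma mpartial0 (l : seq 'I_n) : mpartial l (fun _ : V => 0 : R) = fun _ => 0.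
Proof.
elim: l => [//|i l IH]; rewrite /mpartial /= -/(mpartial l _) IH.
by apply/funext => x; exact: derive_cst.
Qed.

Lemma smooth0 : smooth (fun _ : V => 0 : R).
Proof.
move=> l; rewrite mpartial0; split; first exact: cst_continuous.
by move=> i x; exact: derivable_cst.
Qed.

Definition cbox (x : V) (r : R) : set V := [set y | forall i, `|x 0 i - y 0 i| <= r].

Lemma cbox_compact x r : compact (cbox x r).
Proof.
have := @rV_compact R n (fun i => `[x 0 i - r, x 0 i + r]%classic)
  (fun i => @segment_compact R (x 0 i - r) (x 0 i + r)).
congr compact; apply/seteqP; split=> y h i.
  by have := h i; rewrite /= in_itv/= ler_distlC.
by have := h i; rewrite /= in_itv/= ler_distlC.
Qed.

Lemma cbox_closed x r : closed (cbox x r).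
Proof. by apply: compact_closed; [exact: norm_hausdorff|exact: cbox_compact]. Qed.

Lemma fsupport_cbox (f : V -> R[i]) x r : (forall y, ~ cbox x r y -> f y = 0) ->
  fsupport f `<=` cbox x r.
Proof.
move=> f0; have -> : cbox x r = closure (cbox x r) by apply/closure_id; exact: cbox_closed.
by apply: closureS => y /= h; apply: contrapT => /f0.
Qed.

Lemma test_tens phi (x : V) (r : R) : (forall i, smooth1 (phi i)) ->
  (forall i (u : R), r < `|x 0 i - u| -> phi i u = 0) ->
  test_function (fun y => (tens phi y)%:C) /\
  fsupport (fun y => (tens phi y)%:C) `<=` cbox x r.
Proof.
move=> sp p0.
have sub : fsupport (fun y => (tens phi y)%:C) `<=` cbox x r.
  apply: fsupport_cbox => y /existsNP[i /negP]; rewrite -ltNge => h.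
  by rewrite /tens (bigD1 i)//= p0// mul0r.
split=> //; split.
  by split; [exact: smooth_tens|exact: smooth0].
have cl : closed (fsupport (fun y => (tens phi y)%:C)) by exact: closed_closure.
exact: (subclosed_compact cl (@cbox_compact x r) sub).
Qed.

Lemma kernd_continuous (f b : V -> R) : continuous f -> kernd b -> kernd (fun x => f x * b x).
Proof.
move=> cf kb; have [c [c0 _ bc b0]] := kernd_wide 0 kb.
have [B hB] : exists B, forall x, boxd c x -> `|f x| <= B.
  have cp : compact (f @` cbox 0 c).
    by apply: continuous_compact; [exact: continuous_subspaceT|exact: cbox_compact].
  have [B [_ hB]] := compact_bounded cp.
  exists (B + 1) => x xc; apply: (hB (B + 1)); first by rewrite ltrDl.
  by exists x => // i; rewrite mxE sub0r normrN; exact: xc.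
apply: (@kernd_intro _ _ _ (`|B| * c) c).
- apply: measurable_funM; last by case: kb.
  exact: continuous_rV_measurable.
- move=> x; have [h|h] := pselect (boxd c x); last by rewrite b0// mulr0 normr0 mulr_ge0// ltW.
  by rewrite normrM ler_pM// (le_trans (hB x h))// ler_norm.
- by move=> x /b0 ->; rewrite mulr0.
Qed.

End tensor_test_functions.

Section up_function_facts.
Variables (R : realType) (Psi0 : R -> R).
Hypothesis up : up_function Psi0.

Lemma up_smooth1 : smooth1 Psi0. Proof. by case: up. Qed.

Lemma up_bsupp : bsupp 1 Psi0.
Proof.
move=> x x1; apply: contrapT => h; case: up => _ cl _.
have : closure [set x | Psi0 x <> 0] x by exact: subset_closure.
by rewrite cl /= in_itv/= -ler_norml leNgt x1.
Qed.

(** The integral is the Fourier transform at 0, where every factor [sinc] equals 1. *)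
Lemma up_integ : integ Psi0 = 1.
Proof.
case: up => _ _ /(_ 0); rewrite /fourier1 /cintegral.
have -> : cRe (fun y => (Psi0 y)%:C * expi (- (2 * pi * 0 * y))) = Psi0.
  apply/funext => y; rewrite /cRe mulr0 mul0r oppr0 /expi cos0 sin0 /=.
  by rewrite mulr1 mul0r subr0.
have -> : (fun k : nat => \prod_(0 <= j < k) sinc (2 ^- j * 0)) = (fun _ : nat => 1 : R).
  by apply/funext => k; apply: big1 => j _; rewrite mulr0 /sinc eqxx.
by rewrite lim_cst//; case.
Qed.

End up_function_facts.

Section regular_distributions.
Variables (R : realType) (n : nat).
Local Notation V := ('rV[R]_n).
Variables (T : (V -> R[i]) -> R[i]) (g : V -> R[i]).
Hypothesis gT : continuous_version T g.

Lemma version_tens (phi : 'I_n -> R -> R) (x : V) (r : R) : (forall i, smooth1 (phi i)) ->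
  (forall i (u : R), r < `|x 0 i - u| -> phi i u = 0) ->
  T (fun y => (tens phi y)%:C) =
  integd (fun z => cRe g z * tens phi z) +i* integd (fun z => cIm g z * tens phi z).
Proof.
move=> sp p0; have [_ ->] := gT; last exact: (test_tens sp p0).1.
rewrite /cintegral; congr (_ +i* _).
  congr (Rintegral _ _ _); apply/funext => z; rewrite /cRe; case: (g z) => a b /=.
  by rewrite mulr0 subr0.
congr (Rintegral _ _ _); apply/funext => z; rewrite /cIm; case: (g z) => a b /=.
by rewrite mulr0 add0r.
Qed.

Variables (Psi0 : R -> R).
Hypotheses (sm : smooth1 Psi0) (b0 : bsupp 1 Psi0) (i0 : integ Psi0 = 1).

Lemma dconvolution_tconv L (m : {ffun 'I_n -> nat}) (x : V) :
  dconvolution (mPsi Psi0 L m) T x =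
  tconv (cRe g) (fun i => Psi Psi0 L (m i)) x +i* tconv (cIm g) (fun i => Psi Psi0 L (m i)) x.
Proof.
rewrite /dconvolution.
have E : (fun y => mPsi Psi0 L m (x - y)) = tens (fun i u => Psi Psi0 L (m i) (x 0 i - u)).
  by apply/funext => y; apply: eq_bigr => i _; rewrite rV_subE.
have -> : (fun y => (mPsi Psi0 L m (x - y))%:C) =
   fun y => (tens (fun i u => Psi Psi0 L (m i) (x 0 i - u)) y)%:C.
  by rewrite -E.
rewrite (@version_tens _ x 1).
- by congr (_ +i* _); rewrite /tconv; congr integd; apply/funext => z;
    rewrite tens_subE.
- move=> i; have := @smooth1_affine R 1 (-1) (x 0 i) _ (@smooth_Psi R Psi0 L sm (m i)).
  congr smooth1; apply/funext => u; rewrite mul1r mulN1r addrC//.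
- by move=> i u; exact: bsupp_Psi.
Qed.

(** The dyadic dilations of [Psi0] are an approximate identity. Multiplying [f] by the indicator of
    the unit box around [x] gives compact support and changes neither [f x] nor the integrals, since
    these dilations live at distance at most [2 ^- J <= 1] from [x]. *)
Lemma vanish_of_test (f : V -> R) (x : V) (J0 : nat) : continuous f ->
  (forall J, (J0 <= J)%N -> integd (fun z => f z * tens (fun i u => dyadic Psi0 J (x 0 i - u)) z) = 0) ->
  f x = 0.
Proof.
move=> cf h0.
have kP : kern Psi0 := @smooth1_kern R _ _ 0 sm b0.
pose c := integ (fun u => `|Psi0 u|).
have c0 : 0 <= c.
  by apply: le_trans (normr_ge0 (integ Psi0)) (le_norm_integ kP).
have kb : kernd (fun z : V => tens (fun _ => ball_ind 1) (x - z)).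
  by apply: kernd_tens_reflect => i; exact: kern_ball_ind.
pose h z := f z * tens (fun _ => ball_ind 1) (x - z).
have kh : kernd h by exact: kernd_continuous.
have kd J : kern (dyadic Psi0 J) by exact: kern_dyadic.
have bx (z : V) : (forall i, `|x 0 i - z 0 i| <= 1) -> tens (fun _ => ball_ind (1 : R)) (x - z) = 1.
  by move=> hz; rewrite /tens big1// => i _; rewrite rV_subE /ball_ind hz.
have t0 J : (J0 <= J)%N -> tconv h (fun _ => dyadic Psi0 J) x = 0.
  move=> JJ; rewrite -[RHS](h0 J JJ); congr integd; apply/funext => z.
  rewrite /h -mulrA; congr (_ * _); rewrite -(@tens_subE _ _ (fun _ => dyadic Psi0 J)).
  have [hz|/existsNP[i /negP]] := pselect (forall i, `|x 0 i - z 0 i| <= 1).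
    by rewrite bx// mul1r.
  rewrite -ltNge => hi; rewrite [tens (fun _ => dyadic Psi0 J) _](_ : _ = 0) ?mulr0//.
  rewrite /tens (bigD1 i)//= rV_subE (dyadic_bsupp b0) ?mul0r//.
  by apply: le_lt_trans hi; rewrite mul1r invf_le1 ?exprn_gt0// exprn_ege1// ler1n.
have hx : h x = f x by rewrite /h bx ?mulr1// => i; rewrite subrr normr0.
apply/eqP; rewrite -normr_le0; apply/ler_addgt0Pr => eps eps0; rewrite add0r.
have cn : 0 < c ^+ n + 1 by rewrite ltr_wpDl ?exprn_ge0.
have e0 : 0 < eps / (c ^+ n + 1) by rewrite divr_gt0.
have [r r0 hr] : exists2 r : R, 0 < r & forall y : V, (forall i, `|x 0 i - y 0 i| < r) ->
    `|f x - f y| < eps / (c ^+ n + 1).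
  apply: (@rV_nbhs_box R n [set y | `|f x - f y| < eps / (c ^+ n + 1)] x).
  by have /cvgr_dist_lt /(_ _ e0) := cf x.
have m0 : 0 < Num.min r 1 by rewrite lt_min r0 ltr01.
have [J1] := dyadic_small ltr01 m0; rewrite mul1r => hJ1.
pose J := (J0 + J1)%N.
have J1J : 2 ^- J <= 2 ^- J1 :> R.
  by rewrite lef_pV2 ?posrE ?exprn_gt0// ler_weXn2l ?ler1n// leq_addl.
have hJ : 2 ^- J < Num.min r 1 by apply: le_lt_trans hJ1.
have := @approx_identity R n h (fun _ => dyadic Psi0 J) kh (fun _ => kd J) (1 * 2 ^- J)
  (eps / (c ^+ n + 1)) c x (ltW e0).
rewrite (t0 J (leq_addr _ _)) subr0 hx => /(_ _ _ _ _)/le_trans; apply.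
- by move=> i; exact: dyadic_bsupp.
- by move=> i; rewrite integ_dyadic.
- move=> i; rewrite (_ : (fun _ => _) = dyadic (fun y => `|Psi0 y|) J).
    by rewrite integ_dyadic//; exact: kern_norm.
  by apply/funext => u; rewrite /dyadic normrM gtr0_norm ?exprn_gt0.
- move=> y hy.
  have hy' i : `|x 0 i - y 0 i| < Num.min r 1 by apply: le_lt_trans hJ; rewrite -[leRHS]mul1r.
  have hy1 i : `|x 0 i - y 0 i| <= 1 by have := hy' i; rewrite lt_min => /andP[_ /ltW].
  rewrite /h bx// mulr1 -/h -{1}hx.
  have -> : h x = f x := hx.
  by apply: ltW; apply: hr => i; have := hy' i; rewrite lt_min => /andP[].
- rewrite mulrAC ler_pdivrMr// ler_wpM2l ?(ltW eps0)// lerDl//.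
Qed.

End regular_distributions.

Section vanishing.
Variables (R : realType) (n : nat) (Psi0 : R -> R).
Hypotheses (sm : smooth1 Psi0) (b0 : bsupp 1 Psi0) (i0 : integ Psi0 = 1).
Local Notation V := ('rV[R]_n).
Variables (T : (V -> R[i]) -> R[i]) (g : V -> R[i]).
Hypothesis gT : continuous_version T g.

Lemma support_vanish (x : V) : ~ dsupport T x -> cRe g x = 0 /\ cIm g x = 0.
Proof.
move=> /existsNP[U /not_implyP[oU /not_implyP[Ux hU]]].
have [e e0 he] := rV_nbhs_box (oU x Ux).
have [J0] := dyadic_small ltr01 e0; rewrite mul1r => hJ0.
pose phi J (i : 'I_n) u := dyadic Psi0 J (x 0 i - u).
have sp J i : smooth1 (phi J i).
  have := @smooth1_affine R (2 ^+ J) (- 2 ^+ J) (2 ^+ J * x 0 i) _ sm.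
  congr smooth1; apply/funext => u; rewrite /phi /dyadic; congr (_ * Psi0 _); ring.
have p0 J i (u : R) : 2 ^- J < `|x 0 i - u| -> phi J i u = 0.
  by move=> h; rewrite /phi (dyadic_bsupp b0)// mul1r.
have Z J : (J0 <= J)%N -> integd (fun z => cRe g z * tens (phi J) z) = 0 /\
    integd (fun z => cIm g z * tens (phi J) z) = 0.
  move=> JJ; have [tf sub] := test_tens (sp J) (p0 J).
  have : T (fun y => (tens (phi J) y)%:C) = 0.
    apply: contrapT => nz; apply: hU; exists (fun y => (tens (phi J) y)%:C); split=> //.
    move=> y /sub hy; apply: he => i; apply: le_lt_trans (hy i) _; apply: le_lt_trans hJ0.
    by rewrite lef_pV2 ?posrE ?exprn_gt0// ler_weXn2l// ler1n.
  by rewrite (version_tens gT (sp J) (p0 J)) => -[-> ->].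
have [[cr ci] _] := gT.
split.
  by apply: (vanish_of_test sm b0 i0 cr (J0 := J0)) => J /Z[].
by apply: (vanish_of_test sm b0 i0 ci (J0 := J0)) => J /Z[].
Qed.

(** On a face where a coordinate equals 1, [f] is a limit of its values just outside the cube. This
    supplies the half-open condition of [sum_lattice_kronecker]. *)
Lemma boundary_vanish (f : V -> R) : continuous f -> (forall x, ~ cube x -> f x = 0) ->
  forall (x : V) (i : 'I_n), ~~ (0 <= x 0 i < 1) -> f x = 0.
Proof.
move=> cf f0 x i hx.
have [xc|/f0//] := pselect (@cube R n x).
have x1 : 1 <= x 0 i.
  by have /andP[h1 h2] := xc i; move: hx; rewrite h1 /= -leNgt.
apply: contrapT => /eqP nz.
have p0 : 0 < `|f x| by rewrite normr_gt0.
have [e e0 he] : exists2 e : R, 0 < e & forall y : V, (forall j, `|x 0 j - y 0 j| < e) ->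
    `|f x - f y| < `|f x|.
  apply: (@rV_nbhs_box R n [set y | `|f x - f y| < `|f x|] x).
  by have /cvgr_dist_lt /(_ _ p0) := cf x.
pose y : V := x + (e / 2) *: delta_mx 0 i.
have yE j : y 0 j = x 0 j + e / 2 * (j == i)%:R by rewrite !mxE eqxx.
have e2 : 0 < e / 2 by rewrite divr_gt0.
have : `|f x - f y| < `|f x|.
  apply: he => j; rewrite yE opprD addrA subrr add0r normrN.
  case: (j == i); rewrite ?mulr1 ?mulr0 ?normr0// gtr0_norm//.
  by rewrite ltr_pdivrMr// ltr_pMr// ltr1n.
rewrite (f0 y) ?subr0 ?ltxx// => /(_ i); rewrite yE eqxx mulr1 => /andP[_].
by rewrite leNgt => /negP; apply; rewrite (le_lt_trans x1)// ltrDl.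
Qed.

End vanishing.

(** * From the Besov norm to bounds on each level *)

Section besov_levels.
Variables (R : realType) (n : nat).
Local Notation V := ('rV[R]_n).

Lemma poweR_le1 (x : \bar R) (t : R) : 0 < t -> (0 <= x)%E -> (poweR x t <= 1)%E -> (x <= 1)%E.
Proof.
move=> t0 x0 h; have E : x = poweR (poweR x t) t^-1.
  by rewrite -poweRrM mulfV ?gt_eqF// poweRe1.
apply: (@le_trans _ _ (poweR 1 t^-1)); last by rewrite poweR1r.
rewrite E; apply: gt0_ler_poweR => //.
- by rewrite invr_ge0 ltW.
- by rewrite in_itv/= poweR_ge0 leey.
- by rewrite in_itv/= lee01 leey.
Qed.

Lemma besov_level (Psi0 : R -> R) (L : nat) (s : R) (p theta : \bar R)
    (T : (V -> R[i]) -> R[i]) (m : {ffun 'I_n -> nat}) :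
  (1 <= theta)%E -> (besov_norm Psi0 L s p theta T <= 1)%E ->
  (Lp_norm p (dconvolution (mPsi Psi0 L m) T) <= (2 `^ (- (s * (norm1 m)%:R)))%:E)%E.
Proof.
move=> t1; rewrite powRN.
set l := Lp_norm p _; set w := 2 `^ _.
have w0 : 0 < w by rewrite powR_gt0.
have l0 : (0 <= l)%E by exact: Lnorm_ge0.
suff : (besov_norm Psi0 L s p theta T <= 1)%E -> (w%:E * l <= 1)%E.
  by move=> h /h; rewrite -lee_pdivlMl// mule1.
case: theta t1 => [t|_|//]; last first.
  by move=> h; apply: le_trans h; apply: ereal_sup_ubound; exists m.
rewrite lee_fin => t1 /=.
have t0 : 0 < t by apply: lt_le_trans t1.
set S := esum _ _ => h.
have S0 : (0 <= S)%E.
  by apply: esum_ge0 => i _; rewrite mule_ge0 ?poweR_ge0// lee_fin powR_ge0.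
have S1 : (S <= 1)%E.
  by apply: (@poweR_le1 S t^-1) => //; rewrite invr_gt0.
have W1 : ((2 `^ (s * (norm1 m)%:R * t))%:E * poweR l t <= 1)%E.
  apply: le_trans S1; apply: esum_ge; exists [set m]; first by split=> //; exact: finite_set1.
  by rewrite fsbig_set1.
have wl0 : (0 <= w%:E * l)%E by rewrite mule_ge0// lee_fin ltW.
have : (poweR (w%:E * l) t <= 1)%E.
  by rewrite poweRM// ?lee_fin ?(ltW w0)// poweR_EFin /w -powRrM.
exact: poweR_le1.
Qed.

(* For [p = +oo] one passes to a finite exponent [r] with [1 / r < s]; the support in
   the bounded window makes this possible. *)
Lemma lp_bound (p : \bar R) (s : R) : (1 <= p)%E -> (p^-1 < s%:E)%E ->
  exists r W : R, [/\ 1 <= r, r^-1 < s, 0 <= W &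
    forall (F : V -> R[i]) (u : V -> R) (w : R), measurable_fun setT (fun x => cabs (F x)) ->
      kernd u -> (forall x, `|u x| <= cabs (F x)) -> (forall x, window x = 0 -> u x = 0) ->
      0 <= w -> (Lp_norm p F <= w%:E)%E -> integd (fun x => `|u x| `^ r) <= W * w `^ r].
Proof.
have key (r : R) (u : V -> R) : 1 <= r -> kernd u ->
    ((integd (fun x => `|u x| `^ r))%:E = \int[lebesgue_rV R n]_x (`|u x| `^ r)%:E)%E.
  move=> r1 ku; rewrite /integd /Rintegral fineK//.
  by apply: integrable_fin_num => //; exact: kernd_integrable (kernd_powR ku r1).
case: p => [r|_|//].
  rewrite lee_fin => r1 rs; exists r, 1.
  have r0 : 0 < r by apply: lt_le_trans r1.
  split=> //; first by move: rs; rewrite inver gt_eqF// lte_fin.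
  move=> F u w mF ku uF _ w0; rewrite /Lp_norm unlock => hF.
  rewrite mul1r -lee_fin key//.
  set I := (\int[_]_x _)%E in hF.
  have I0 : (0 <= I)%E by apply: integral_ge0 => x _; exact: poweR_ge0.
  have I1 : (I <= (w `^ r)%:E)%E.
    rewrite -(poweRe1 I0) -(@mulVf _ r) ?gt_eqF// poweRrM -poweR_EFin.
    apply: gt0_ler_poweR => //; first exact: ltW.
      by rewrite in_itv/= poweR_ge0 leey.
    by rewrite in_itv/= lee_fin w0 leey.
  apply: le_trans I1; apply: ge0_le_integral => //.
  - by apply/measurable_EFinP; case: (kernd_powR ku r1).
  - rewrite (_ : (fun x => _) = EFin \o (fun x => (cabs (F x)) `^ r)).
      by apply/measurable_EFinP; exact: (measurableT_comp (measurable_powR r) mF).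
    by apply/funext => x /=; rewrite ger0_norm ?cabs_ge0.
  - move=> x _ /=; rewrite lee_fin (ger0_norm (cabs_ge0 _)).
    by apply: ge0_ler_powR; rewrite ?nnegrE ?cabs_ge0// ltW.
move=> s0; have {}s0 : 0 < s by move: s0; rewrite invey lte_fin.
(* [2 / s] makes [1 / r] at most [s / 2], and [3 ^+ n] is the volume of the window. *)
exists (Num.max 1 (2 / s)), (3 ^+ n).
set r := Num.max _ _.
have r1 : 1 <= r by rewrite le_max lexx.
have r0 : 0 < r by apply: lt_le_trans r1.
split=> //.
  rewrite invf_plt ?posrE//; apply: (@lt_le_trans _ _ (2 / s)).
    by rewrite -[ltLHS]mul1r ltr_pM2r ?invr_gt0// ltr1n.
  by rewrite le_max lexx orbT.
move=> F u w mF ku uF u0 w0; rewrite /Lp_norm unlock => hF.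
have aeF : {ae lebesgue_rV R n, forall x, setT x -> ((cabs (F x))%:E <= w%:E)%E}.
  (* The norm for [p = +oo] is defined by cases on whether the whole space has positive measure; if
     it has not, every property holds almost everywhere. *)
  move: hF; case: ifPn => [mu0 /ess_sup_inf.ess_supP|/negP mu0 _].
    by apply: filterS => x /=; rewrite ger0_norm ?cabs_ge0.
  exists setT; split=> //; apply/eqP; rewrite eq_le measure_ge0 andbT leNgt; exact/negP.
have kw : kernd (fun x : V => w `^ r * window x) by apply: kerndZ; exact: kernd_window.
rewrite mulrC -(integ_box_window R n) -integdZ; last exact: kernd_window.
rewrite -lee_fin key//.
have -> : ((integd (fun x : V => w `^ r * window x))%:E =
    \int[lebesgue_rV R n]_x (w `^ r * window x)%:E)%E.
  by rewrite /integd /Rintegral fineK//; apply: integrable_fin_num => //; exact: kernd_integrable kw.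
apply: ae_ge0_le_integral => //.
- by apply/measurable_EFinP; case: (kernd_powR ku r1).
- by move=> x _; rewrite lee_fin mulr_ge0 ?powR_ge0//; have /andP[] := window_bound x.
- by apply/measurable_EFinP; case: kw.
apply: filterS aeF => x /(_ I); rewrite !lee_fin => hx _.
have [wx|wx] := pselect (window x = 0).
  by rewrite (u0 _ wx) wx mulr0 normr0 powR0// gt_eqF.
have -> : window x = 1 by move: wx; rewrite windowE; case: [forall _, _].
rewrite mulr1; apply: ge0_ler_powR; rewrite ?nnegrE ?(ltW r0)//.
exact: le_trans (uF x) hx.
Qed.

End besov_levels.

Lemma Re_le_cabs (R : realType) (z : R[i]) : `|complex.Re z| <= cabs z.
Proof.
case: z => a b; rewrite /cabs /= -sqrtr_sqr ler_sqrt ?addr_ge0 ?sqr_ge0//.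
by rewrite lerDl sqr_ge0.
Qed.

Lemma Im_le_cabs (R : realType) (z : R[i]) : `|complex.Im z| <= cabs z.
Proof.
case: z => a b; rewrite /cabs /= -sqrtr_sqr ler_sqrt ?addr_ge0 ?sqr_ge0//.
by rewrite lerDr sqr_ge0.
Qed.

Lemma quadrature_error_le (R : realType) d N (x : 'I_N -> 'rV[R]_d) (g : 'rV[R]_d -> R[i]) :
  quadrature_error x g <=
  `|Rintegral (lebesgue_rV R d) (@cube R d) (cRe g) - N%:R^-1 * \sum_(n < N) cRe g (x n)| +
  `|Rintegral (lebesgue_rV R d) (@cube R d) (cIm g) - N%:R^-1 * \sum_(n < N) cIm g (x n)|.
Proof.
rewrite /quadrature_error; set z := (X in cabs X).
suff -> : z = (Rintegral (lebesgue_rV R d) (@cube R d) (cRe g) - N%:R^-1 * \sum_(n < N) cRe g (x n))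
  +i* (Rintegral (lebesgue_rV R d) (@cube R d) (cIm g) - N%:R^-1 * \sum_(n < N) cIm g (x n)).
  exact: cabs_le_sum.
have SE : \sum_(n < N) g (x n) = (\sum_(n < N) cRe g (x n)) +i* (\sum_(n < N) cIm g (x n)).
  elim: (index_enum _) => [|i r IH]; first by rewrite !big_nil.
  by rewrite !big_cons IH /cRe /cIm; case: (g (x i)).
have NE : N%:R^-1 = (N%:R^-1)%:C :> R[i] by rewrite fmorphV rmorph_nat.
rewrite /z SE NE /cintegral; move: (N%:R^-1) => w; move: (\sum_(n < N) _) => a.
move: (\sum_(n < N) _) => b; move: (Rintegral _ _ _) => u; move: (Rintegral _ _ _) => v.
by apply/eqP; rewrite eq_complex /= !mul0r subr0 addr0 !eqxx.
Qed.

Lemma level_weight (R : realType) (s r : R) (j : nat) :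
  (2 ^+ j) `^ (- (s * r)) = (2 `^ (- (s * j%:R))) `^ r :> R.
Proof.
rewrite -[RHS]powRrM -[X in X `^ _ = _]powR_mulrn ?ler0n// -[LHS]powRrM.
by congr (_ `^ _); ring.
Qed.

Lemma kernd_cube (R : realType) n (f : 'rV[R]_n -> R) : continuous f ->
  (forall x, ~ cube x -> f x = 0) -> kernd f.
Proof.
move=> cf f0; rewrite (_ : f = fun x => f x * window x).
  by apply: kernd_continuous => //; exact: kernd_window.
apply/funext => x; have [xc|xc] := pselect (cube x); last by rewrite f0// mul0r.
rewrite windowE; have -> : [forall i, -1 <= x 0 i <= 2]; last by rewrite mulr1.
apply/forallP => i; have /andP[h1 h2] := xc i; apply/andP; split.
  exact: le_trans (lerN10 _) h1.
by apply: le_trans h2 _; rewrite ler1n.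
Qed.

Lemma Rintegral_cube (R : realType) n (f : 'rV[R]_n -> R) :
  (forall x, ~ cube x -> f x = 0) -> Rintegral (lebesgue_rV R n) (@cube R n) f = integd f.
Proof.
move=> f0; rewrite /integd /Rintegral; congr fine.
rewrite integral_mkcond; apply: eq_integral => x _; rewrite patchE.
by case: ifPn => //; rewrite notin_setE => /f0 ->.
Qed.

(* The dimension is d = k.+1, so that alpha has d - 1 = k components. *)
Theorem theorem21 (R : realType) (k : nat) (hd : (3 <= k.+1)%N)
    (p theta : \bar R) (hp : (1 <= p)%E) (htheta : (1 <= theta)%E)
    (s : R) (hs : (p^-1 < s%:E)%E)
    (Psi0 : R -> R) (hPsi0 : up_function Psi0)
    (L : nat) (hL : s < L%:R + 1)
    (alpha : 'rV[R]_k) (halpha : forall j, irrational (alpha 0 j))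
    (htype : approximation_type alpha 1)
    (delta : R) (hdelta : 0 < delta) :
  exists C : R, forall N : nat, (0 < N)%N ->
    (wce Psi0 L (kronecker_points alpha (N := N)) s p theta
       <= (C / N%:R `^ (s - delta))%:E)%E.
Proof.
have sm := up_smooth1 hPsi0; have b0 := up_bsupp hPsi0; have i0 := up_integ hPsi0.
have [r [W [r1 rs W0 hW]]] := @lp_bound R k.+1 p s hp hs.
have [C C0 hC] := core_estimate L htype sm b0 i0 r1 rs W0 hdelta.
(* Real and imaginary parts of the continuous version are estimated separately, hence the factor
   2. *)
exists (2 * C) => N N0; apply: ge_ereal_sup => _ [T [g [[_ _ dT] hT gT ->]]].
rewrite lee_fin -mulrA -powRN.
have [[cr ci] _] := gT.
have gv x : ~ cube x -> cRe g x = 0 /\ cIm g x = 0.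
  by move=> xc; apply: (support_vanish sm b0 i0 gT) => /dT.
have vr x : ~ cube x -> cRe g x = 0 by move=> /gv[].
have vi x : ~ cube x -> cIm g x = 0 by move=> /gv[].
have kr := kernd_cube cr vr; have ki := kernd_cube ci vi.
have kP j := @kern_Psi R Psi0 L sm b0 j.
have P0 j := @bsupp_Psi R Psi0 L b0 j.
have cubeE (f : 'rV[R]_k.+1 -> R) : (forall x, ~ cube x -> f x = 0) ->
    forall x : 'rV[R]_k.+1, ~ (forall i, 0 <= x 0 i <= 1) -> f x = 0 by [].
have key (f : 'rV[R]_k.+1 -> R) (m : 'I_k.+1 -> nat) : kernd f -> (forall x, ~ cube x -> f x = 0) ->
    (forall (m' : {ffun 'I_k.+1 -> nat}) x, `|tconv f (fun i => Psi Psi0 L (m' i)) x| <=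
       cabs (dconvolution (mPsi Psi0 L m') T x)) ->
    integd (fun y => `|tconv f (fun i => Psi Psi0 L (m i)) y| `^ r) <=
     W * (2 ^+ (\sum_i m i)) `^ (- (s * r)).
  move=> kf f0 hle; pose m' : {ffun 'I_k.+1 -> nat} := [ffun i => m i].
  have mE : (fun i => Psi Psi0 L (m i)) = (fun i => Psi Psi0 L (m' i)).
    by apply/funext => i; rewrite ffunE.
  have nE : (\sum_i m i)%N = norm1 m' by apply: eq_bigr => i _; rewrite ffunE.
  rewrite mE nE.
  rewrite level_weight.
  have lvl := besov_level m' htheta hT.
  apply: (hW _ _ _ _ _ (hle m') _ _ lvl).
  - have -> : (fun x => cabs (dconvolution (mPsi Psi0 L m') T x)) = (fun x =>
      Num.sqrt (tconv (cRe g) (fun i => Psi Psi0 L (m' i)) x ^+ 2 +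
                tconv (cIm g) (fun i => Psi Psi0 L (m' i)) x ^+ 2)).
      by apply/funext => x; rewrite (dconvolution_tconv gT sm b0).
    apply: measurableT_comp.
      by apply: continuous_measurable_fun; exact: sqrt_continuous.
    by apply: measurable_funD; apply: measurable_funX;
      [case: (@kernd_tconv R _ _ _ kr (fun i => kP (m' i)))|case: (@kernd_tconv R _ _ _ ki (fun i => kP (m' i)))].
  - exact: kernd_tconv.
  - move=> x wx; rewrite -(tconv_window f0 P0) wx mulr0//.
  - exact: powR_ge0.
have dE (m' : {ffun 'I_k.+1 -> nat}) x := dconvolution_tconv gT sm b0 L m' x.
apply: le_trans (quadrature_error_le _ _) _.
rewrite !Rintegral_cube// mulr2n mulrDl mul1r; apply: lerD.
  apply: (hC N (cRe g) N0 cr kr (cubeE _ vr) (boundary_vanish cr vr)) => m.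
  by apply: key => // m' x; rewrite dE; exact: (Re_le_cabs (_ +i* _)).
apply: (hC N (cIm g) N0 ci ki (cubeE _ vi) (boundary_vanish ci vi)) => m.
by apply: key => // m' x; rewrite dE; exact: (Im_le_cabs (_ +i* _)).
Qed.
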